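(* Let $L>0$ and let $\gamma\colon [0,L]\to\mathbb{R}^{3}$ be a $\mathcal{C}^{3}$ simple closed convex curve with unit speed and nowhere vanishing curvature. If no plane in $\mathbb{R}^3$ intersects $\gamma$ in more than four points (counted with multiplicity), then $$\operatorname{vol}(\operatorname{conv}(\gamma)) = \frac{1}{24}\int_{0}^{L}\int_{0}^{L} \lvert \det(\gamma'(t_{1}), \gamma'(t_{2}), \gamma(t_{1}) - \gamma(t_{2}))\rvert\, dt_{1}\, dt_{2}.$$
   Context: A $\mathcal{C}^3$ curve $\gamma\colon[0,L]\to\mathbb{R}^3$ is closed if $\gamma^{(h)}(0)=\gamma^{(h)}(L)$ for all $0\le h\leq 3$, and simple if it is injective on $[0,L)$. $\operatorname{conv}(\gamma)$ denotes the convex hull of the image $\gamma([0,L])$. The curve is called convex if it lies on the boundary of its convex hull, i.e., $\gamma([0,L])\subset\partial\operatorname{conv}(\gamma)$. Unit speed means $\lVert\gamma'(t)\rVert=1$ for all $t$; nowhere vanishing curvature then means $\gamma''(t)\neq 0$ for all $t$. $\operatorname{vol}$ denotes volume (three-dimensional Lebesgue measure). Multiplicity is the order of contact: for a plane $\{x\in\mathbb{R}^3:\langle x,\nu\rangle=c\}$ with $\nu\neq0$, put $f(t)=\langle\gamma(t),\nu\rangle-c$; the multiplicity of an intersection point $\gamma(t_0)$, $t_0\in[0,L)$, $f(t_0)=0$, is the least $m\in\{1,2,3\}$ with $f^{(m)}(t_0)\neq0$, and it is counted as $4$ if $f'(t_0)=f''(t_0)=f'''(t_0)=0$. The number of intersection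 points counted with multiplicity is the sum of these multiplicities over all $t_0\in[0,L)$ with $f(t_0)=0$. *)

(* Defs.v *)
From HB Require Import structures.
From mathcomp Require Import all_boot all_order all_algebra.
From mathcomp Require Import all_classical all_reals all_analysis.

Set Implicit Arguments.
Unset Strict Implicit.
Unset Printing Implicit Defensive.

Import Order.TTheory GRing.Theory Num.Theory.
Import numFieldNormedType.Exports.

Local Open Scope classical_set_scope.
Local Open Scope ring_scope.

(* Derivatives relative to a set D: only the values of f on D matter, so that
   on D = [a, b] they are one-sided at the endpoints.  A function on [a, b] is
   represented by a total function on R whose values outside are irrelevant. *)

Definition within_quotient (R : realType) (V : normedModType R) (D : set R)
    (f : R -> V) (t : R) : set_system V :=
  (fun h => h^-1 *: (f (h + t) - f t)) @ within (fun h => D (h + t)) 0^'.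

Definition derivable_in (R : realType) (V : normedModType R) (D : set R)
    (f : R -> V) : Prop :=
  forall t, D t -> cvg (within_quotient D f t).

Definition derive1_in (R : realType) (V : normedModType R) (D : set R)
    (f : R -> V) : R -> V :=
  fun t => lim (within_quotient D f t).

Definition derive1n_in (R : realType) (V : normedModType R) (D : set R)
    (n : nat) (f : R -> V) : R -> V :=
  iter n (derive1_in D) f.

Definition is_Ck (R : realType) (V : normedModType R) (k : nat) (D : set R)
    (f : R -> V) : Prop :=
  (forall h, (h < k)%N -> derivable_in D (derive1n_in D h f)) /\
  {within D, continuous (derive1n_in D k f)}.

(* The library norm on 'rV is the sup norm, hence an explicit Euclidean one. *)

Definition dot (R : realType) (u v : 'rV[R]_3) : R :=
  \sum_(i < 3) u ord0 i * v ord0 i.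

Definition enorm (R : realType) (u : 'rV[R]_3) : R := Num.sqrt (dot u u).

(* u, v, w are the columns. *)
Definition det3 (R : realType) (u v w : 'rV[R]_3) : R :=
  \det (\matrix_(i < 3, j < 3) [:: u; v; w]`_j ord0 i).

Definition row3 (R : realType) (x y z : R) : 'rV[R]_3 :=
  \row_(i < 3) [:: x; y; z]`_i.

Definition vol (R : realType) (A : set 'rV[R]_3) : \bar R :=
  ((@lebesgue_measure R \x @lebesgue_measure R) \x @lebesgue_measure R)%E
    [set p | A (row3 p.1.1 p.1.2 p.2)].

Definition convex_hull (R : realType) (A : set 'rV[R]_3) : set 'rV[R]_3 :=
  smallest (@convex_set R 'rV[R]_3) A.

Definition boundary (T : topologicalType) (A : set T) : set T :=
  closure A `\` A°.

Definition curve_hull (R : realType) (L : R) (gamma : R -> 'rV[R]_3) :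
    set 'rV[R]_3 :=
  convex_hull (gamma @` `[0, L]).

Definition closed_curve (R : realType) (L : R) (gamma : R -> 'rV[R]_3) : Prop :=
  forall h, (h <= 3)%N ->
    derive1n_in `[0, L] h gamma 0 = derive1n_in `[0, L] h gamma L.

Definition simple_curve (R : realType) (L : R) (gamma : R -> 'rV[R]_3) : Prop :=
  {in `[0, L[ &, injective gamma}.

Definition convex_curve (R : realType) (L : R) (gamma : R -> 'rV[R]_3) : Prop :=
  gamma @` `[0, L] `<=` boundary (curve_hull L gamma).

Definition unit_speed (R : realType) (L : R) (gamma : R -> 'rV[R]_3) : Prop :=
  forall t, t \in `[0, L] -> enorm (derive1n_in `[0, L] 1 gamma t) = 1.

Definition nonvanishing_curvature (R : realType) (L : R)
    (gamma : R -> 'rV[R]_3) : Prop :=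
  forall t, t \in `[0, L] -> derive1n_in `[0, L] 2 gamma t != 0.

Definition plane_fun (R : realType) (gamma : R -> 'rV[R]_3) (nu : 'rV[R]_3)
    (c : R) : R -> R :=
  fun t => dot (gamma t) nu - c.

(* Order of contact of f at a zero t, capped at 4. *)
Definition multiplicity (R : realType) (L : R) (f : R -> R) (t : R) : nat :=
  if derive1n_in (`[0, L] : set R) 1 f t != 0 then 1%N
  else if derive1n_in (`[0, L] : set R) 2 f t != 0 then 2%N
  else if derive1n_in (`[0, L] : set R) 3 f t != 0 then 3%N
  else 4%N.

Definition plane_params (R : realType) (L : R) (gamma : R -> 'rV[R]_3)
    (nu : 'rV[R]_3) (c : R) : set R :=
  `[0, L[ `&` [set t | plane_fun gamma nu c t = 0].

(* Extended-real valued: +oo when there are infinitely many intersections. *)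
Definition plane_count (R : realType) (L : R) (gamma : R -> 'rV[R]_3)
    (nu : 'rV[R]_3) (c : R) : \bar R :=
  (\esum_(t in plane_params L gamma nu c)
    ((multiplicity L (plane_fun gamma nu c) t)%:R)%:E)%E.

(* Main.v *)
(* Inscribe closed polygons x_0, ..., x_(n-1) in general position in gamma, with
   mesh tending to 0.  A plane meets gamma in at most four points, so an affine
   function cannot alternate in sign along six cyclically ordered vertices.
   Hence every facet of the hull of the polygon is a triangle with an edge
   [x_j, x_(j+1)], and whether x_j, x_(j+1), x_k span a facet is decided by the
   sides on which the two neighbours of x_k lie.  Expanding each tetrahedron
   x_i, x_(i+1), x_j, x_(j+1) with respect to x_0 and summing by parts therefore
   leaves exactly the facets coned from x_0:
     vol conv(x) = 1/24 sum_(i,j) |det(x_i, x_(i+1), x_j, x_(j+1))|.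
   As the mesh tends to 0, the right-hand side is a Riemann sum of the double
   integral, and conv(x) contains homothetic copies of conv(gamma) of ratio
   tending to 1. *)

Require Import Defs.
From HB Require Import structures.
From mathcomp Require Import all_boot all_order all_algebra all_fingroup.
From mathcomp Require Import all_classical all_reals all_analysis.
From mathcomp Require Import measurable_realfun ring lra zify.

Set Implicit Arguments.
Unset Strict Implicit.
Unset Printing Implicit Defensive.

Import Order.TTheory GRing.Theory Num.Theory.
Import numFieldNormedType.Exports.

Local Open Scope classical_set_scope.
Local Open Scope ring_scope.

(** * Linear change of variables in dimension three *)

(** The constant is 24 = 6 * 2 * 2. A simplex coned from [x_0] has volume one sixth of a
    determinant; expanding a tetrahedron yields one contribution for each of its two polygon edges,
    which symmetry in i and j turns into a factor 2; and a facet collects two equal signs, one from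
    either neighbour, while opposite signs cancel. That the cones from [x_0] over the facets tile
    the hull is obtained without a theory of faces. A point of the hull off the finitely many planes
    through [x_0] and two other vertices is a positive combination of three vectors leading from
    [x_0] to vertices. A triple of least total weight is an optimal basis of a linear program, and
    dual feasibility states exactly that the plane of the triple supports the polygon. Two facets
    whose cones contain the point assign it the same weight, and then they coincide. General
    position keeps the pivots nondegenerate and the signs strict. The hull of the curve is
    measurable by the same approximation: it is closed and squeezed between polygonal hulls and
    their homothetic enlargements. *)

Lemma scaled_pushforward_measure (R : realType) (d1 d2 : measure_display)
  (X : measurableType d1) (Y : measurableType d2)
  (m : {measure set X -> \bar R}) (f : X -> Y) (r : R) :
  measurable_fun setT f -> 0 <= r ->
  exists mu : {measure set Y -> \bar R}, forall A, mu A = (r%:E * m (f @^-1` A))%E.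
Proof.
move=> mf r0; pose nu := measure_function_pushforward__canonical__measure_function_Measure m mf.
by exists [the measure _ _ of mscale (NngNum r0) nu].
Qed.

(** The scaled pushforward is again a measure, so it suffices to compare it with Lebesgue measure on
    the intervals []a, b]]. For negative [c] the preimage is half-open on the other side, hence the
    two cases. *)
Lemma lebesgue_measure_affine (R : realType) (c d : R) (A : set R) :
  c != 0 -> measurable A ->
  (lebesgue_measure ((fun z : R => (c * z + d)%R) @^-1` A) * `|c|%:E =
   lebesgue_measure A)%E.
Proof.
move=> c0 mA.
pose f : measurableTypeR R -> measurableTypeR R := fun z => c * z + d.
have mf : measurable_fun [set: measurableTypeR R] f.
  by apply: measurable_funD => //; apply: measurable_funM.
have [mu muE] := scaled_pushforward_measure (@lebesgue_measure R) mf (normr_ge0 c).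
have -> : lebesgue_measure A = mu A.
  apply: lebesgue_measure_unique => //.
  move=> _ /= [[a b]] _ <-.
  rewrite muE /=.
  have [c1|c1] := ltP 0 c.
    rewrite (_ : f @^-1` _ = `](a - d) / c, (b - d) / c]%classic); last first.
      apply/seteqP; split => x /=; rewrite !in_itv/= /f => /andP[].
        by rewrite ltr_pdivrMr// ler_pdivlMr// => ? ?; apply/andP; split; lra.
      by rewrite ltr_pdivrMr// ler_pdivlMr// => ? ?; apply/andP; split; lra.
    rewrite !lebesgue_measure_itv/= !lte_fin ltr_pM2r ?invr_gt0// ltrD2r.
    case: ifPn => _; last by rewrite mule0.
    rewrite -!EFinB -EFinM gtr0_norm//; congr (_%:E); field; lra.
  have {}c1 : c < 0 by rewrite lt_neqAle c0.
  rewrite (_ : f @^-1` _ = `[(b - d) / c, (a - d) / c[%classic); last first.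
    apply/seteqP; split => x /=; rewrite !in_itv/= /f => /andP[].
      by rewrite ltr_ndivlMr// ler_ndivrMr// => ? ?; apply/andP; split; lra.
    by rewrite ltr_ndivlMr// ler_ndivrMr// => ? ?; apply/andP; split; lra.
  rewrite !lebesgue_measure_itv/= !lte_fin ltr_nM2r ?invr_lt0// ltrD2r.
  case: ifPn => _; last by rewrite mule0.
  rewrite -!EFinB -EFinM ltr0_norm//; congr (_%:E); field; lra.
by rewrite muE muleC.
Qed.

Lemma measurable_preimage (d1 d2 : measure_display) (X : measurableType d1)
  (Y : measurableType d2) (f : X -> Y) (A : set Y) :
  measurable_fun setT f -> measurable A -> measurable (f @^-1` A).
Proof. by move=> mf mA; rewrite -[X in measurable X]setTI; exact: mf. Qed.

Definition swap12 {T : Type} (p : T * T * T) := ((p.1.2, p.1.1), p.2).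
Definition swap23 {T : Type} (p : T * T * T) := ((p.1.1, p.2), p.1.2).

Section product_swaps.
Variables (R : realType) (d : measure_display) (T : measurableType d).
Variable m : {sigma_finite_measure set T -> \bar R}.

Lemma product_measure_swap (A : set (T * T)) : measurable A ->
  (m \x m)%E ((fun p => (p.2, p.1)) @^-1` A) = (m \x m)%E A.
Proof.
move=> mA; pose f (p : T * T) := (p.2, p.1).
have mf : measurable_fun setT f by exact/measurable_fun_pair.
have [mu muE] := scaled_pushforward_measure (m \x m)%E mf ler01.
have -> : (m \x m)%E A = mu A.
  apply: product_measure_unique => // A1 A2 mA1 mA2.
  rewrite muE mul1e (_ : f @^-1` _ = A2 `*` A1); last first.
    by apply/seteqP; split => -[x y] [].
  by rewrite [LHS]product_measure1E// muleC.
by rewrite muE mul1e.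
Qed.

Lemma sigma_finite_square : sigma_finite setT (m \x m)%E.
Proof.
have /sigma_finiteP[F [TF ndF Foo]] := sigma_finiteT m.
exists (fun n => F n `*` F n).
  rewrite -setXTT TF predeqE => -[x y]; split.
    move=> [/= [n _ Fnx] [k _ Gky]]; exists (maxn n k) => //; split.
    - by move: x Fnx; exact/subsetPset/ndF/leq_maxl.
    - by move: y Gky; exact/subsetPset/ndF/leq_maxr.
  by move=> [n _ []/= ? ?]; split; exists n.
move=> k; have [? ?] := Foo k.
split; first exact: measurableX.
by rewrite product_measure1E// lte_mul_pinfty// ge0_fin_numE.
Qed.

Definition square_isSigmaFinite :=
  Measure_isSigmaFinite.Build _ _ _ (m \x m)%E sigma_finite_square.

(** Uniqueness of the product [(m \x m) \x m] is invoked with [m \x m] as first factor, which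
    therefore has to carry a sigma-finite structure. *)
Definition square_measure : {sigma_finite_measure set (T * T)%type -> \bar R} :=
  HB.pack (m \x m)%E square_isSigmaFinite.

Lemma measurable_fst1 : measurable_fun [set: T * T * T] (fun p => p.1.1).
Proof. exact: (measurableT_comp measurable_fst measurable_fst). Qed.

Lemma measurable_fst2 : measurable_fun [set: T * T * T] (fun p => p.1.2).
Proof. exact: (measurableT_comp measurable_snd measurable_fst). Qed.

Lemma measurable_swap12 : measurable_fun [set: T * T * T] swap12.
Proof.
apply/measurable_fun_pair => //; apply/measurable_fun_pair.
  exact: measurable_fst2.
exact: measurable_fst1.
Qed.

Lemma measurable_swap23 : measurable_fun [set: T * T * T] swap23.
Proof.
apply/measurable_fun_pair; last exact: measurable_fst2.
by apply/measurable_fun_pair => //; exact: measurable_fst1.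
Qed.

Lemma product_measure_swap12 (A : set (T * T * T)) : measurable A ->
  ((m \x m) \x m)%E (swap12 @^-1` A) = ((m \x m) \x m)%E A.
Proof.
move=> mA.
have [mu muE] := scaled_pushforward_measure ((m \x m) \x m)%E measurable_swap12 ler01.
have -> : ((m \x m) \x m)%E A = mu A.
  apply: (product_measure_unique (m1 := square_measure) (m2 := m) (m' := mu)) => // A1 A2 mA1 mA2.
  rewrite muE mul1e (_ : swap12 @^-1` _ = ((fun p => (p.2, p.1)) @^-1` A1) `*` A2).
    rewrite [LHS]product_measure1E//.
      by congr (_ * _)%E; exact: product_measure_swap.
    have mf : measurable_fun setT (fun p : T * T => (p.2, p.1)) by exact/measurable_fun_pair.
    exact: (measurable_preimage mf mA1).
  by apply/seteqP; split => -[[x y] z] [].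
by rewrite muE mul1e.
Qed.

(** By uniqueness only [A1 * A2] has to be measured, but [A1] is an arbitrary planar set, so the
    preimage is no product. Its section over [(x, y)] is the section of [A1] over [x] if [y] is in
    [A2] and empty otherwise, and Tonelli separates the two variables. *)
Lemma product_measure_swap23 (A : set (T * T * T)) : measurable A ->
  ((m \x m) \x m)%E (swap23 @^-1` A) = ((m \x m) \x m)%E A.
Proof.
move=> mA.
have [mu muE] := scaled_pushforward_measure ((m \x m) \x m)%E measurable_swap23 ler01.
have -> : ((m \x m) \x m)%E A = mu A.
  apply: (product_measure_unique (m1 := square_measure) (m2 := m) (m' := mu)) => // A1 A2 mA1 mA2.
  rewrite muE mul1e.
  transitivity (\int[m \x m]_q ((\1_A2 q.2)%:E * m (xsection A1 q.1)))%E.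
    apply: eq_integral => -[x y] _ /=; rewrite indicE.
    have [yA2|yA2] := boolP (y \in A2); rewrite /= ?mul1e ?mul0e.
      congr (m _); apply/seteqP; split=> z; rewrite /xsection /= !inE.
        by case.
      by move=> ?; split => //=; exact/set_mem.
    rewrite (_ : xsection _ _ = set0) ?measure0//.
    apply/seteqP; split=> z //; rewrite /xsection /= !inE /= => -[_] /=.
    by move/mem_set; apply/negP.
  have mF : measurable_fun setT (fun q : T * T => ((\1_A2 q.2)%:E * m (xsection A1 q.1))%E).
    apply: emeasurable_funM.
      apply/measurable_EFinP.
      have mB := measurable_preimage (@measurable_snd _ _ T T) mA2.
      exact: (measurable_indic mB).
    by apply: (measurableT_comp (measurable_fun_xsection _ mA1)).
  rewrite (fubini_tonelli1 _ mF)//=; last by move=> q; rewrite mule_ge0.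
  rewrite /fubini_F /= -ge0_integralZr//; last exact: measurable_fun_xsection.
  apply: eq_integral => x _; rewrite ge0_integralZr//.
    by rewrite integral_indic// setIT muleC.
  by apply/measurable_EFinP.
by rewrite muE mul1e.
Qed.

End product_swaps.

Notation lam2 R := (@lebesgue_measure R \x @lebesgue_measure R)%E.
Notation lam3 R := (lam2 R \x @lebesgue_measure R)%E.

Section linear_change.
Variable R : realType.
Local Notation T3 := (measurableTypeR R * measurableTypeR R * measurableTypeR R)%type.

(** The maps for which the change of variables reduces to the line: the first two coordinates are
    parameters, and over each of them the last one undergoes an affine map of slope [c]. The
    constant [d] serves the translations. *)
Definition last_row (a b c d : R) (p : T3) : T3 :=
  (p.1, a * p.1.1 + b * p.1.2 + c * p.2 + d).

Lemma measurable_last_row a b c d : measurable_fun setT (last_row a b c d).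
Proof.
apply/measurable_fun_pair => //.
apply: measurable_funD => //; apply: measurable_funD; last exact: measurable_funM.
by apply: measurable_funD; apply: measurable_funM => //;
  [exact: measurable_fst1|exact: measurable_fst2].
Qed.

Lemma lam3E (A : set T3) : (lam3 R A = \int[lam2 R]_x lebesgue_measure (xsection A x))%E.
Proof. by []. Qed.

Lemma lam3_last_row a b c d (A : set T3) : c != 0 -> measurable A ->
  (lam3 R (last_row a b c d @^-1` A) * `|c|%:E = lam3 R A)%E.
Proof.
move=> c0 mA; have mA' := measurable_preimage (measurable_last_row a b c d) mA.
rewrite !lam3E -(@ge0_integralZr _ _ _ _ _ measurableT)//; last first.
  exact: measurable_fun_xsection.
apply: eq_integral => -[x y] _ /=.
rewrite -(lebesgue_measure_affine (a * x + b * y + d) c0 (measurable_xsection (x, y) mA)).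
congr (lebesgue_measure _ * _)%E; apply/seteqP; split => z;
  by rewrite /xsection /= !inE /last_row /= (_ : c * z + _ = a * x + b * y + c * z + d) //; ring.
Qed.

Lemma lam3_swap12 (A : set T3) : measurable A -> lam3 R (swap12 @^-1` A) = lam3 R A.
Proof. exact: (product_measure_swap12 (@lebesgue_measure R)). Qed.

Lemma lam3_swap23 (A : set T3) : measurable A -> lam3 R (swap23 @^-1` A) = lam3 R A.
Proof. exact: (product_measure_swap23 (@lebesgue_measure R)). Qed.

End linear_change.

Notation i0 := (@Ordinal 3 0 isT).
Notation i1 := (@Ordinal 3 1 isT).
Notation i2 := (@Ordinal 3 2 isT).

Lemma big_ord3 (V : nmodType) (F : 'I_3 -> V) : \sum_(i < 3) F i = F i0 + F i1 + F i2.
Proof.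
rewrite !big_ord_recr big_ord0 /= add0r.
by congr (F _ + F _ + F _); apply/val_inj.
Qed.

Lemma det22 (R : comNzRingType) (M : 'M[R]_2) :
  \det M = M ord0 ord0 * M ord_max ord_max - M ord0 ord_max * M ord_max ord0.
Proof.
rewrite (expand_det_row _ ord0) !big_ord_recl big_ord0 addr0 /cofactor !det_mx11 !mxE /=.
rewrite expr0 expr1 mul1r mulN1r mulrN.
by congr (_ * M _ _ - M _ _ * M _ _); apply/val_inj.
Qed.

Lemma det33 (R : comNzRingType) (M : 'M[R]_3) : \det M =
  M i0 i0 * (M i1 i1 * M i2 i2 - M i1 i2 * M i2 i1)
  - M i0 i1 * (M i1 i0 * M i2 i2 - M i1 i2 * M i2 i0)
  + M i0 i2 * (M i1 i0 * M i2 i1 - M i1 i1 * M i2 i0).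
Proof.
rewrite (expand_det_row _ i0) big_ord3 /cofactor !det22 !mxE /=.
have l00 : lift i0 ord0 = i1 by exact/val_inj.
have l01 : lift i0 ord_max = i2 by exact/val_inj.
have l10 : lift i1 ord0 = i0 by exact/val_inj.
have l11 : lift i1 ord_max = i2 by exact/val_inj.
have l20 : lift i2 ord0 = i0 by exact/val_inj.
have l21 : lift i2 ord_max = i1 by exact/val_inj.
rewrite l00 l01 l10 l11 l20 l21 /=.
rewrite (_ : (0 + 0 = 0)%N) // (_ : (0 + 1 = 1)%N) // (_ : (0 + 2 = 2)%N) // expr0 expr1 sqrrN expr1n; ring.
Qed.

Lemma eq_mx3 (R : Type) (M N : 'M[R]_3) :
  M i0 i0 = N i0 i0 -> M i0 i1 = N i0 i1 -> M i0 i2 = N i0 i2 ->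
  M i1 i0 = N i1 i0 -> M i1 i1 = N i1 i1 -> M i1 i2 = N i1 i2 ->
  M i2 i0 = N i2 i0 -> M i2 i1 = N i2 i1 -> M i2 i2 = N i2 i2 -> M = N.
Proof.
move=> *; apply/matrixP => -[[|[|[|//]]] i3] -[[|[|[|//]]] j3];
by rewrite (bool_irrelevance i3 isT) (bool_irrelevance j3 isT).
Qed.

Definition mx3 (R : Type) (x0 : R) (s : seq (seq R)) : 'M[R]_3 :=
  \matrix_(i, j) nth x0 (nth [::] s i) j.

Lemma lup_decomposition (F : fieldType) (n : nat) (M : 'M[F]_n.+1) :
  exists (s : {perm 'I_n.+1}) (L U : 'M[F]_n.+1),
    [/\ forall i j : 'I_n.+1, (j < i)%N -> U i j = 0, forall i j : 'I_n.+1, (i <= j)%N -> L i j = (i == j)%:R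
      & M = perm_mx s *m L *m U].
Proof.
have := cormen_lup_correct M; have := cormen_lup_perm M.
have := @cormen_lup_lower _ _ M; have := @cormen_lup_upper _ _ M.
case: (cormen_lup M) => -[P L] U /= up lo /is_perm_mxP[s Ps] E; rewrite {}Ps in E.
exists s^-1%g, L, U; split => //.
by rewrite -mulmxA -[L *m U]E -[_ * M]/(_ *m M) mulmxA -perm_mxM mulVg perm_mx1 mul1mx.
Qed.

Section mx_change.
Variable R : realType.
Local Notation T3 := (measurableTypeR R * measurableTypeR R * measurableTypeR R)%type.

Definition act (M : 'M[R]_3) (p : T3) : T3 :=
  ((M i0 i0 * p.1.1 + M i0 i1 * p.1.2 + M i0 i2 * p.2,
    M i1 i0 * p.1.1 + M i1 i1 * p.1.2 + M i1 i2 * p.2),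
   M i2 i0 * p.1.1 + M i2 i1 * p.1.2 + M i2 i2 * p.2).

Lemma act_mul M N p : act (M *m N) p = act M (act N p).
Proof. by rewrite /act /= !mxE !big_ord3; congr (_, _, _); ring. Qed.

Lemma measurable_act M : measurable_fun setT (act M).
Proof.
have mlin a b c : measurable_fun [set: T3] (fun p : T3 => a * p.1.1 + b * p.1.2 + c * p.2).
  by apply: measurable_funD; [apply: measurable_funD|]; apply: measurable_funM => //;
    [exact: measurable_fst1|exact: measurable_fst2].
apply/measurable_fun_pair; last exact: mlin.
by apply/measurable_fun_pair; exact: mlin.
Qed.

(* By LUP decomposition it is enough to treat permutations and maps changing only
   the last coordinate. *)
Definition scales M := forall A, measurable A ->
  (lam3 R (act M @^-1` A) * `|\det M|%:E = lam3 R A)%E.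

Lemma scales_mul M N : scales M -> scales N -> scales (M *m N).
Proof.
move=> sM sN A mA; have mA' := measurable_preimage (measurable_act M) mA.
rewrite -(sM _ mA) -(sN _ mA') det_mulmx normrM mulrC EFinM muleA.
congr (lam3 R _ * _ * _)%E; apply/seteqP; split=> p /=; by rewrite act_mul.
Qed.

Lemma scales_last_row a b c : c != 0 -> scales (mx3 0 [:: [:: 1; 0; 0]; [:: 0; 1; 0]; [:: a; b; c]]).
Proof.
move=> c0 A mA; rewrite det33 !mxE /= -(lam3_last_row a b 0 c0 mA).
congr (lam3 R _ * _)%E; last by congr (`|_|%:E); ring.
apply/seteqP; split=> -[[x y] z]; rewrite /last_row /act /= !mxE /=.
  by rewrite !mul1r !mul0r !addr0 add0r.
by rewrite !mul1r !mul0r !addr0 add0r.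
Qed.

Lemma scales_swap12 : scales (mx3 0 [:: [:: 0; 1; 0]; [:: 1; 0; 0]; [:: 0; 0; 1]]).
Proof.
move=> A mA; rewrite det33 !mxE /= -(lam3_swap12 mA).
rewrite (_ : `|_| = 1); last by rewrite !(mul0r, mulr0, subr0, sub0r, addr0, mul1r) normrN1.
rewrite mule1.
congr (lam3 R _)%E; apply/seteqP; split=> -[[x y] z]; rewrite /swap12 /act /= !mxE /=;
  by rewrite !mul1r !mul0r !addr0 !add0r.
Qed.

Lemma scales_swap23 : scales (mx3 0 [:: [:: 1; 0; 0]; [:: 0; 0; 1]; [:: 0; 1; 0]]).
Proof.
move=> A mA; rewrite det33 !mxE /= -(lam3_swap23 mA).
rewrite (_ : `|_| = 1); last by rewrite !(mul0r, mulr0, subr0, sub0r, addr0, mul1r) normrN1.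
rewrite mule1.
congr (lam3 R _)%E; apply/seteqP; split=> -[[x y] z]; rewrite /swap23 /act /= !mxE /=;
  by rewrite !mul1r !mul0r !addr0 !add0r.
Qed.

Lemma scales_swap13 : scales (mx3 0 [:: [:: 0; 0; 1]; [:: 0; 1; 0]; [:: 1; 0; 0]]).
Proof.
have := scales_mul (scales_mul scales_swap12 scales_swap23) scales_swap12.
congr scales; apply: eq_mx3; rewrite !mxE !big_ord3 !mxE !big_ord3 !mxE /=; ring.
Qed.

Lemma scales_lower (M : 'M[R]_3) : M i0 i1 = 0 -> M i0 i2 = 0 -> M i1 i2 = 0 ->
  M i0 i0 != 0 -> M i1 i1 != 0 -> M i2 i2 != 0 -> scales M.
Proof.
move=> M01 M02 M12 M00 M11 M22.
have d1 : scales (mx3 0 [:: [:: M i0 i0; 0; 0]; [:: 0; 1; 0]; [:: 0; 0; 1]]).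
  have := scales_mul (scales_mul scales_swap13 (scales_last_row 0 0 M00)) scales_swap13.
  congr scales; apply: eq_mx3; rewrite !mxE !big_ord3 !mxE !big_ord3 !mxE /=; ring.
have d2 : scales (mx3 0 [:: [:: 1; 0; 0]; [:: M i1 i0 / M i0 i0; M i1 i1; 0]; [:: 0; 0; 1]]).
  have := scales_mul (scales_mul scales_swap23 (scales_last_row (M i1 i0 / M i0 i0) 0 M11)) scales_swap23.
  congr scales; apply: eq_mx3; rewrite !mxE !big_ord3 !mxE !big_ord3 !mxE /=; ring.
(* The factors act from the right, so the last row is applied to coordinates already changed by [d1]
   and [d2]; its entries are corrected for that. *)
have := scales_mul (scales_mul (scales_last_row
  ((M i2 i0 - M i2 i1 / M i1 i1 * M i1 i0) / M i0 i0) (M i2 i1 / M i1 i1) M22) d2) d1.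
congr scales; apply: eq_mx3; rewrite !mxE !big_ord3 !mxE !big_ord3 !mxE /= ?M01 ?M02 ?M12;
  field; by rewrite ?M00 ?M11.
Qed.

(** Conjugation by the exchange of the first and the last coordinate reverses rows and columns and
    turns an upper triangular matrix into a lower one. *)
Lemma scales_upper (M : 'M[R]_3) : M i1 i0 = 0 -> M i2 i0 = 0 -> M i2 i1 = 0 ->
  M i0 i0 != 0 -> M i1 i1 != 0 -> M i2 i2 != 0 -> scales M.
Proof.
move=> M10 M20 M21 M00 M11 M22.
have lw : scales (mx3 0 [:: [:: M i2 i2; 0; 0]; [:: M i1 i2; M i1 i1; 0]; [:: M i0 i2; M i0 i1; M i0 i0]]).
  by apply: scales_lower; rewrite !mxE.
have := scales_mul (scales_mul scales_swap13 lw) scales_swap13.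
congr scales; apply: eq_mx3; rewrite !mxE !big_ord3 !mxE !big_ord3 !mxE /= ?M10 ?M20 ?M21; ring.
Qed.

Lemma scales_perm (s : {perm 'I_3}) : scales (perm_mx s).
Proof.
have s1 : scales 1%:M.
  have := scales_mul scales_swap13 scales_swap13.
  congr scales; apply: eq_mx3; rewrite !mxE !big_ord3 !mxE /=; ring.
have tp i j : scales (perm_mx (tperm i j)).
  have [->|] := eqVneq i j; first by rewrite tperm1 perm_mx1.
  case: i => -[|[|[|//]]] i3; case: j => -[|[|[|//]]] j3 // _;
  [move: scales_swap12 | move: scales_swap13 | move: scales_swap12 |
   move: scales_swap23 | move: scales_swap13 | move: scales_swap23];
  by congr scales; apply: eq_mx3; rewrite !mxE permE.
have [ts -> _] := prod_tpermP s.
elim: ts => [|t ts ih]; first by rewrite big_nil perm_mx1.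
by rewrite big_cons perm_mxM; apply: scales_mul.
Qed.

Lemma scales_unit (M : 'M[R]_3) : \det M != 0 -> scales M.
Proof.
move=> M0; have [s [L [U [z lo E]]]] := lup_decomposition M.
have dU : \det U != 0.
  by apply: contraNneq M0; rewrite E det_mulmx => ->; rewrite mulr0.
rewrite E {E M0}; apply: scales_mul; last first.
  move: dU; rewrite det33 !(z i1 i0, z i2 i0, z i2 i1)// !(mulr0, mul0r, subr0, addr0).
  rewrite !mulf_eq0 !negb_or => /andP[? /andP[? ?]].
  by apply: scales_upper => //; exact: z.
apply: scales_mul; first exact: scales_perm.
by apply: scales_lower; rewrite lo // oner_eq0.
Qed.

End mx_change.

(** * Volumes of simplices, planes and homothetic copies *)

Lemma integral_powB (R : realType) (a : R) (n : nat) : 0 <= a ->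
  (\int[@lebesgue_measure R]_(y in `[0%R, a]) ((a - y) ^+ n)%:E = (a ^+ n.+1 / n.+1%:R)%:E)%E.
Proof.
rewrite le_eqVlt => /predU1P[<-|a0].
  by rewrite set_itv1 integral_set1 expr0n mul0r.
pose F : R -> R := - ((n.+1%:R)^-1 *: ((cst a - id) ^+ n.+1)).
have dF (y : R) : is_derive y 1 F ((a - y) ^+ n).
  apply: is_derive_eq; rewrite sub0r.
  rewrite -2![_ *: _]/(_ * _) mulrN1 mulrN opprK mulrA mulVf ?pnatr_eq0// mul1r.
  by rewrite !fctE.
have cF : continuous F.
  by move=> y; apply: differentiable_continuous; apply/derivable1_diffP; have [] := dF y.
rewrite (@continuous_FTC2 _ (fun y => (a - y) ^+ n) F)//.
- rewrite -EFinB; congr _%:E; rewrite /F !fctE /= subrr subr0 expr0n /= scaler0 oppr0 sub0r opprK.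
  by rewrite -[_ *: _]/(_ * _) mulrC.
- apply: continuous_subspaceT => y.
  apply: (@continuous_comp _ _ _ (fun y => a - y) (fun u => u ^+ n)); last exact: exprn_continuous.
  by apply: cvgB; [exact: cvg_cst|exact: cvg_id].
- by split; [move=> y _; have [] := dF y | exact/cvg_at_right_filter/cF | exact/cvg_at_left_filter/cF].
- by move=> y _; rewrite derive1E; have [_] := dF y.
Qed.

Definition std_simplex (R : realType) : set (measurableTypeR R * measurableTypeR R * measurableTypeR R) :=
  [set p | [&& 0 <= p.1.1, 0 <= p.1.2, 0 <= p.2 & p.1.1 + p.1.2 + p.2 <= 1]].

Section std_simplex.
Variable R : realType.
Local Notation T2 := (measurableTypeR R * measurableTypeR R)%type.
Local Notation T3 := (measurableTypeR R * measurableTypeR R * measurableTypeR R)%type.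

Lemma measurable_std_simplex : measurable (@std_simplex R).
Proof.
rewrite -[X in measurable X]setTI.
have m1 := @measurable_fst1 _ (measurableTypeR R); have m2 := @measurable_fst2 _ (measurableTypeR R).
have m3 : measurable_fun [set: T3] (fun p => p.2) by exact: measurable_snd.
apply: (measurable_and _ (measurable_and _ (measurable_and _ _))) => //.
- exact: measurable_fun_ler.
- exact: measurable_fun_ler.
- exact: measurable_fun_ler.
- by apply: measurable_fun_ler => //; apply: measurable_funD => //; apply: measurable_funD.
Qed.

Lemma lam3_std_simplex : lam3 R (@std_simplex R) = (6^-1)%:E.
Proof.
pose h (q : T2) := lebesgue_measure (xsection (@std_simplex R) q).
have mh : measurable_fun setT h by apply: measurable_fun_xsection; exact: measurable_std_simplex.
rewrite lam3E -/h (fubini_tonelli1 _ mh) /fubini_F; last by move=> q; exact: measure_ge0.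
have hE (x y : R) : h (x, y) = if (0 <= x) && (0 <= y) && (x + y <= 1) then (1 - x - y)%:E else 0%E.
  rewrite /h; have [/andP[/andP[x0 y0] xy]|H] := ifP.
    rewrite (_ : xsection _ _ = `[0, 1 - x - y]%classic); last first.
      apply/seteqP; split=> z; rewrite /xsection /= inE /std_simplex /= in_itv /=.
        by case/and4P => ? ? ? ?; apply/andP; split => //; lra.
      by case/andP => ? ?; apply/and4P; split => //; lra.
    rewrite lebesgue_measure_itv /= lte_fin; case: ifPn => [_|]; first by rewrite sube0.
    by rewrite -leNgt => ?; congr _%:E; lra.
  rewrite (_ : xsection _ _ = set0) ?measure0//.
  apply/seteqP; split=> z //; rewrite /xsection /= inE /std_simplex /= => /and4P[x0 y0 z0 xyz].
  by move: H; rewrite x0 y0 /= => /negP; apply; lra.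
transitivity (\int[@lebesgue_measure R]_(x in `[0%R, 1%R]) ((1 - x) ^+ 2 / 2)%:E)%E.
  rewrite [RHS]integral_mkcond; apply: eq_integral => x _.
  rewrite patchE; have [|] := boolP (x \in `[0, 1]%classic).
    rewrite inE /= in_itv /= => /andP[x0 x1].
    rewrite -(integral_powB 1 (a := 1 - x)) ?subr_ge0//.
    rewrite [RHS]integral_mkcond; apply: eq_integral => y _.
    rewrite hE x0 /= patchE mem_setE in_itv /= -lerBrDl.
    by case: ifP => // _; rewrite expr1.
  rewrite mem_setE in_itv /= => /negP x01.
  rewrite integral0_eq// => y _; rewrite hE; case: ifP => // /andP[/andP[x0 y0] xy].
  by exfalso; apply: x01; rewrite x0 /=; lra.
under eq_integral do rewrite mulrC EFinM.
rewrite ge0_integralZl//=.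
- rewrite (integral_powB 2 ler01) -EFinM; congr _%:E; rewrite expr1n; lra.
- apply/measurable_EFinP; apply: measurable_funX; exact: measurable_funB.
- by move=> x _; rewrite lee_fin sqr_ge0.
Qed.

End std_simplex.

Lemma det3E (R : realType) (u v w : 'rV[R]_3) : det3 u v w =
  u ord0 i0 * (v ord0 i1 * w ord0 i2 - w ord0 i1 * v ord0 i2)
  - v ord0 i0 * (u ord0 i1 * w ord0 i2 - w ord0 i1 * u ord0 i2)
  + w ord0 i0 * (u ord0 i1 * v ord0 i2 - v ord0 i1 * u ord0 i2).
Proof. by rewrite /det3 det33 !mxE. Qed.

Lemma eq_rV3 (R : Type) (u v : 'rV[R]_3) :
  u ord0 i0 = v ord0 i0 -> u ord0 i1 = v ord0 i1 -> u ord0 i2 = v ord0 i2 -> u = v.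
Proof.
move=> *; apply/rowP => -[[|[|[|//]]] i3]; by rewrite (bool_irrelevance i3 isT).
Qed.

Section volumes.
Variable R : realType.
Local Notation T3 := (measurableTypeR R * measurableTypeR R * measurableTypeR R)%type.
Local Notation V := 'rV[R]_3.

Definition of_coords (p : T3) : V := row3 p.1.1 p.1.2 p.2.
Definition coords (u : V) : T3 := ((u ord0 i0, u ord0 i1), u ord0 i2).

Lemma of_coordsK p : coords (of_coords p) = p.
Proof. by case: p => -[x y] z; rewrite /coords /of_coords /row3 !mxE. Qed.

Lemma coordsK u : of_coords (coords u) = u.
Proof. by apply: eq_rV3; rewrite !mxE. Qed.

(** [vol] is evaluated on coordinate triples, so this is the measurability that its additivity and
    its transformation rules ask for. *)
Definition vmeasurable (A : set V) := measurable (of_coords @^-1` A).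

Definition affine (M : 'M[R]_3) (b : V) (u : V) : V := u *m M^T + b.

Definition translate (b : V) (p : T3) : T3 :=
  ((p.1.1 + b ord0 i0, p.1.2 + b ord0 i1), p.2 + b ord0 i2).

Lemma coords_affine M b p :
  coords (affine M b (of_coords p)) = translate b (act M p).
Proof.
rewrite /coords /affine /translate /act /= !mxE !big_ord3 /of_coords !mxE /=.
by congr (_ + _, _ + _, _ + _); ring.
Qed.

Lemma measurable_translate b : measurable_fun setT (translate b).
Proof.
apply/measurable_fun_pair; last by apply: measurable_funD.
by apply/measurable_fun_pair; apply: measurable_funD => //;
  [exact: measurable_fst1|exact: measurable_fst2].
Qed.

Lemma lam3_translate b (A : set T3) : measurable A ->
  lam3 R (translate b @^-1` A) = lam3 R A.
Proof.
move=> mA.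
have one : (1 : R) != 0 by exact: oner_neq0.
have step d (B : set T3) : measurable B -> lam3 R (last_row 0 0 1 d @^-1` B) = lam3 R B.
  by move=> mB; rewrite -(lam3_last_row 0 0 d one mB) normr1 mule1.
have ms d (B : set T3) : measurable B -> measurable (last_row 0 0 1 d @^-1` B).
  by move=> mB; exact: (measurable_preimage (measurable_last_row 0 0 1 d) mB).
have m12 (B : set T3) : measurable B -> measurable (swap12 @^-1` B).
  by move=> mB; exact: (measurable_preimage (@measurable_swap12 _ (measurableTypeR R)) mB).
have m23 (B : set T3) : measurable B -> measurable (swap23 @^-1` B).
  by move=> mB; exact: (measurable_preimage (@measurable_swap23 _ (measurableTypeR R)) mB).
pose fz := last_row 0 0 1 (b ord0 i2).
pose fy := last_row 0 0 1 (b ord0 i1).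
pose fx := last_row 0 0 1 (b ord0 i0).
(* Each coordinate in turn is brought to the last place, shifted there, and brought back. *)
have -> : translate b @^-1` A = swap12 @^-1` (swap23 @^-1` (fx @^-1` (swap23 @^-1` (swap12 @^-1`
   (swap23 @^-1` (fy @^-1` (swap23 @^-1` (fz @^-1` A)))))))).
  by apply/seteqP; split=> -[[x y] z];
    rewrite /fx /fy /fz /swap12 /swap23 /last_row /translate /= !mul0r !mul1r !add0r.
have A1 := ms (b ord0 i2) _ mA.
have A2 := m23 _ A1. have A3 := ms (b ord0 i1) _ A2. have A4 := m23 _ A3.
have A5 := m12 _ A4. have A6 := m23 _ A5. have A7 := ms (b ord0 i0) _ A6.
have A8 := m23 _ A7.
rewrite (lam3_swap12 A8) (lam3_swap23 A7) (step _ _ A6) (lam3_swap23 A5) (lam3_swap12 A4).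
by rewrite (lam3_swap23 A3) (step _ _ A2) (lam3_swap23 A1) (step _ _ mA).
Qed.

Lemma of_coords_affine M b A :
  of_coords @^-1` (affine M b @^-1` A) = act M @^-1` (translate b @^-1` (of_coords @^-1` A)).
Proof.
apply/seteqP; split=> p /=; by rewrite -coords_affine coordsK.
Qed.

Lemma vmeasurable_affine M b A : vmeasurable A -> vmeasurable (affine M b @^-1` A).
Proof.
move=> mA; rewrite /vmeasurable of_coords_affine.
exact: (measurable_preimage (measurable_act M) (measurable_preimage (measurable_translate b) mA)).
Qed.

Lemma vol_affine M b A : \det M != 0 -> vmeasurable A ->
  (vol (affine M b @^-1` A) * `|\det M|%:E = vol A)%E.
Proof.
move=> M0 mA.
have -> : vol (affine M b @^-1` A) = lam3 R (act M @^-1` (translate b @^-1` (of_coords @^-1` A))).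
  by rewrite -of_coords_affine.
rewrite (scales_unit M0 (measurable_preimage (measurable_translate b) mA)).
by rewrite (lam3_translate b mA).
Qed.

(** The solid simplex with vertices [o], [o + u], [o + v] and [o + w]. *)
Definition cone (o u v w : V) : set V :=
  [set p | exists a b c, [/\ 0 <= a, 0 <= b, 0 <= c, a + b + c <= 1 & p = o + a *: u + b *: v + c *: w]].

(** Cramer's rule for the coordinates of [p - o] in the basis [u, v, w]; they carry [cone o u v w]
    onto the standard simplex. *)
Definition basis_change (o u v w p : V) : V :=
  row3 (det3 (p - o) v w / det3 u v w) (det3 u (p - o) w / det3 u v w) (det3 u v (p - o) / det3 u v w).

Lemma basis_changeE o u v w : det3 u v w != 0 -> exists M b,
  [/\ forall p, basis_change o u v w p = affine M b p & \det M = (det3 u v w)^-1].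
Proof.
move=> D0; pose U := \matrix_(i < 3, j < 3) [:: u; v; w]`_j ord0 i.
have Uu : U \in unitmx by rewrite unitmxE unitfE.
exists (invmx U), (- o *m (invmx U)^T); split; last exact: det_inv.
move=> p; rewrite /affine -mulmxDl.
apply: (can_inj (mulmxK (_ : U^T \in unitmx))); first by rewrite unitmx_tr.
rewrite -mulmxA -trmx_mul mulmxV // trmx1 mulmx1.
have := D0; rewrite det3E => D0'.
by apply: eq_rV3; rewrite !mxE !big_ord3 /basis_change !mxE /= !det3E !mxE; field.
Qed.

Lemma basis_change_lin o u v w a b c : det3 u v w != 0 ->
  basis_change o u v w (o + a *: u + b *: v + c *: w) = row3 a b c.
Proof.
move=> D0; have := D0; rewrite det3E => D0'.
by apply: eq_rV3; rewrite /basis_change !mxE /= !det3E !mxE; field.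
Qed.

Lemma basis_changeK o u v w p (x := basis_change o u v w p) : det3 u v w != 0 ->
  p = o + x ord0 i0 *: u + x ord0 i1 *: v + x ord0 i2 *: w.
Proof.
move=> D0; have := D0; rewrite det3E => D0'.
by apply: eq_rV3; rewrite /x /basis_change !mxE /= !det3E !mxE; field.
Qed.

Lemma cone_basis_change o u v w : det3 u v w != 0 ->
  cone o u v w = basis_change o u v w @^-1` (coords @^-1` (@std_simplex R)).
Proof.
move=> D0; apply/seteqP; split=> [p [a [b [c [a0 b0 c0 abc ->]]]]|p].
  rewrite /= basis_change_lin // /std_simplex /= !mxE /=; by apply/and4P.
rewrite /std_simplex /= => /and4P[a0 b0 c0 abc].
by do 3!eexists; split; [exact: a0|exact: b0|exact: c0|exact: abc|exact: basis_changeK].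
Qed.

Lemma vmeasurable_simplex : vmeasurable (coords @^-1` (@std_simplex R)).
Proof.
rewrite /vmeasurable (_ : of_coords @^-1` _ = @std_simplex R); first exact: measurable_std_simplex.
by apply/seteqP; split=> p /=; rewrite of_coordsK.
Qed.

Lemma vmeasurable_cone o u v w : det3 u v w != 0 -> vmeasurable (cone o u v w).
Proof.
move=> D0; rewrite cone_basis_change //; have [M [b [/funext -> _]]] := basis_changeE o D0.
exact: vmeasurable_affine vmeasurable_simplex.
Qed.

Lemma vol_cone o u v w : det3 u v w != 0 -> vol (cone o u v w) = (`|det3 u v w| / 6)%:E.
Proof.
move=> D0; rewrite cone_basis_change //; have [M [b [/funext -> dM]]] := basis_changeE o D0.
have M0 : \det M != 0 by rewrite dM invr_eq0.
have := vol_affine b M0 vmeasurable_simplex.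
have -> : vol (coords @^-1` (@std_simplex R)) = (6^-1)%:E.
  rewrite -lam3_std_simplex /vol; congr (lam3 R _).
  by apply/seteqP; split=> p /=; rewrite (of_coordsK p).
move/(congr1 (fun x => x * `|det3 u v w|%:E)%E).
rewrite -muleA -!EFinM dM normfV mulVf ?normr_eq0// mule1 => ->.
by rewrite mulrC.
Qed.

(** The vector [w] witnesses that [u] and [v] are independent. In the basis [u, v, w] the plane
    becomes a coordinate plane, whose sections along the last axis are single points. *)
Lemma vol_plane (o u v w : V) : det3 u v w != 0 ->
  vmeasurable [set p | det3 u v (p - o) = 0] /\ vol [set p | det3 u v (p - o) = 0] = 0%E.
Proof.
move=> D0.
have -> : [set p | det3 u v (p - o) = 0] = basis_change o u v w @^-1` [set x | x ord0 i2 = 0].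
  apply/seteqP; split=> p /=; rewrite /basis_change !mxE /=; first by move->; rewrite mul0r.
  by move/eqP; rewrite mulf_eq0 invr_eq0 (negbTE D0) orbF => /eqP.
have [M [b [/funext -> dM]]] := basis_changeE o D0.
have M0 : \det M != 0 by rewrite dM invr_eq0.
pose Z : set T3 := setT `*` [set 0].
have ZE : of_coords @^-1` [set x | x ord0 i2 = 0] = Z.
  apply/seteqP; split=> -[q z] /=; rewrite /of_coords !mxE /=; first by move=> ->.
  by case.
have mz : vmeasurable [set x : V | x ord0 i2 = 0].
  by rewrite /vmeasurable ZE; apply: measurableX.
split; first exact: vmeasurable_affine.
have := vol_affine b M0 mz.
have -> : vol [set x : V | x ord0 i2 = 0] = 0%E.
  rewrite /vol -/of_coords.
  have -> : [set p | [set x : V | x ord0 i2 = 0] (row3 p.1.1 p.1.2 p.2)] = Z by rewrite -ZE.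
  rewrite lam3E integral0_eq// => q _.
  rewrite (_ : xsection _ _ = [set 0]) ?lebesgue_measure_set1//.
  apply/seteqP; split=> z; rewrite /xsection /= inE /Z /=; first by case.
  by move=> ->.
move/eqP; rewrite mule_eq0 eqe normr_eq0 (negbTE M0) orbF => /eqP.
by [].
Qed.

(** The image of [A] under the homothety of centre [o] and ratio [r], written as a preimage under
    the inverse map so that measurability is inherited. *)
Lemma vol_homothety (o : V) (r : R) (A : set V) : 0 < r -> vmeasurable A ->
  vmeasurable [set p | A (o + r^-1 *: (p - o))] /\
  vol [set p | A (o + r^-1 *: (p - o))] = ((r ^+ 3)%:E * vol A)%E.
Proof.
move=> r0 mA; pose M : 'M[R]_3 := (r^-1)%:M.
have dM : \det M = (r ^+ 3)^-1 by rewrite det_scalar exprVn.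
have M0 : \det M != 0 by rewrite dM invr_eq0 expf_neq0 ?gt_eqF.
have -> : [set p | A (o + r^-1 *: (p - o))] = affine M (o - r^-1 *: o) @^-1` A.
  have E p : o + r^-1 *: (p - o) = affine M (o - r^-1 *: o) p.
    by rewrite /affine tr_scalar_mx mul_mx_scalar scalerBr addrCA.
  by apply/seteqP; split=> p /=; rewrite E.
split; first exact: vmeasurable_affine.
rewrite -(vol_affine (o - r^-1 *: o) M0 mA) muleC -muleA -EFinM dM.
by rewrite gtr0_norm ?invr_gt0 ?exprn_gt0// mulVf ?mule1// expf_neq0 ?gt_eqF.
Qed.

End volumes.

(** * Vertices seen from one vertex of a hull *)

Section caratheodory.
Variables (R : realType).
Local Notation V := 'rV[R]_3.

Definition supp (n : nat) (l : 'I_n -> R) : {set 'I_n} := [set i | l i != 0]%SET.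

Lemma dependency (n : nat) (y : 'I_n -> V) (A : {set 'I_n}) : (3 < #|A|)%N ->
  exists mu : 'I_n -> R, [/\ forall i, i \notin A -> mu i = 0, exists i, mu i != 0
    & \sum_i mu i *: y i = 0].
Proof.
move=> A3; pose m := #|A|; pose f : 'I_m -> 'I_n := enum_val.
have finj : injective f by exact: enum_val_inj.
pose Y : 'M[R]_(m, 3) := \matrix_(k < m) y (f k).
have : kermx Y != 0.
  rewrite -mxrank_eq0 mxrank_ker -lt0n subn_gt0.
  by apply: (leq_ltn_trans (rank_leq_col Y)).
move/rowV0Pn => [u /sub_kermxP uY u0].
exists (fun i => \sum_(k | f k == i) u ord0 k); split.
- move=> i iA; apply: big1 => k /eqP fk.
  by move: iA; rewrite -fk /f enum_valP.
- have [k uk] : exists k, u ord0 k != 0.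
    apply/existsP; apply: contraNT u0 => /existsPn H; apply/eqP/rowP => k.
    by rewrite !mxE; apply/eqP; have := H k; rewrite negbK.
  exists (f k); rewrite (bigD1 k) //= big1 ?addr0 // => l /andP[/eqP /finj ->].
  by rewrite eqxx.
- transitivity (\sum_k u ord0 k *: y (f k)).
    rewrite (partition_big f predT) //=; apply: eq_bigr => i _.
    rewrite scaler_suml; apply: eq_bigr => k /eqP ->; by [].
  rewrite mulmx_sum_row in uY; rewrite -[RHS]uY.
  by apply: eq_bigr => k _; rewrite rowK.
Qed.

(** While more than three coefficients are nonzero, a multiple of a linear dependency is subtracted
    until one of them vanishes. The bound on the total weight is what later makes this cone version
    yield convex combinations, with the missing weight placed at a base point. *)
Lemma caratheodory_cone (n : nat) (y : 'I_n -> V) (l : 'I_n -> R) : (forall i, 0 <= l i) ->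
  exists l' : 'I_n -> R, [/\ forall i, 0 <= l' i, \sum_i l' i *: y i = \sum_i l i *: y i,
    \sum_i l' i <= \sum_i l i, (#|supp l'| <= 3)%N
    & supp l' \subset supp l].
Proof.
have [k] := ubnP #|supp l|; elim: k l => // k IH l lk l0.
have [le3|gt3] := leqP #|supp l| 3.
  by exists l; split.
have [mu [muA [i1 mui1] mu0]] := dependency y gt3.
(* Of a dependency and its opposite one has nonnegative sum; not being zero, it then has a positive
   entry. Subtracting it cannot increase the total weight. *)
have {mu muA i1 mui1 mu0} [mu [muA [i1 mui1] mu0 mus]] : exists mu : 'I_n -> R,
  [/\ forall i, i \notin supp l -> mu i = 0, exists i, 0 < mu i,
   \sum_i mu i *: y i = 0 & 0 <= \sum_i mu i].
  have key (nu : 'I_n -> R) i : nu i != 0 -> 0 <= \sum_i nu i -> exists i, 0 < nu i.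
    move=> nui s0; apply/existsP; apply: contraNT nui => /existsPn H.
    have H' j : 0 <= - nu j by rewrite oppr_ge0 leNgt.
    have : \sum_j - nu j == 0 by rewrite eq_le sumr_ge0 // sumrN oppr_le0 s0.
    by rewrite psumr_eq0 // => /allP /(_ i (mem_index_enum i)) /=; rewrite oppr_eq0.
  have [s0|s0] := lerP 0 (\sum_i mu i).
    by exists mu; split => //; exact: key mui1 s0.
  exists (fun i => - mu i); split.
  - by move=> i /muA ->; rewrite oppr0.
  - by apply: (key _ i1); rewrite ?oppr_eq0 // sumrN oppr_ge0 ltW.
  - by under eq_bigr do rewrite scaleNr; rewrite sumrN mu0 oppr0.
  - by rewrite sumrN oppr_ge0 ltW.
(* Ratio test: [t] is the largest multiple of [mu] whose subtraction keeps all coefficients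
   nonnegative, and it annihilates the one at [i0]. *)
pose i0 := [arg min_(i < i1 | 0 < mu i) (l i / mu i)]%O.
have [mui0 imin] : 0 < mu i0 /\ forall j, 0 < mu j -> l i0 / mu i0 <= l j / mu j.
  by rewrite /i0; case: arg_minP.
pose t := l i0 / mu i0.
have t0 : 0 <= t by rewrite divr_ge0 // ltW.
pose l1 i := l i - t * mu i.
have l10 i : 0 <= l1 i.
  rewrite subr_ge0; have [mi|mi] := ltrP 0 (mu i).
    by rewrite -ler_pdivlMr //; exact: imin.
  by apply: le_trans (l0 i); rewrite mulr_ge0_le0.
have sub1 : supp l1 \subset supp l.
  apply/fintype.subsetP => i; rewrite !inE; apply: contraNneq => li.
  by rewrite /l1 li muA ?inE ?li ?eqxx // mulr0 subrr.
have lt1 : (#|supp l1| < k)%N.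
  rewrite ltnS in lk; apply: leq_trans lk; apply: proper_card; rewrite properE sub1 /=.
  apply/subsetPn; exists i0; rewrite !inE.
    by apply: contraL mui0 => /eqP li; rewrite (muA i0) ?ltxx // inE li eqxx.
  by rewrite /l1 /t divfK ?subrr ?eqxx // gt_eqF.
have [l' [l'0 l's l'le l'3 l'sub]] := IH l1 lt1 l10.
exists l'; split => //.
- rewrite l's; under eq_bigr do rewrite scalerBl -scalerA.
  by rewrite sumrB -scaler_sumr mu0 scaler0 subr0.
- apply: (le_trans l'le); rewrite /l1 sumrB -mulr_sumr gerBl; exact: mulr_ge0.
- exact: fintype.subset_trans l'sub sub1.
Qed.

End caratheodory.

Section det3_theory.
Variables (R : realType).
Implicit Types u v w : 'rV[R]_3.

Lemma det3_swap12 u v w : det3 v u w = - det3 u v w.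
Proof. by rewrite !det3E; ring. Qed.

Lemma det3_swap23 u v w : det3 u w v = - det3 u v w.
Proof. by rewrite !det3E; ring. Qed.

Lemma det3_swap13 u v w : det3 w v u = - det3 u v w.
Proof. by rewrite !det3E; ring. Qed.

Lemma det3_comb u v w (a1 b1 c1 a2 b2 c2 a3 b3 c3 : R) :
  det3 (a1 *: u + b1 *: v + c1 *: w) (a2 *: u + b2 *: v + c2 *: w) (a3 *: u + b3 *: v + c3 *: w)
  = (a1 * (b2 * c3 - c2 * b3) - b1 * (a2 * c3 - c2 * a3) + c1 * (a2 * b3 - b2 * a3)) * det3 u v w.
Proof. by rewrite !det3E !mxE; ring. Qed.

Lemma det3_cramer u v w q : det3 u v w != 0 ->
  q = (det3 q v w / det3 u v w) *: u + (det3 u q w / det3 u v w) *: v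
      + (det3 u v q / det3 u v w) *: w.
Proof.
move=> D0; have := D0; rewrite det3E => D0'.
by apply: eq_rV3; rewrite !mxE !det3E; field.
Qed.

Lemma det3_coef1 u v w (a b c : R) : det3 u v w != 0 ->
  det3 (a *: u + b *: v + c *: w) v w / det3 u v w = a.
Proof. by rewrite !det3E !mxE => D0; field. Qed.

Lemma det3_coef2 u v w (a b c : R) : det3 u v w != 0 ->
  det3 u (a *: u + b *: v + c *: w) w / det3 u v w = b.
Proof. by rewrite !det3E !mxE => D0; field. Qed.

Lemma det3_coef3 u v w (a b c : R) : det3 u v w != 0 ->
  det3 u v (a *: u + b *: v + c *: w) / det3 u v w = c.
Proof. by rewrite !det3E !mxE => D0; field. Qed.

End det3_theory.

Section optimal_triple.
Variables (R : realType) (n : nat).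
Local Notation V := 'rV[R]_3.
Variables (y : 'I_n -> V) (o : 'I_n) (q : V).
Hypothesis yo : y o = 0.
Hypothesis y_gen : forall a b c, a != o -> b != o -> c != o -> a != b -> a != c -> b != c ->
  det3 (y a) (y b) (y c) != 0.
Hypothesis q_gen : forall a b, a != o -> b != o -> a != b -> det3 (y a) (y b) q != 0.

Let I3 := ('I_n * 'I_n * 'I_n)%type.
Let D (t : I3) := det3 (y t.1.1) (y t.1.2) (y t.2).
(** By Cramer's rule [c1], [c2], [c3] are the coordinates of [q] in the basis indexed by [t]. Thus
    [feasible] places [q] in the open cone over the triple; the boundary is ruled out by [q_gen]. *)
Let c1 (t : I3) := det3 q (y t.1.2) (y t.2) / D t.
Let c2 (t : I3) := det3 (y t.1.1) q (y t.2) / D t.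
Let c3 (t : I3) := det3 (y t.1.1) (y t.1.2) q / D t.
Let feasible t := [&& D t != 0, 0 < c1 t, 0 < c2 t & 0 < c3 t].
Let weight t := c1 t + c2 t + c3 t.

Lemma D_neq t : D t != 0 ->
  [/\ t.1.1 != o, t.1.2 != o & t.2 != o] /\ [/\ t.1.1 != t.1.2, t.1.1 != t.2 & t.1.2 != t.2].
Proof.
move: t => [[a b] c]; rewrite /D /= => D0.
by split; split; apply: contraNneq D0 => e; rewrite ?e ?yo det3E ?mxE; apply/eqP; ring.
Qed.

Let swap12t (t : I3) : I3 := ((t.1.2, t.1.1), t.2).
Let swap13t (t : I3) : I3 := ((t.2, t.1.2), t.1.1).

Lemma feasible_swap12 t : feasible t -> feasible (swap12t t) /\ weight (swap12t t) = weight t.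
Proof.
rewrite /feasible /weight /c1 /c2 /c3 /D /swap12t /= => /and4P[D0 p1 p2 p3].
rewrite (det3_swap12 (y t.1.1) (y t.1.2) (y t.2)) (det3_swap12 (y t.1.1) q) (det3_swap12 q (y t.1.2)).
rewrite (det3_swap12 (y t.1.1) (y t.1.2) q) oppr_eq0 invrN !mulrNN D0 p1 p2 p3.
by split => //; rewrite [X in X + _]addrC.
Qed.

Lemma feasible_swap13 t : feasible t -> feasible (swap13t t) /\ weight (swap13t t) = weight t.
Proof.
rewrite /feasible /weight /c1 /c2 /c3 /D /swap13t /= => /and4P[D0 p1 p2 p3].
rewrite (det3_swap13 (y t.1.1) (y t.1.2) (y t.2)) (det3_swap13 (y t.1.1) (y t.1.2) q).
rewrite (det3_swap13 q (y t.1.2) (y t.2)) (det3_swap13 (y t.1.1) q (y t.2)).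
rewrite oppr_eq0 invrN !mulrNN D0 p1 p2 p3.
by split => //; rewrite addrC addrA addrAC.
Qed.

Lemma q_not_in_plane a b (s r : R) : a != o -> b != o -> a != b -> q <> s *: y a + r *: y b.
Proof.
move=> ao bo ab E; have := q_gen ao bo ab; rewrite E det3E !mxE => /eqP; apply; ring.
Qed.

(* One pivot of the simplex method. *)
Lemma exchange (t : I3) (d : 'I_n) (m1 m2 m3 : R) : feasible t ->
  y d = m1 *: y t.1.1 + m2 *: y t.1.2 + m3 *: y t.2 ->
  1 < m1 + m2 + m3 -> 0 < m1 ->
  c1 t / m1 * m2 <= c2 t -> c1 t / m1 * m3 <= c3 t ->
  exists2 t', feasible t' & weight t' < weight t.
Proof.
move=> /and4P[D0 p1 p2 p3] yd msum m1p le2 le3.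
have qE : q = c1 t *: y t.1.1 + c2 t *: y t.1.2 + c3 t *: y t.2 by exact: det3_cramer.
(* [s] is the coefficient of the entering vector [y d]. The ratio test [le2], [le3] keeps the other
   two coefficients nonnegative, [q_gen] makes them positive, and the weight drops by
   [s * (m1 + m2 + m3 - 1)]. *)
set s := c1 t / m1 in le2 le3; have sp : 0 < s by rewrite divr_gt0.
have m1n : m1 != 0 by rewrite gt_eqF.
have qE' : q = s *: y d + (c2 t - s * m2) *: y t.1.2 + (c3 t - s * m3) *: y t.2.
  rewrite {1}qE yd; apply: eq_rV3; rewrite !mxE /s; field; exact: m1n.
pose t' : I3 := ((d, t.1.2), t.2).
have D' : D t' = m1 * D t.
  rewrite /D /t' /= yd; have := det3_comb (y t.1.1) (y t.1.2) (y t.2) m1 m2 m3 0 1 0 0 0 1.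
  rewrite !scale0r !scale1r !addr0 !add0r => ->; ring.
have D'0 : D t' != 0 by rewrite D' mulf_neq0.
have [[/= do' bo co] [/= db dc bc]] := D_neq D'0.
have E1 : c1 t' = s by rewrite /c1 qE'; exact: det3_coef1.
have E2 : c2 t' = c2 t - s * m2 by rewrite {1}/c2 {1}qE'; exact: det3_coef2.
have E3 : c3 t' = c3 t - s * m3 by rewrite {1}/c3 {1}qE'; exact: det3_coef3.
exists t'.
  rewrite /feasible D'0 E1 E2 E3 sp /= !subr_gt0 !lt_neqAle le2 le3 !andbT.
  apply/andP; split; apply/eqP => e.
    by apply: (@q_not_in_plane d t.2 s (c3 t - s * m3)) => //; rewrite {1}qE' -e subrr scale0r addr0.
  by apply: (@q_not_in_plane d t.1.2 s (c2 t - s * m2)) => //; rewrite {1}qE' -e subrr scale0r addr0.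
rewrite /weight E1 E2 E3.
have -> : c1 t = s * m1 by rewrite /s divfK.
rewrite -subr_gt0 (_ : _ - _ = s * (m1 + m2 + m3 - 1)); last by ring.
by rewrite mulr_gt0 // subr_gt0.
Qed.

(** Some [m] is positive because their sum is; among the positive ones, the index with the least
    ratio [a / m] leaves the basis. *)
Lemma pivot_choice (a1 a2 a3 m1 m2 m3 : R) : 0 < a1 -> 0 < a2 -> 0 < a3 -> 0 < m1 + m2 + m3 ->
  [\/ [/\ 0 < m1, a1 / m1 * m2 <= a2 & a1 / m1 * m3 <= a3],
      [/\ 0 < m2, a2 / m2 * m1 <= a1 & a2 / m2 * m3 <= a3] |
      [/\ 0 < m3, a3 / m3 * m2 <= a2 & a3 / m3 * m1 <= a1]].
Proof.
move=> p1 p2 p3 ms.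
have key (a m b k : R) : 0 < a -> 0 < b -> 0 < m -> k <= 0 \/ (0 < k /\ a / m <= b / k) -> a / m * k <= b.
  move=> a0 b0 m0 [k0|[k0 le]].
    by apply: le_trans (ltW b0); rewrite mulr_ge0_le0 // divr_ge0 // ltW.
  by rewrite -ler_pdivlMr.
have [h1|h1] := ltrP 0 m1; have [h2|h2] := ltrP 0 m2; have [h3|h3] := ltrP 0 m3.
- have [h12|h12] := leP (a1 / m1) (a2 / m2); have [h13|h13] := leP (a1 / m1) (a3 / m3);
  have [h23|h23] := leP (a2 / m2) (a3 / m3).
  all: try (by apply: Or31; split => //; apply: key => //; right; split => //; lra).
  all: try (by apply: Or32; split => //; apply: key => //; right; split => //; lra).
  all: try (by apply: Or33; split => //; apply: key => //; right; split => //; lra).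
- have [h12|h12] := leP (a1 / m1) (a2 / m2).
    by apply: Or31; split => //; apply: key => //; [right|left].
  by apply: Or32; split => //; apply: key => //; [right; split => //; exact: ltW|left].
- have [h12|h12] := leP (a1 / m1) (a3 / m3).
    by apply: Or31; split => //; apply: key => //; [left|right].
  by apply: Or33; split => //; apply: key => //; [left|right; split => //; exact: ltW].
- by apply: Or31; split => //; apply: key => //; left.
- have [h12|h12] := leP (a2 / m2) (a3 / m3).
    by apply: Or32; split => //; apply: key => //; [left|right].
  by apply: Or33; split => //; apply: key => //; [right; split => //; exact: ltW|left].
- by apply: Or32; split => //; apply: key => //; left.
- by apply: Or33; split => //; apply: key => //; left.
- exfalso; lra.
Qed.

Lemma exists_feasible (l : 'I_n -> R) (e1 e2 e3 : 'I_n) :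
  e1 != o -> e2 != o -> e3 != o -> e1 != e2 -> e1 != e3 -> e2 != e3 ->
  (forall i, 0 <= l i) -> q = \sum_i l i *: y i -> \sum_i l i <= 1 ->
  exists2 t, feasible t & weight t <= 1.
Proof.
move=> e1o e2o e3o e12 e13 e23 l0 ql l1.
have [m [m0 mq ml m3 _]] := caratheodory_cone y l0.
pose B := (supp m :\ o)%SET.
have qB : q = \sum_(i <- enum B) m i *: y i.
  rewrite big_enum /= ql -mq (bigID [in B]) /= [X in _ + X]big1 ?addr0 // => i.
  rewrite !inE negb_and !negbK => /orP[/eqP ->|/eqP ->]; by rewrite ?yo ?scaler0 ?scale0r.
have sB : \sum_(i <- enum B) m i <= 1.
  rewrite big_enum /=; apply: le_trans l1; apply: le_trans ml.
  by rewrite [leRHS](bigID [in B]) /= lerDl sumr_ge0.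
have B3 : (size (enum B) <= 3)%N.
  by rewrite -cardE; apply: leq_trans m3; apply: subset_leq_card; exact: subD1set.
have Bo i : i \in enum B -> i != o /\ 0 < m i.
  by rewrite mem_enum !inE => /andP[-> mi]; rewrite lt_neqAle eq_sym mi m0.
have Bu : uniq (enum B) by exact: enum_uniq.
(* With fewer than three vectors in the support, [q] would lie in a plane through two vertices; [e1]
   and [e2] complete the pair when the support is too small. *)
move: (enum B) B3 Bo Bu qB sB => [|a [|b [|c [|]]]] //= _ Bo Bu.
- rewrite big_nil => qE _; exfalso.
  by apply: (@q_not_in_plane e1 e2 0 0) => //; rewrite !scale0r addr0.
- rewrite big_seq1 => qE _; exfalso; have [ao _] := Bo a (mem_head _ _).
  have [ae|ae] := eqVneq a e1.
    by apply: (@q_not_in_plane a e2 (m a) 0) => //; rewrite ?ae // scale0r addr0 -ae.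
  by apply: (@q_not_in_plane a e1 (m a) 0) => //; rewrite scale0r addr0.
- rewrite big_cons big_seq1 => qE _; exfalso.
  have [ao _] := Bo a (mem_head _ _); have [bo _] : b != o /\ 0 < m b by apply: Bo; rewrite !inE eqxx orbT.
  by apply: (@q_not_in_plane a b (m a) (m b)) => //; move: Bu; rewrite inE andbT.
rewrite !big_cons !big_nil !addr0 !addrA => qE sB.
have [ao ma] := Bo a (mem_head _ _); have [bo mb] : b != o /\ 0 < m b by apply: Bo; rewrite !inE eqxx orbT.
have [co mc] : c != o /\ 0 < m c by apply: Bo; rewrite !inE eqxx !orbT.
have [ab ac bc] : [/\ a != b, a != c & b != c].
  by move: Bu; rewrite !inE negb_or andbT => /andP[/andP[]].
pose t : I3 := ((a, b), c).
have D0 : D t != 0 by exact: y_gen.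
have E1 : c1 t = m a by rewrite /c1 qE; exact: det3_coef1.
have E2 : c2 t = m b by rewrite /c2 qE; exact: det3_coef2.
have E3 : c3 t = m c by rewrite /c3 qE; exact: det3_coef3.
by exists t; rewrite /feasible /weight E1 E2 E3 // D0 ma mb mc.
Qed.

(* The last clause is dual feasibility: a feasible triple of least weight is an
   optimal basis for the linear program min sum l with q = sum l y. *)
Lemma optimal_triple (l : 'I_n -> R) (e1 e2 e3 : 'I_n) :
  e1 != o -> e2 != o -> e3 != o -> e1 != e2 -> e1 != e3 -> e2 != e3 ->
  (forall i, 0 <= l i) -> q = \sum_i l i *: y i -> \sum_i l i <= 1 ->
  exists a b c s1 s2 s3, [/\ det3 (y a) (y b) (y c) != 0, [/\ 0 < s1, 0 < s2 & 0 < s3],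
    s1 + s2 + s3 <= 1, q = s1 *: y a + s2 *: y b + s3 *: y c
    & forall d, (det3 (y d) (y b) (y c) + det3 (y a) (y d) (y c) + det3 (y a) (y b) (y d))
                / det3 (y a) (y b) (y c) <= 1].
Proof.
move=> e1o e2o e3o e12 e13 e23 l0 ql l1.
have [t0 ft0 wt0] := exists_feasible e1o e2o e3o e12 e13 e23 l0 ql l1.
pose t := [arg min_(t < t0 | feasible t) weight t]%O.
have [ft tmin] : feasible t /\ forall t', feasible t' -> weight t <= weight t'.
  by rewrite /t; case: arg_minP.
have [D0 p1 p2 p3] := and4P ft.
exists t.1.1, t.1.2, t.2, (c1 t), (c2 t), (c3 t); split => //.
- exact: le_trans (tmin _ ft0) wt0.
- exact: det3_cramer.
move=> d; rewrite leNgt; apply/negP.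
rewrite !mulrDl.
set m1 := det3 (y d) _ _ / _; set m2 := det3 _ (y d) _ / _; set m3 := det3 _ _ (y d) / _ => ms.
have yd : y d = m1 *: y t.1.1 + m2 *: y t.1.2 + m3 *: y t.2 by exact: det3_cramer.
have ms0 : 0 < m1 + m2 + m3 by apply: lt_trans ms.
have bad t' : feasible t' -> weight t' < weight t -> False.
  by move=> /tmin H; rewrite ltNge H.
(* A violated dual constraint would allow a pivot that lowers the weight. [exchange] replaces the
   first vector of the triple, so the other two cases are swapped to the front. *)
case: (pivot_choice p1 p2 p3 ms0) => -[mp h1 h2].
- by have [t' ft' wt'] := exchange ft yd ms mp h1 h2; exact: bad ft' wt'.
- have [fs ws] := feasible_swap12 ft.
  have E : [/\ c1 (swap12t t) = c2 t, c2 (swap12t t) = c1 t & c3 (swap12t t) = c3 t].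
    rewrite /c1 /c2 /c3 /D /swap12t /= (det3_swap12 (y t.1.1) (y t.1.2) (y t.2)) (det3_swap12 (y t.1.1) q).
    by rewrite (det3_swap12 q (y t.1.2)) (det3_swap12 (y t.1.1) (y t.1.2) q) invrN !mulrNN.
  have [E1 E2 E3] := E.
  have [||||t' ft' wt'] := @exchange (swap12t t) d m2 m1 m3 fs _ _ mp; rewrite ?E1 ?E2 ?E3 //=.
  + by rewrite {1}yd [X in X + _]addrC.
  + by rewrite [X in X + _]addrC.
  + by apply: (bad t') => //; rewrite -ws.
- have [fs ws] := feasible_swap13 ft.
  have E : [/\ c1 (swap13t t) = c3 t, c2 (swap13t t) = c2 t & c3 (swap13t t) = c1 t].
    rewrite /c1 /c2 /c3 /D /swap13t /= (det3_swap13 (y t.1.1) (y t.1.2) (y t.2)) (det3_swap13 (y t.1.1) (y t.1.2) q).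
    rewrite (det3_swap13 q (y t.1.2) (y t.2)) (det3_swap13 (y t.1.1) q (y t.2)).
    by rewrite invrN !mulrNN.
  have [E1 E2 E3] := E.
  have [||||t' ft' wt'] := @exchange (swap13t t) d m3 m2 m1 fs _ _ mp; rewrite ?E1 ?E2 ?E3 //=.
  + by rewrite {1}yd addrC addrA addrAC.
  + by rewrite addrC addrA addrAC.
  + by apply: (bad t') => //; rewrite -ws.
Qed.

End optimal_triple.

(** * Facets of a polygon with few alternations *)

Section affine_forms.
Variable R : realType.
Local Notation V := 'rV[R]_3.

(** Six times the signed volume of the tetrahedron [a b c d]; it is alternating, and affine in each
    point. *)
Definition det4 (a b c d : V) : R := det3 (b - a) (c - a) (d - a).

(** The shape is that of [plane_fun], so zeros of [f] along the curve are intersections with a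
    plane. Constants, with [nu = 0], are included and serve as perturbations. *)
Definition affine_form (f : V -> R) := exists nu c, forall p, f p = dot p nu - c.

Lemma affine_form_coord (f : V -> R) (a b c d : R) :
  (forall p, f p = a * p ord0 i0 + b * p ord0 i1 + c * p ord0 i2 + d) -> affine_form f.
Proof.
move=> fE; exists (row3 a b c), (- d) => p.
by rewrite fE /dot big_ord3 !mxE /= opprK; ring.
Qed.

Lemma affine_form_cst (c : R) : affine_form (fun _ => c).
Proof. by apply: (@affine_form_coord _ 0 0 0 c) => p; rewrite !mul0r !add0r. Qed.

Lemma affine_form_comb (f g : V -> R) (e : R) :
  affine_form f -> affine_form g -> affine_form (fun p => f p + e * g p).
Proof.
move=> [nu [c fE]] [nu' [c' gE]]; exists (nu + e *: nu'), (c + e * c') => p.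
by rewrite fE gE /dot !big_ord3 !mxE; ring.
Qed.

Lemma affine_form_det4 b c d : affine_form (fun p => det4 p b c d).
Proof.
apply: (@affine_form_coord _ (det4 (row3 1 0 0) b c d - det4 0 b c d)
  (det4 (row3 0 1 0) b c d - det4 0 b c d) (det4 (row3 0 0 1) b c d - det4 0 b c d)
  (det4 0 b c d)) => p.
by rewrite /det4 !det3E !mxE /=; ring.
Qed.

Lemma det4_swap12 a b c d : det4 b a c d = - det4 a b c d.
Proof. by rewrite /det4 !det3E !mxE; ring. Qed.
Lemma det4_swap23 a b c d : det4 a c b d = - det4 a b c d.
Proof. by rewrite /det4 !det3E !mxE; ring. Qed.
Lemma det4_swap34 a b c d : det4 a b d c = - det4 a b c d.
Proof. by rewrite /det4 !det3E !mxE; ring. Qed.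
Lemma det4_swap13_24 a b c d : det4 c d a b = det4 a b c d.
Proof. by rewrite /det4 !det3E !mxE; ring. Qed.
Lemma det4_rot a b c d : det4 a d b c = det4 a b c d.
Proof. by rewrite /det4 !det3E !mxE; ring. Qed.
Lemma det4_eq12 a c d : det4 a a c d = 0.
Proof. by rewrite /det4 !det3E !mxE; ring. Qed.
Lemma det4_eq13 a c d : det4 a c a d = 0.
Proof. by rewrite /det4 !det3E !mxE; ring. Qed.
Lemma det4_eq14 a c d : det4 a c d a = 0.
Proof. by rewrite /det4 !det3E !mxE; ring. Qed.
Lemma det4_eq23 a c d : det4 d a a c = 0.
Proof. by rewrite /det4 !det3E !mxE; ring. Qed.
Lemma det4_eq24 a c d : det4 d a c a = 0.
Proof. by rewrite /det4 !det3E !mxE; ring. Qed.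

(** The signed volume of a tetrahedron is the sum of the signed cones from [o] over its four
    faces. *)
Lemma det4_cone o a b c d :
  det4 a b c d = det4 o b c d + det4 a o c d + det4 a b o d + det4 a b c o.
Proof. by rewrite /det4 !det3E !mxE; ring. Qed.

(** The form is a combination of barycentric coordinates. The point [d] only serves to make
    [a, b, c] the vertices of a nondegenerate triangle. *)
Lemma affine_form_interpolation (a b c d : V) (s t r : R) : det4 a b c d != 0 ->
  exists2 g, affine_form g & [/\ g a = s, g b = t & g c = r].
Proof.
move=> D0.
pose h p := s / det4 a b c d * det4 p b c d + t / det4 a b c d * (- det4 p a c d)
  + r / det4 a b c d * det4 p a b d.
exists h.
  have e k f : affine_form f -> affine_form (fun p : V => k * f p).
    move=> ff; have := affine_form_comb k (affine_form_cst 0) ff.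
    by congr affine_form; apply/funext => p; rewrite add0r.
  rewrite (_ : h = fun p => (s / det4 a b c d * det4 p b c d
     + (- (t / det4 a b c d)) * det4 p a c d) + r / det4 a b c d * det4 p a b d); last first.
    by apply/funext => p; rewrite /h mulrN mulNr.
  apply: affine_form_comb; last exact: affine_form_det4.
  by apply: affine_form_comb; [apply: e|]; exact: affine_form_det4.
rewrite /h (det4_swap12 a b c d) !det4_eq12 !det4_eq13 !oppr0 ?opprK.
have -> : det4 c a b d = det4 a b c d by rewrite /det4 !det3E !mxE; ring.
by split; field; exact: D0.
Qed.

Lemma small_perturbation (a b : R) : 0 < a ->
  exists2 e, 0 < e & forall e', 0 < e' -> e' <= e -> e' * b < a.
Proof.
move=> a0; have b1 : 0 < 1 + `|b| by rewrite ltr_wpDr.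
exists (a / (1 + `|b|) / 2); first by rewrite !divr_gt0.
move=> e' e'0 le; apply: (@le_lt_trans _ _ (e' * `|b|)).
  by rewrite ler_pM2l // ler_norm.
apply: (@le_lt_trans _ _ (a / (1 + `|b|) / 2 * (1 + `|b|))).
  by apply: ler_pM => //; rewrite ?ltW// ltrDr.
by rewrite mulrAC divfK ?gt_eqF//; lra.
Qed.

Lemma small_perturbation3 (a1 b1 a2 b2 a3 b3 : R) : 0 < a1 -> 0 < a2 -> 0 < a3 ->
  exists e, [/\ 0 < e, e * b1 < a1, e * b2 < a2 & e * b3 < a3].
Proof.
move=> a10 a20 a30.
have [e1 e10 H1] := small_perturbation b1 a10.
have [e2 e20 H2] := small_perturbation b2 a20.
have [e3 e30 H3] := small_perturbation b3 a30.
pose e := Num.min e1 (Num.min e2 e3).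
have e0 : 0 < e by rewrite !lt_min e10 e20 e30.
exists e; split => //; [apply: H1|apply: H2|apply: H3] => //; by rewrite !ge_min lexx ?orbT.
Qed.

End affine_forms.

Section polygon_facets.
Variables (R : realType) (n : nat) (x : nat -> 'rV[R]_3).
Local Notation V := 'rV[R]_3.
Hypothesis n5 : (5 <= n)%N.
Hypothesis x_per : forall i, x (i + n)%N = x i.
Hypothesis x_gen : forall i j k l, (i < j)%N -> (j < k)%N -> (k < l)%N -> (l < i + n)%N ->
  det4 (x i) (x j) (x k) (x l) != 0.
Hypothesis x_alt : forall f, affine_form f -> forall i1 i2 i3 i4 i5 i6 : nat,
  (i1 < i2 < i3)%N -> (i3 < i4 < i5)%N -> (i5 < i6 < i1 + n)%N ->
  [/\ f (x i1) < 0, 0 < f (x i2) & f (x i3) < 0] ->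
  ~ [/\ 0 < f (x i4), f (x i5) < 0 & 0 < f (x i6)].

(** If [f] were negative at some [x m], a small affine perturbation with prescribed signs at the
    three zeros would alternate along six vertices: the edge [j, j.+1] supplies two opposite signs,
    [k] a negative one between its two positive neighbours. *)
Lemma isolated_facet f k j : affine_form f -> (k + 2 <= j)%N -> (j + 3 <= k + n)%N ->
  f (x k) = 0 -> f (x j) = 0 -> f (x j.+1) = 0 ->
  (forall m, (k < m < k + n)%N -> m != j -> m != j.+1 -> f (x m) != 0) ->
  0 < f (x k.+1) -> 0 < f (x (k + n - 1)%N) ->
  forall m, (k < m < k + n)%N -> m != j -> m != j.+1 -> 0 < f (x m).
Proof.
move=> ff kj jk fk fj fj1 fnz fk1 fkn m /andP[km mk] mj mj1.
rewrite lt_neqAle eq_sym fnz ?km//=; apply/negP => /negP; rewrite -ltNge => fm.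
have fmN : 0 < - f (x m) by rewrite oppr_gt0.
have G : forall s t r, exists2 g, affine_form g & [/\ g (x k) = s, g (x j) = t & g (x j.+1) = r].
  move=> s t r; apply: (@affine_form_interpolation _ _ _ _ (x j.+2)).
  by apply: x_gen; lia.
(* The signs [- + - + - +] occur at [k, k.+1, m, j, j.+1, k + n - 1] if [m] precedes the edge, and
   at [k, k.+1, j, j.+1, m, k + n - 1] if it follows. *)
have [mA|mB] := ltnP m j.
- have [g fg [gk gj gj1]] := G (-1) 1 (-1).
  have [e [e0 E1 E2 E3]] := small_perturbation3 (- g (x k.+1)) (g (x m)) (- g (x (k + n - 1)%N)) fk1 fmN fkn.
  have mk1 : m != k.+1 by apply: contraTneq fm => ->; rewrite -leNgt ltW.
  apply: (x_alt (affine_form_comb e ff fg) (i1 := k) (i2 := k.+1) (i3 := m) (i4 := j) (i5 := j.+1) (i6 := (k + n - 1)%N));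
    rewrite ?fk ?fj ?fj1 ?gk ?gj ?gj1; try lia.
  + by split; lra.
  + by split; lra.
- have mB' : (j.+1 < m)%N by rewrite ltn_neqAle eq_sym mj1 ltn_neqAle eq_sym mj mB.
  have [g fg [gk gj gj1]] := G (-1) (-1) 1.
  have [e [e0 E1 E2 E3]] := small_perturbation3 (- g (x k.+1)) (g (x m)) (- g (x (k + n - 1)%N)) fk1 fmN fkn.
  have mk1 : m != (k + n - 1)%N by apply: contraTneq fm => ->; rewrite -leNgt ltW.
  apply: (x_alt (affine_form_comb e ff fg) (i1 := k) (i2 := k.+1) (i3 := j) (i4 := j.+1) (i5 := m) (i6 := (k + n - 1)%N));
    rewrite ?fk ?fj ?fj1 ?gk ?gj ?gj1; try lia.
  + by split; lra.
  + by split; lra.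
Qed.

(** The same perturbation with the three zeros side by side: they receive the signs [- + -], and
    [j.+3, m, j + n - 1] continue with [+ - +]. *)
Lemma consecutive_facet f j : affine_form f ->
  f (x j) = 0 -> f (x j.+1) = 0 -> f (x j.+2) = 0 ->
  (forall m, (j.+2 < m < j + n)%N -> f (x m) != 0) ->
  0 < f (x j.+3) -> 0 < f (x (j + n - 1)%N) ->
  forall m, (j.+2 < m < j + n)%N -> 0 < f (x m).
Proof.
move=> ff fj fj1 fj2 fnz fj3 fjn m /andP[jm mj].
rewrite lt_neqAle eq_sym fnz ?jm//=; apply/negP => /negP; rewrite -ltNge => fm.
have fmN : 0 < - f (x m) by rewrite oppr_gt0.
have [g fg [gj gj1 gj2]] : exists2 g, affine_form g & [/\ g (x j) = -1, g (x j.+1) = 1 & g (x j.+2) = -1].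
  by apply: (@affine_form_interpolation _ _ _ _ (x j.+3)); apply: x_gen; lia.
have [e [e0 E1 E2 E3]] := small_perturbation3 (- g (x j.+3)) (g (x m)) (- g (x (j + n - 1)%N)) fj3 fmN fjn.
have mk1 : m != (j + n - 1)%N by apply: contraTneq fm => ->; rewrite -leNgt ltW.
have mk2 : m != j.+3 by apply: contraTneq fm => ->; rewrite -leNgt ltW.
apply: (x_alt (affine_form_comb e ff fg) (i1 := j) (i2 := j.+1) (i3 := j.+2) (i4 := j.+3) (i5 := m) (i6 := (j + n - 1)%N));
  rewrite ?fj ?fj1 ?fj2 ?gj ?gj1 ?gj2; try lia.
- by split; lra.
- by split; lra.
Qed.

(** Lowering [f] by a small constant makes the three zeros negative and leaves their successors
    positive. The gaps of at least two make these six vertices distinct and cyclically ordered. *)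
Lemma facet_has_edge f a b c : affine_form f -> (a + 2 <= b)%N -> (b + 2 <= c)%N -> (c + 2 <= a + n)%N ->
  f (x a) = 0 -> f (x b) = 0 -> f (x c) = 0 ->
  (forall m, (a < m < a + n)%N -> m != b -> m != c -> 0 < f (x m)) -> False.
Proof.
move=> ff ab bc ca fa fb fc fpos.
have fa1 : 0 < f (x a.+1) by apply: fpos; lia.
have fb1 : 0 < f (x b.+1) by apply: fpos; lia.
have fc1 : 0 < f (x c.+1) by apply: fpos; lia.
have [e [e0 E1 E2 E3]] := small_perturbation3 1 1 1 fa1 fb1 fc1.
apply: (x_alt (affine_form_comb e ff (affine_form_cst (-1))) (i1 := a) (i2 := a.+1) (i3 := b) (i4 := b.+1) (i5 := c) (i6 := c.+1));
  rewrite ?fa ?fb ?fc; try lia.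
- by split; lra.
- by split; lra.
Qed.

End polygon_facets.

Section facet_terms.
Variables (R : realType) (n : nat) (x : nat -> 'rV[R]_3).
Local Notation V := 'rV[R]_3.
Hypothesis n5 : (5 <= n)%N.
Hypothesis x_per : forall i, x (i + n)%N = x i.
Hypothesis x_gen : forall i j k l, (i < j)%N -> (j < k)%N -> (k < l)%N -> (l < i + n)%N ->
  det4 (x i) (x j) (x k) (x l) != 0.
Hypothesis x_alt : forall f, affine_form f -> forall i1 i2 i3 i4 i5 i6 : nat,
  (i1 < i2 < i3)%N -> (i3 < i4 < i5)%N -> (i5 < i6 < i1 + n)%N ->
  [/\ f (x i1) < 0, 0 < f (x i2) & f (x i3) < 0] ->
  ~ [/\ 0 < f (x i4), f (x i5) < 0 & 0 < f (x i6)].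

Definition plane_side (j d m : nat) : R := det4 (x m) (x (j + d)%N) (x j) (x j.+1).

(** Both signs are allowed because the orientation of the triple [j + d, j, j.+1] is not normalised.
    The window from [j.+2] to [j + n - 1] runs once through the vertices off the edge. *)
Definition facet (j d : nat) : Prop :=
  (forall m, (j.+1 < m < j + n)%N -> m != (j + d)%N -> 0 < plane_side j d m) \/
  (forall m, (j.+1 < m < j + n)%N -> m != (j + d)%N -> plane_side j d m < 0).

(** Six times the volume of the cone from [x 0] over the facet, and zero if the triple spans no
    facet or if [x 0] is one of its vertices. *)
Definition facet_area (j d : nat) : R := `|plane_side j d 0| *+ `[< facet j d >].

Lemma side_per j d m : plane_side j d (m + n) = plane_side j d m.
Proof. by rewrite /plane_side x_per. Qed.

Lemma side_neq0 j d m : (2 <= d)%N -> (d < n)%N -> (j.+1 < m < j + n)%N -> m != (j + d)%N ->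
  plane_side j d m != 0.
Proof.
move=> d2 dn /andP[jm mj] mjd; rewrite /plane_side.
have [lt|lt] := ltnP m (j + d).
  by rewrite -det4_swap13_24; apply: x_gen; lia.
have {}lt : (j + d < m)%N by lia.
by rewrite -det4_swap13_24 det4_swap34 oppr_eq0; apply: x_gen; lia.
Qed.

Lemma side0 j d : (j < n)%N -> (exists2 m, (j.+1 < m < j + n)%N /\ m != (j + d)%N & plane_side j d 0 = plane_side j d m)
  \/ plane_side j d 0 = 0.
Proof.
move=> jn; have [m [jm mj xm]] : exists m, [/\ (j <= m)%N, (m < j + n)%N & x 0 = x m].
  case: j jn => [_|j jn]; first by exists 0%N; split => //; lia.
  by exists n; split; try lia; rewrite -[in RHS](add0n n) x_per.
have sE : plane_side j d 0 = plane_side j d m by rewrite /plane_side xm.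
have [/eqP e|mjd] := boolP (m == (j + d)%N); first by right; rewrite sE e /plane_side det4_eq12.
have [/eqP e|mj0] := boolP (m == j); first by right; rewrite sE e /plane_side det4_eq13.
have [/eqP e|mj1] := boolP (m == j.+1); first by right; rewrite sE e /plane_side det4_eq14.
by left; exists m => //; split => //; lia.
Qed.

(** Here [a] and [b] are the sides of two vertices next to the triple. If they are opposite, the
    signs cancel and there is no facet; if they agree, all vertices lie on that side, so the common
    sign turns the side of [x 0] into its absolute value. *)
Lemma facet_term_of (a b : R) j d : (j < n)%N -> a != 0 -> b != 0 ->
  (0 < a -> 0 < b -> forall m, (j.+1 < m < j + n)%N -> m != (j + d)%N -> 0 < plane_side j d m) ->
  (a < 0 -> b < 0 -> forall m, (j.+1 < m < j + n)%N -> m != (j + d)%N -> plane_side j d m < 0) ->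
  (facet j d -> 0 < a * b) ->
  (Num.sg a + Num.sg b) * plane_side j d 0 = 2 * facet_area j d.
Proof.
move=> jn a0 b0 Hpos Hneg Hf; rewrite /facet_area.
have [f|nf] := pselect (facet j d); last first.
  rewrite (asboolF nf) mulr0n mulr0.
  have [ap|an|az] := ltgtP 0 a; last by rewrite -az eqxx in a0.
    have [bp|bn|bz] := ltgtP 0 b; last by rewrite -bz eqxx in b0.
      by exfalso; apply: nf; left; apply: Hpos.
    by rewrite (gtr0_sg ap) (ltr0_sg bn) subrr mul0r.
  have [bp|bn|bz] := ltgtP 0 b; last by rewrite -bz eqxx in b0.
    by rewrite (ltr0_sg an) (gtr0_sg bp) addrC subrr mul0r.
  by exfalso; apply: nf; right; apply: Hneg.
rewrite (asboolT f) mulr1n.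
have := Hf f; have [ap|an|az] := ltgtP 0 a; last by rewrite -az eqxx in a0.
  rewrite (pmulr_rgt0 _ ap) => bp; rewrite !gtr0_sg //.
  have -> : `|plane_side j d 0| = plane_side j d 0; last by [].
  by apply: ger0_norm; have [[m [m1 m2] ->]|->//] := side0 d jn; exact/ltW/Hpos.
rewrite (nmulr_rgt0 _ an) => bn; rewrite !ltr0_sg //.
have -> : `|plane_side j d 0| = - plane_side j d 0; last by ring.
by apply: ler0_norm; have [[m [m1 m2] ->]|->//] := side0 d jn; exact/ltW/Hneg.
Qed.

Lemma facet_mul j d m1 m2 : facet j d -> (j.+1 < m1 < j + n)%N -> m1 != (j + d)%N ->
  (j.+1 < m2 < j + n)%N -> m2 != (j + d)%N -> 0 < plane_side j d m1 * plane_side j d m2.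
Proof.
by move=> [] H h1 h2 h3 h4; [rewrite mulr_gt0 ?H|rewrite nmulr_rgt0 ?H].
Qed.

Lemma affine_formN (f : V -> R) : affine_form f -> affine_form (fun p => - f p).
Proof.
move=> ff; have := affine_form_comb (-1) (affine_form_cst 0) ff.
by congr affine_form; apply/funext => p; rewrite add0r mulN1r.
Qed.

(* If exactly one neighbour of x_(j+d) lies on the positive side, both members
   vanish; if both lie on the same side, a further vertex on the other side could be
   perturbed into six alternations. *)
Lemma isolated_facet_term j d : (j < n)%N -> (3 <= d)%N -> (d + 2 <= n)%N ->
  (Num.sg (plane_side j d (j + d + n - 1)) + Num.sg (plane_side j d (j + d).+1)) * plane_side j d 0 = 2 * facet_area j d.
Proof.
move=> jn d3 dn.
have E : plane_side j d (j + d + n - 1) = plane_side j d (j + d - 1).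
  by rewrite (_ : (j + d + n - 1 = j + d - 1 + n)%N); [rewrite side_per|lia].
have ff : affine_form (fun p => det4 p (x (j + d)%N) (x j) (x j.+1)) by exact: affine_form_det4.
(* [isolated_facet] counts from the apex [j + d], where the edge appears as [j + n, (j + n).+1],
   while [facet] counts from the edge. [win] and [win'] translate between the two windows. *)
have win m : (j + d < m < j + d + n)%N -> m != (j + n)%N -> m != (j + n).+1 ->
  exists2 m', (j.+1 < m' < j + n)%N /\ m' != (j + d)%N & x m = x m'.
  move=> mw m1 m2; have [lt|ge] := ltnP m (j + n); first by exists m => //; split => //; lia.
  have nm : (n <= m)%N by lia.
  by exists (m - n)%N; [split; lia|rewrite -{1}(subnK nm) x_per].
have win' m : (j.+1 < m < j + n)%N -> m != (j + d)%N ->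
  exists2 m', [/\ (j + d < m' < j + d + n)%N, m' != (j + n)%N & m' != (j + n).+1] & x m = x m'.
  move=> mw m1; have [lt|ge] := ltnP m (j + d); last by exists m => //; split; lia.
  by exists (m + n)%N; [split; lia|rewrite x_per].
have xjn : x (j + n)%N = x j by exact: x_per.
have xjn1 : x (j + n).+1 = x j.+1 by rewrite -addSn x_per.
have xk1 : x (j + d + n - 1)%N = x (j + d - 1)%N.
  by rewrite (_ : (j + d + n - 1 = j + d - 1 + n)%N); [rewrite x_per|lia].
apply: facet_term_of => //.
- by rewrite E side_neq0 //; lia.
- by rewrite side_neq0 //; lia.
- move=> s1 s2 m mw m1; have [m' [m'1 m'2 m'3] xm] := win' m mw m1.
  rewrite /plane_side xm.
  apply: (isolated_facet n5 x_gen x_alt ff (k := (j + d)%N) (j := (j + n)%N)) => //; rewrite ?xjn ?xjn1; try lia.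
  + exact: det4_eq12.
  + exact: det4_eq13.
  + exact: det4_eq14.
  + move=> l lw l1 l2; have [l' [l'1 l'2] xl] := win l lw l1 l2; rewrite xl.
    by apply: side_neq0 => //; lia.
- move=> s1 s2 m mw m1; have [m' [m'1 m'2 m'3] xm] := win' m mw m1.
  rewrite /plane_side xm -oppr_gt0.
  apply: (isolated_facet n5 x_gen x_alt (affine_formN ff) (k := (j + d)%N) (j := (j + n)%N)) => //; rewrite ?xjn ?xjn1; try lia.
  + by rewrite det4_eq12 oppr0.
  + by rewrite det4_eq13 oppr0.
  + by rewrite det4_eq14 oppr0.
  + move=> l lw l1 l2; have [l' [l'1 l'2] xl] := win l lw l1 l2; rewrite xl oppr_eq0.
    by apply: side_neq0 => //; lia.
  + by rewrite oppr_gt0.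
  + by rewrite oppr_gt0.
- move=> f; rewrite E; apply: (facet_mul f); lia.
Qed.

(** Three consecutive vertices have only two outer neighbours, [j - 1] and [j + 3]; they replace the
    two neighbours of an isolated apex. *)
Lemma consecutive_facet_term j : (j < n)%N ->
  (Num.sg (plane_side j 2 (j + n - 1)) + Num.sg (plane_side j 2 j.+3)) * plane_side j 2 0 = 2 * facet_area j 2.
Proof.
move=> jn.
have ff : affine_form (fun p => det4 p (x (j + 2)%N) (x j) (x j.+1)) by exact: affine_form_det4.
have j2 : (j + 2 = j.+2)%N by lia.
apply: facet_term_of => //.
- by rewrite side_neq0 //; lia.
- by rewrite side_neq0 //; lia.
- move=> s1 s2 m mw m1; rewrite /plane_side.
  apply: (consecutive_facet n5 x_gen x_alt ff (j := j)) => //; rewrite ?j2; try lia.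
  + exact: det4_eq13.
  + exact: det4_eq14.
  + exact: det4_eq12.
  + by move=> l lw; rewrite -j2; apply: side_neq0; lia.
- move=> s1 s2 m mw m1; rewrite /plane_side -oppr_gt0.
  apply: (consecutive_facet n5 x_gen x_alt (affine_formN ff) (j := j)) => //; rewrite ?j2; try lia.
  + by rewrite det4_eq13 oppr0.
  + by rewrite det4_eq14 oppr0.
  + by rewrite det4_eq12 oppr0.
  + by move=> l lw; rewrite -j2 oppr_eq0; apply: side_neq0; lia.
  + by move: s2; rewrite /plane_side j2 oppr_gt0.
  + by move: s1; rewrite /plane_side j2 oppr_gt0.
- move=> f; apply: (facet_mul f); lia.
Qed.

End facet_terms.

(** * Summation by parts over pairs of edges *)

Section tetrahedra_sum.
Variables (R : realType) (n : nat) (x : nat -> 'rV[R]_3).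
Local Notation V := 'rV[R]_3.
Hypothesis n5 : (5 <= n)%N.
Hypothesis x_per : forall i, x (i + n)%N = x i.
Hypothesis x_gen : forall i j k l, (i < j)%N -> (j < k)%N -> (k < l)%N -> (l < i + n)%N ->
  det4 (x i) (x j) (x k) (x l) != 0.
Hypothesis x_alt : forall f, affine_form f -> forall i1 i2 i3 i4 i5 i6 : nat,
  (i1 < i2 < i3)%N -> (i3 < i4 < i5)%N -> (i5 < i6 < i1 + n)%N ->
  [/\ f (x i1) < 0, 0 < f (x i2) & f (x i3) < 0] ->
  ~ [/\ 0 < f (x i4), f (x i5) < 0 & 0 < f (x i6)].

Local Notation side := (plane_side x).

Lemma sum_shift (G : nat -> R) k : (forall i, G (i + n)%N = G i) ->
  \sum_(0 <= i < n) G (i + k)%N = \sum_(0 <= i < n) G i.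
Proof.
move=> per; elim: k => [|k <-]; first by apply: eq_bigr => i _; rewrite addn0.
have [m nm] : exists m, n = m.+1 by exists n.-1; lia.
rewrite nm big_nat_recr //= [RHS]big_nat_recl //= add0n addrC; congr (_ + _).
  by rewrite -[RHS]per nm; congr G; lia.
by apply: eq_bigr => i _; congr G; lia.
Qed.

Let t i j := det4 (x i) (x i.+1) (x j) (x j.+1).
Let U k j := det4 (x 0) (x k) (x j) (x j.+1).
(** The term of [U (j + d) j] after summation by parts: the two signs are the sides of the
    neighbours of [x (j + d)]. Adding [n] before subtracting 1 keeps the predecessor correct at
    index 0. *)
Let B j d := (Num.sg (side j d (j + d + n - 1)) + Num.sg (side j d (j + d).+1)) * side j d 0.

Let t_sym i j : t i j = t j i.
Proof. by rewrite /t det4_swap13_24. Qed.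

(** Seen from [x 0], the four faces of the tetrahedron fall into two pairs, those containing the
    edge at [j] and those containing the edge at [i]. *)
Let norm_t i j : `|t i j| =
  Num.sg (t i j) * (U i.+1 j - U i j) + Num.sg (t i j) * (U j.+1 i - U j i).
Proof.
rewrite normrEsg -mulrDr; congr (_ * _).
rewrite {1}/t (det4_cone (x 0)) /U (det4_swap12 (x 0) (x i)).
rewrite (det4_swap13_24 (x 0) (x j.+1)) -addrA; congr (_ + _); congr (_ + _).
by rewrite -det4_swap13_24 det4_swap12.
Qed.

Lemma sum_tetrahedra_step : \sum_(0 <= i < n) \sum_(0 <= j < n) `|t i j| =
  2 * \sum_(0 <= j < n) \sum_(0 <= d < n) B j d.
Proof.
(* The two halves of [norm_t] are interchanged by exchanging [i] and [j]. *)
transitivity (2 * \sum_(0 <= i < n) \sum_(0 <= j < n) Num.sg (t i j) * (U i.+1 j - U i j)).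
  under eq_bigr do under eq_bigr do rewrite norm_t.
  under eq_bigr do rewrite big_split /=.
  rewrite big_split /= mulr_natl mulr2n; congr (_ + _).
  rewrite exchange_big /=; apply: eq_bigr => i _; apply: eq_bigr => j _.
  by rewrite t_sym.
congr (_ * _); rewrite exchange_big /=; apply: eq_bigr => j _.
(* Abel summation around the cycle, which by periodicity leaves no boundary term. *)
have -> : \sum_(0 <= i < n) Num.sg (t i j) * (U i.+1 j - U i j) =
   \sum_(0 <= i < n) (Num.sg (t (i + n - 1) j) - Num.sg (t i j)) * U i j.
  under eq_bigr do rewrite mulrBr.
  under [RHS]eq_bigr do rewrite mulrBl.
  rewrite !sumrB; congr (_ - _).
  pose G i := Num.sg (t (i + n - 1) j) * U i j.
  rewrite -[RHS]/(\sum_(0 <= i < n) G i) -(sum_shift (G := G) 1).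
    apply: eq_bigr => i _; rewrite /G addn1 (_ : (i.+1 + n - 1 = i + n)%N); last lia.
    by rewrite /t -addSn !x_per.
  move=> i; rewrite /G /U /t x_per (_ : (i + n + n - 1 = i + n - 1 + n)%N); last lia.
  by rewrite -addSn !x_per.
pose G i := (Num.sg (t (i + n - 1) j) - Num.sg (t i j)) * U i j.
rewrite -[LHS]/(\sum_(0 <= i < n) G i) -(sum_shift (G := G) j).
  apply: eq_bigr => d _; rewrite /G /B (addnC d j); congr ((_ + _) * _).
    congr Num.sg; rewrite /t /plane_side; congr det4.
    by rewrite (_ : (j + d + n - 1).+1 = (j + d + n)%N); [rewrite x_per|lia].
  by rewrite -sgrN /t -det4_swap12.
move=> i; rewrite /G /U /t x_per (_ : (i + n + n - 1 = i + n - 1 + n)%N); last lia.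
by rewrite -!addSn !x_per.
Qed.

(** Since [x (j + n)] is [x j], the apex directly precedes the edge, and this is the plane of
    [B j 2] seen from the other end. One neighbour of the apex lies in that plane and contributes
    sign 0, so each of the two terms carries a single sign. *)
Lemma B_last j : B j.+1 (n - 1) = Num.sg (side j 2 (j + n - 1)) * side j 2 0.
Proof.
have e1 : (j.+1 + (n - 1) = j + n)%N by lia.
have e2 : (j + n + n - 1 = j + n - 1 + n)%N by lia.
have sE m : side j.+1 (n - 1) m = side j 2 m by rewrite /plane_side e1 x_per addn2 [RHS]det4_rot.
have e3 : side j 2 (j + n).+1 = 0 by rewrite /plane_side -addSn x_per det4_eq14.
by rewrite /B !sE e1 e2 (side_per x_per) e3 sgr0 addr0.
Qed.

Lemma B_two j : B j 2 = Num.sg (side j 2 j.+3) * side j 2 0.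
Proof.
have e1 : (j + 2 + n - 1 = j.+1 + n)%N by lia.
have e2 : ((j + 2).+1 = j.+3)%N by lia.
have e3 : side j 2 j.+1 = 0 by rewrite /plane_side det4_eq14.
by rewrite /B e1 e2 (side_per x_per) e3 sgr0 add0r.
Qed.

Lemma B_per j d : B (j + n) d = B j d.
Proof.
have sE m : side (j + n)%N d m = side j d m.
  by rewrite /plane_side -addnA (addnC n) addnA -addSn !x_per.
have e1 : (j + n + d + n - 1 = j + d + n - 1 + n)%N by lia.
have e2 : ((j + n + d).+1 = (j + d).+1 + n)%N by lia.
by rewrite /B !sE e1 e2 !(side_per x_per).
Qed.

(** For [d < 2] the three points are not distinct and the term vanishes. A triple of consecutive
    vertices occurs with [d = 2] and, one edge further, with [d = n - 1]; the two halves are added,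
    and the range on the right lists it once. *)
Lemma sum_tetrahedra :
  \sum_(0 <= i < n) \sum_(0 <= j < n) `|det4 (x i) (x i.+1) (x j) (x j.+1)| =
  4 * \sum_(2 <= d < n - 1) \sum_(0 <= j < n) facet_area n x j d.
Proof.
rewrite [LHS]sum_tetrahedra_step exchange_big /=.
pose S d := \sum_(0 <= j < n) B j d; rewrite -[\sum_(0 <= j < n) _]/(\sum_(0 <= d < n) S d).
have S01 d : (d < 2)%N -> S d = 0.
  move=> d2; apply: big1_seq => j _; suff e : side j d 0 = 0 by rewrite /B e mulr0.
  case: d d2 => [|[|//]] _; rewrite /plane_side ?addn0 ?addn1; first exact: det4_eq23.
  exact: det4_eq24.
have area2 : S 2%N + S (n - 1)%N = 2 * \sum_(0 <= j < n) facet_area n x j 2.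
  rewrite mulr_sumr addrC /S -(sum_shift (G := fun j => B j (n - 1)%N) 1); last first.
    by move=> j; exact: B_per.
  rewrite -big_split /= !big_nat; apply: eq_bigr => j /= jn.
  by rewrite addn1 B_last B_two -mulrDl consecutive_facet_term.
have aread d : (3 <= d)%N -> (d < n - 1)%N -> S d = 2 * \sum_(0 <= j < n) facet_area n x j d.
  move=> d3 dn; rewrite mulr_sumr /S !big_nat; apply: eq_bigr => j /= jn.
  by rewrite /B isolated_facet_term //; lia.
rewrite (big_cat_nat _ (n := 2)) //=; last lia.
rewrite [X in X + _]big_nat_cond [X in X + _]big1 ?add0r; last by move=> d /andP[/andP[_ /S01]].
have nE : n = (n - 1).+1 by lia.
rewrite [in X in 2 * X]nE big_nat_recr /=; last lia.
rewrite big_ltn; last lia.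
rewrite addrAC area2 [in RHS]big_ltn; last lia.
have four : 4 = 2 * 2 :> R by ring.
rewrite four -mulrA; congr (_ * _).
rewrite mulrDr; congr (_ + _).
by rewrite mulr_sumr !big_nat; apply: eq_bigr => d /andP[d3 dn]; exact: aread.
Qed.

End tetrahedra_sum.

(** * The volume of the hull of a polygon *)

(** Removing the null set [N] from every piece leaves a genuine partition and changes no measure. *)
Lemma measure_ae_partition (R : realType) (d : measure_display) (T : measurableType d)
  (mu : {measure set T -> \bar R}) (A N : set T) (I : finType) (P : pred I) (C : I -> set T) :
  measurable A -> measurable N -> mu N = 0%E -> (forall i, P i -> measurable (C i)) ->
  (forall i, P i -> C i `<=` A) ->
  (forall p, A p -> ~ N p -> exists2 i, P i & C i p) ->
  (forall p, ~ N p -> forall i j, P i -> P j -> C i p -> C j p -> i = j) ->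
  mu A = (\sum_(i | P i) mu (C i))%E.
Proof.
move=> mA mN N0 mC CA cover disj.
have muD B : measurable B -> mu B = mu (B `\` N).
  move=> mB; have e : mu (B `&` N) = 0%E.
    by apply: (subset_measure0 (B := N)) => //; exact: measurableI.
  by apply: etrans (measureDI mu mB mN) _; rewrite [X in (_ + X)%E]e adde0.
rewrite muD // (_ : A `\` N = \bigcup_(i in [set` P]) (C i `\` N)); last first.
  apply/seteqP; split=> [p [Ap Np]|p [i Pi [Cp Np]]].
    by have [i Pi Cp] := cover p Ap Np; exists i.
  by split => //; exact: CA Cp.
rewrite measure_fin_bigcup //.
- rewrite -(@bigfs _ _ _ _ (index_enum I) P) //; last 2 first.
  + exact: index_enum_uniq.
  + by move=> i _; rewrite mem_index_enum.
  by apply: eq_bigr => i Pi; exact: esym (muD _ (mC _ Pi)).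
- move=> i j Pi Pj [p [[Ci Np] [Cj _]]]; exact: disj Np i j Pi Pj Ci Cj.
- by move=> i Pi; apply: measurableD => //; exact: mC.
Qed.

Lemma card_extend (T : finType) (A B : {set T}) (k : nat) : B \subset A ->
  (#|B| <= k)%N -> (k <= #|A|)%N ->
  exists C : {set T}, [/\ B \subset C, C \subset A & #|C| = k].
Proof.
move=> BA Bk kA; have [m mk] := ubnP (k - #|B|); elim: m B mk BA Bk => // m IH B mk BA Bk.
have [e|ne] := eqVneq #|B| k; first by exists B; split.
have [x xA xB] : exists2 x, x \in A & x \notin B.
  by apply/subsetPn; apply: contraNN ne => /subset_leq_card AB; rewrite eqn_leq Bk (leq_trans kA).
have cB : #|(x |: B)%SET| = #|B|.+1 by rewrite cardsU1 xB.
have [||| C [BC CA Ck]] := IH (x |: B)%SET.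
- by rewrite cB; lia.
- by apply/fintype.subsetP => i; rewrite !inE => /predU1P[->|/(fintype.subsetP BA)].
- by rewrite cB; lia.
by exists C; split => //; apply: fintype.subset_trans BC; exact: finset.subsetUr.
Qed.

Lemma three_elements (T : finType) (A B : {set T}) : B \subset A ->
  (#|B| <= 3)%N -> (3 <= #|A|)%N ->
  exists a b c, [/\ [/\ a \in A, b \in A & c \in A], [/\ a != b, a != c & b != c]
    & B \subset [set a; b; c]%SET].
Proof.
move=> BA B3 A3; have [C [BC CA C3]] := card_extend BA B3 A3.
have : size (enum C) = 3%N by rewrite -cardE.
have Cu := enum_uniq C; have Cm i : (i \in enum C) = (i \in C) by rewrite mem_enum.
move: (enum C) Cu Cm => [|a [|b [|c [|]]]] //= u m _.
have aC : a \in C by rewrite -m !inE eqxx.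
have bC : b \in C by rewrite -m !inE eqxx orbT.
have cC : c \in C by rewrite -m !inE eqxx !orbT.
have sub := fintype.subsetP CA.
exists a, b, c; split; first by split; apply: sub.
  by move: u; rewrite !inE negb_or andbT => /andP[/andP[]].
by apply: fintype.subset_trans BC _; apply/fintype.subsetP => i; rewrite -m !inE orbA.
Qed.

Section hull_measurable.
Variables (R : realType) (n : nat) (z : 'I_n -> 'rV[R]_3) (o : 'I_n).
Local Notation V := 'rV[R]_3.
Local Notation I3 := ('I_n * 'I_n * 'I_n)%type.

Definition finite_hull : set V :=
  [set p | exists l : 'I_n -> R, [/\ forall i, 0 <= l i, \sum_i l i = 1 & p = \sum_i l i *: z i]].

Hypothesis n4 : (4 <= n)%N.
Let y i := z i - z o.
Hypothesis z_gen : forall a b c, a != o -> b != o -> c != o -> a != b -> a != c -> b != c ->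
  det3 (y a) (y b) (y c) != 0.

Lemma finite_hull_coef p : finite_hull p ->
  exists l : 'I_n -> R, [/\ forall i, 0 <= l i, \sum_i l i <= 1 & p - z o = \sum_i l i *: y i].
Proof.
move=> [l [l0 l1 ->]]; exists l; split => //; first by rewrite l1.
rewrite /y; under [RHS]eq_bigr do rewrite scalerBr.
by rewrite sumrB -scaler_suml l1 scale1r.
Qed.

Lemma sum_delta (W : lmodType R) (f : 'I_n -> W) (s : R) (a : 'I_n) :
  \sum_i (s *+ (i == a)) *: f i = s *: f a.
Proof.
rewrite (bigD1 a) //= eqxx mulr1n big1 ?addr0 // => i /negbTE ->.
by rewrite mulr0n scale0r.
Qed.

Lemma sum_delta1 (s : R) (a : 'I_n) : \sum_i (s *+ (i == a)) = s.
Proof.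
by rewrite (bigD1 a) //= eqxx mulr1n big1 ?addr0 // => i /negbTE ->.
Qed.

Lemma cone_finite_hull a b c : cone (z o) (y a) (y b) (y c) `<=` finite_hull.
Proof.
move=> p [s [t [r [s0 t0 r0 str ->]]]].
exists (fun i => (1 - s - t - r) *+ (i == o) + s *+ (i == a) + t *+ (i == b) + r *+ (i == c)); split.
- by move=> i; rewrite !addr_ge0 ?mulrn_wge0 //; lra.
- by rewrite !big_split /= !sum_delta1; ring.
- under eq_bigr do rewrite !scalerDl.
  rewrite !big_split /= !sum_delta /y; apply: eq_rV3; rewrite !mxE; ring.
Qed.

(** Carathéodory seen from the vertex [z o], with small supports padded to three distinct indices,
    which exist because [4 <= n]. As a finite union of nondegenerate simplices the hull is
    measurable. *)
Lemma finite_hullE : finite_hull =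
  \bigcup_(t in [set t : I3 | det3 (y t.1.1) (y t.1.2) (y t.2) != 0])
     cone (z o) (y t.1.1) (y t.1.2) (y t.2).
Proof.
have yo : y o = 0 by rewrite /y subrr.
apply/seteqP; split=> [p|p [t _]]; last exact: cone_finite_hull.
move=> /finite_hull_coef [l [l0 l1 pE]].
have [m [m0 mE ml m3 _]] := caratheodory_cone y l0.
have cA : #|[set~ o]%SET| = n.-1 by rewrite cardsC1 card_ord.
have [||| a [b [c [[ao bo co] [ab ac bc] sub]]]] :=
    @three_elements _ [set~ o]%SET (supp m :\ o)%SET.
- by apply/fintype.subsetP => i; rewrite !inE => /andP[].
- by apply: leq_trans m3; apply: subset_leq_card; exact: subD1set.
- by rewrite cA; lia.
rewrite !inE in ao bo co.
have mz i : i != a -> i != b -> i != c -> m i *: y i = 0.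
  move=> ia ib ic; have [->|io] := eqVneq i o; first by rewrite yo scaler0.
  have : i \notin (supp m :\ o)%SET.
    by apply: contraNN (ia) => /(fintype.subsetP sub); rewrite !inE (negbTE ib) (negbTE ic) !orbF.
  by rewrite !inE io /= negbK => /eqP ->; rewrite scale0r.
exists ((a, b), c); first exact: z_gen.
exists (m a), (m b), (m c); split=> //.
  apply: (le_trans _ l1); apply: (le_trans _ ml).
  rewrite (bigD1 a) //= (bigD1 b) //=; last by rewrite eq_sym.
  rewrite (bigD1 c) //=; last by rewrite ![c == _]eq_sym ac bc.
  by rewrite !addrA lerDl sumr_ge0.
apply: (addIr (- z o)); rewrite pE -mE (bigD1 a) //= (bigD1 b) //=; last by rewrite eq_sym.
rewrite (bigD1 c) //=; last by rewrite ![c == _]eq_sym ac bc.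
rewrite big1 ?addr0; last by move=> i /andP[/andP[ia ib] ic]; exact: mz.
by rewrite !addrA [RHS]addrC !addrA addNr add0r.
Qed.

Lemma vmeasurable_finite_hull : vmeasurable finite_hull.
Proof.
rewrite finite_hullE /vmeasurable preimage_bigcup; apply: fin_bigcup_measurable => //.
by move=> t D0; exact: vmeasurable_cone.
Qed.

End hull_measurable.

Section fans.
Variables (R : realType) (n : nat) (x : nat -> 'rV[R]_3).
Local Notation V := 'rV[R]_3.
Hypothesis n5 : (5 <= n)%N.
Hypothesis x_per : forall i, x (i + n)%N = x i.
Hypothesis x_gen : forall i j k l, (i < j)%N -> (j < k)%N -> (k < l)%N -> (l < i + n)%N ->
  det4 (x i) (x j) (x k) (x l) != 0.
Hypothesis x_alt : forall f, affine_form f -> forall i1 i2 i3 i4 i5 i6 : nat,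
  (i1 < i2 < i3)%N -> (i3 < i4 < i5)%N -> (i5 < i6 < i1 + n)%N ->
  [/\ f (x i1) < 0, 0 < f (x i2) & f (x i3) < 0] ->
  ~ [/\ 0 < f (x i4), f (x i5) < 0 & 0 < f (x i6)].

Local Notation side := (plane_side x).
Local Notation facet := (facet n x).

Definition vtx (i : 'I_n) := x i.

Lemma det4_origin_neq0 a b c : (0 < a < n)%N -> (0 < b < n)%N -> (0 < c < n)%N ->
  a != b -> a != c -> b != c -> det4 (x 0) (x a) (x b) (x c) != 0.
Proof.
move=> a0 b0 c0 ab ac bc.
have [lab|lab] := ltnP a b; have [lac|lac] := ltnP a c; have [lbc|lbc] := ltnP b c.
- by apply: x_gen; lia.
- by rewrite det4_swap34 oppr_eq0; apply: x_gen; lia.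
- lia.
- by rewrite -det4_rot; apply: x_gen; lia.
- by rewrite det4_swap23 oppr_eq0; apply: x_gen; lia.
- lia.
- by rewrite -det4_rot -det4_rot; apply: x_gen; lia.
- by rewrite det4_swap23 oppr_eq0 -det4_rot; apply: x_gen; lia.
Qed.

Lemma x_mod m : x m = x (m %% n).
Proof.
rewrite {1}(divn_eq m n) addnC; elim: (m %/ n)%N => [|k IH]; first by rewrite mul0n addn0.
by rewrite mulSn addnCA addnC x_per.
Qed.

Definition fan (j d : nat) : set V :=
  cone (x 0) (x (j + d)%N - x 0) (x j - x 0) (x j.+1 - x 0).

Lemma cone_swap12 (o u v w : V) : cone o u v w = cone o v u w.
Proof.
by apply/seteqP; split=> p [s [t [r [s0 t0 r0 str ->]]]]; exists t, s, r; split => //;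
  rewrite ?[t + s]addrC // [X in X + _]addrAC.
Qed.

Lemma cone_swap23 (o u v w : V) : cone o u v w = cone o u w v.
Proof.
by apply/seteqP; split=> p [s [t [r [s0 t0 r0 str ->]]]]; exists s, r, t; split => //;
  rewrite addrAC.
Qed.

(** If two of the three indices are adjacent, that pair is the edge of a fan with the third as apex;
    if none are, [facet_has_edge] gives a contradiction. *)
Lemma facet_of_support a b c : (0 < a)%N -> (a < b)%N -> (b < c)%N -> (c < n)%N ->
  (forall m, 0 <= det4 (x 0) (x a) (x b) (x c) * det4 (x m) (x a) (x b) (x c)) ->
  exists j d, [/\ (j < n)%N, (2 <= d < n - 1)%N, facet j d, side j d 0 != 0
    & cone (x 0) (x a - x 0) (x b - x 0) (x c - x 0) = fan j d].
Proof.
move=> a0 ab bc cn; set D := det4 (x 0) _ _ _ => supp.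
have D0 : D != 0 by apply: det4_origin_neq0; lia.
have facetI j d : (2 <= d < n - 1)%N -> (forall m, side j d m = det4 (x m) (x a) (x b) (x c)) -> facet j d.
  move=> d2 sE; have [Dp|Dn|Dz] := ltgtP 0 D; last by rewrite -Dz eqxx in D0.
    left => m mw md; rewrite lt_neqAle eq_sym (side_neq0 n5 x_gen) //=; [|lia|lia].
    by rewrite sE -(pmulr_rge0 _ Dp).
  right => m mw md; rewrite lt_neqAle (side_neq0 n5 x_gen) //=; [|lia|lia].
  by rewrite sE -(nmulr_rge0 _ Dn).
have [ba|ba] := eqVneq b a.+1.
  have d2 : (2 <= c - a < n - 1)%N by lia.
  have e : (a + (c - a) = c)%N by lia.
  have sE m : side a (c - a) m = det4 (x m) (x a) (x b) (x c).
    by rewrite /plane_side e -ba det4_rot.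
  exists a, (c - a)%N; split; [lia|exact: d2|exact: facetI|by rewrite sE|].
  by rewrite /fan e -ba cone_swap23 cone_swap12.
have [cb|cb] := eqVneq c b.+1.
  have d2 : (2 <= a + n - b < n - 1)%N by lia.
  have e : (b + (a + n - b) = a + n)%N by lia.
  have sE m : side b (a + n - b) m = det4 (x m) (x a) (x b) (x c).
    by rewrite /plane_side e x_per -cb.
  exists b, (a + n - b)%N; split; [lia|exact: d2|exact: facetI|by rewrite sE|].
  by rewrite /fan e x_per -cb.
exfalso.
(* The factor [D] makes the supported side positive whatever the orientation. As [x 0] lies
   cyclically between [x c] and [x a], the third gap is at least two as well. *)
have ff : affine_form (fun p => 0 + D * det4 p (x a) (x b) (x c)).
  by apply: affine_form_comb; [exact: affine_form_cst|exact: affine_form_det4].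
apply: (facet_has_edge n5 x_alt ff (a := a) (b := b) (c := c)); try lia.
- by rewrite det4_eq12 mulr0 addr0.
- by rewrite det4_eq13 mulr0 addr0.
- by rewrite det4_eq14 mulr0 addr0.
move=> m mw mb mc; rewrite add0r lt_neqAle supp andbT eq_sym mulf_neq0 //.
have [lb|lb] := ltnP m b.
  by rewrite det4_swap12 oppr_eq0; apply: x_gen; lia.
have [lc|lc] := ltnP m c.
  by rewrite det4_swap12 det4_swap23 opprK; apply: x_gen; lia.
by rewrite det4_swap12 det4_swap23 det4_swap34 opprK oppr_eq0; apply: x_gen; lia.
Qed.

Lemma facet_of_support_perm a b c : (0 < a < n)%N -> (0 < b < n)%N -> (0 < c < n)%N ->
  a != b -> a != c -> b != c ->
  (forall m, 0 <= det4 (x 0) (x a) (x b) (x c) * det4 (x m) (x a) (x b) (x c)) ->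
  exists j d, [/\ (j < n)%N, (2 <= d < n - 1)%N, facet j d, side j d 0 != 0
    & cone (x 0) (x a - x 0) (x b - x 0) (x c - x 0) = fan j d].
Proof.
move=> a0 b0 c0 ab ac bc sp.
have sp23 (u v w : V) : (forall m, 0 <= det4 (x 0) u v w * det4 (x m) u v w) ->
    forall m, 0 <= det4 (x 0) v u w * det4 (x m) v u w.
  by move=> H m; rewrite (det4_swap23 (x 0) u v) (det4_swap23 (x m) u v) mulrNN.
have sp34 (u v w : V) : (forall m, 0 <= det4 (x 0) u v w * det4 (x m) u v w) ->
    forall m, 0 <= det4 (x 0) u w v * det4 (x m) u w v.
  by move=> H m; rewrite (det4_swap34 (x 0) u v) (det4_swap34 (x m) u v) mulrNN.
have [lab|lab] := ltnP a b; have [lac|lac] := ltnP a c; have [lbc|lbc] := ltnP b c.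
- by apply: facet_of_support => //; lia.
- by rewrite cone_swap23; apply: facet_of_support; [lia|lia|lia|lia|exact: sp34].
- lia.
- rewrite cone_swap23 cone_swap12.
  by apply: facet_of_support; [lia|lia|lia|lia|exact/sp23/sp34].
- by rewrite cone_swap12; apply: facet_of_support; [lia|lia|lia|lia|exact: sp23].
- lia.
- rewrite cone_swap12 cone_swap23.
  by apply: facet_of_support; [lia|lia|lia|lia|exact/sp34/sp23].
- rewrite cone_swap12 cone_swap23 cone_swap12.
  by apply: facet_of_support; [lia|lia|lia|lia|exact/sp23/sp34/sp23].
Qed.

End fans.

Section polygon_volume.
Variables (R : realType) (n : nat) (x : nat -> 'rV[R]_3).
Local Notation V := 'rV[R]_3.
Hypothesis n5 : (5 <= n)%N.
Hypothesis x_per : forall i, x (i + n)%N = x i.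
Hypothesis x_gen : forall i j k l, (i < j)%N -> (j < k)%N -> (k < l)%N -> (l < i + n)%N ->
  det4 (x i) (x j) (x k) (x l) != 0.
Hypothesis x_alt : forall f, affine_form f -> forall i1 i2 i3 i4 i5 i6 : nat,
  (i1 < i2 < i3)%N -> (i3 < i4 < i5)%N -> (i5 < i6 < i1 + n)%N ->
  [/\ f (x i1) < 0, 0 < f (x i2) & f (x i3) < 0] ->
  ~ [/\ 0 < f (x i4), f (x i5) < 0 & 0 < f (x i6)].

Local Notation side := (plane_side x).
Local Notation facet := (facet n x).
Local Notation fan := (fan x).

Let n_gt0 : (0 < n)%N. Proof. lia. Qed.
Let o : 'I_n := Ordinal n_gt0.
Let y (m : nat) := x m - x 0.
Let hull := finite_hull (vtx (n := n) x).

Definition good_pair (t : 'I_n * 'I_n) := [&& t.1 != o, t.2 != o & t.1 != t.2].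

(** Off these planes through [x 0] no coordinate of the point with respect to a triple vanishes, so
    the linear program is nondegenerate and no point lies on the common boundary of two cones. *)
Definition exceptional : set V :=
  \bigcup_(t in [set` good_pair]) [set p | det3 (y t.1) (y t.2) (p - x 0) = 0].

Let xM m : x m = x (m %% n) := x_mod x_per m.

Lemma vtx_gen (a b c : 'I_n) : a != o -> b != o -> c != o -> a != b -> a != c -> b != c ->
  det3 (y a) (y b) (y c) != 0.
Proof.
move=> a0 b0 c0 ab ac bc.
have pos (i : 'I_n) : i != o -> (0 < i < n)%N.
  by move=> io; rewrite ltn_ord andbT lt0n.
by apply: (det4_origin_neq0 n5 x_gen); try exact: pos.
Qed.

Lemma third_index (a b : 'I_n) : exists2 c : 'I_n, c != o & c != a /\ c != b.
Proof.
have l1 : (1 < n)%N by lia.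
have l2 : (2 < n)%N by lia.
have l3 : (3 < n)%N by lia.
have [e1|e1] := boolP ((Ordinal l1 != a) && (Ordinal l1 != b)).
  by exists (Ordinal l1) => //; exact/andP.
have [e2|e2] := boolP ((Ordinal l2 != a) && (Ordinal l2 != b)).
  by exists (Ordinal l2) => //; exact/andP.
exists (Ordinal l3) => //; rewrite -!(inj_eq val_inj) /= in e1 e2 *.
by split; apply/eqP => e3; move: e1 e2; rewrite -e3 /=; lia.
Qed.

Lemma exceptional_null : vmeasurable exceptional /\ vol exceptional = 0%E.
Proof.
have pl t : good_pair t -> let A := [set p | det3 (y t.1) (y t.2) (p - x 0) = 0] in
    vmeasurable A /\ vol A = 0%E.
  move=> /and3P[t1 t2 t12]; have [c co [c1 c2]] := third_index t.1 t.2.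
  apply: (@vol_plane _ (x 0) (y t.1) (y t.2) (y c)).
  by apply: vtx_gen => //; rewrite eq_sym.
have mE : vmeasurable exceptional.
  rewrite /vmeasurable /exceptional preimage_bigcup; apply: fin_bigcup_measurable => //.
  by move=> t gt; have [] := pl t gt.
split => //; apply: measure_negligible => //.
rewrite -[X in _.-negligible X]/(of_coords (R := R) @^-1` exceptional).
rewrite /exceptional preimage_bigcup (@bigcup_pred _ _ good_pair).
apply: (big_ind (fun A => (lam3 R).-negligible A)); first exact: negligible_set0.
  by move=> A B; exact: negligibleU.
by move=> t gt; have [m0 v0] := pl t gt; apply/negligibleP.
Qed.

Lemma generic_det p a b v : ~ exceptional p -> det3 (y a) (y b) v != 0 ->
  det3 (y a) (y b) (p - x 0) != 0.
Proof.
move=> Np D0; apply/eqP => e; apply: Np.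
exists (Ordinal (ltn_pmod a n_gt0), Ordinal (ltn_pmod b n_gt0)) => /=; last by rewrite /y -!xM.
have yM m : y m = y (m %% n) by rewrite /y [in LHS]xM.
apply/and3P; split; apply: contraNneq D0 => /(congr1 val) /= e0.
- by rewrite yM e0 /y subrr !det3E !mxE; apply/eqP; ring.
- by rewrite [y b]yM e0 /y subrr !det3E !mxE; apply/eqP; ring.
- by rewrite [y b]yM -e0 -yM !det3E; apply/eqP; ring.
Qed.

Lemma exists_fan p : hull p -> ~ exceptional p ->
  exists j d, [/\ (j < n)%N, (2 <= d < n - 1)%N, facet j d, side j d 0 != 0 & fan j d p].
Proof.
move=> hp Np.
have [l [l0 l1 pE]] := finite_hull_coef o hp.
have y_o : y o = 0 by rewrite /y subrr.
pose q := p - x 0.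
have q_gen (a b : 'I_n) : a != o -> b != o -> a != b -> det3 (y a) (y b) q != 0.
  move=> ao bo ab; have [c co [ca cb]] := third_index a b.
  by apply: (generic_det (v := y c)) => //; apply: vtx_gen => //; rewrite eq_sym.
have i1 : (1 < n)%N by lia.
have i2 : (2 < n)%N by lia.
have i3 : (3 < n)%N by lia.
have [a [b [c [s1 [s2 [s3 [D0 [s10 s20 s30] s1s qE opt]]]]]]] :=
  @optimal_triple R n (fun i : 'I_n => y i) o q y_o vtx_gen q_gen l
    (Ordinal i1) (Ordinal i2) (Ordinal i3) isT isT isT isT isT isT l0 pE l1.
have [[/= ao bo co] [/= ab ac bc]] := D_neq (y := fun i : 'I_n => y i) (t := ((a, b), c)) y_o D0.
have pos (i : 'I_n) : i != o -> (0 < i < n)%N by move=> io; rewrite ltn_ord andbT lt0n.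
have [|j [d [jn d2 fjd s0 fE]]] := facet_of_support_perm n5 x_per x_gen x_alt
    (pos _ ao) (pos _ bo) (pos _ co) ab ac bc.
  move=> m; rewrite (xM m); have := opt (Ordinal (ltn_pmod m n_gt0)); rewrite /=.
  set m' := (m %% n)%N; set D := det3 (y a) (y b) (y c) in D0 *.
  (* The dual functional is 0 at [x 0] and 1 on the plane of the triple, so the side of a vertex is
     [D] times one minus its dual value. Dual feasibility thus puts every vertex weakly on the side
     of [x 0]. *)
  move=> le1; rewrite -[det4 (x 0) _ _ _]/D; have -> : det4 (x m') (x a) (x b) (x c) =
     D * (1 - (det3 (y m') (y b) (y c) + det3 (y a) (y m') (y c) + det3 (y a) (y b) (y m')) / D).
    rewrite mulrBr mulr1 mulrCA mulfV // mulr1 /D /det4 /y !det3E !mxE; ring.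
  by rewrite mulrA mulr_ge0 ?subr_ge0 // -expr2 sqr_ge0.
exists j, d; split => //; rewrite -fE.
exists s1, s2, s3; split; try exact: ltW.
  by [].
have pq : p = x 0 + q by rewrite /q addrCA subrr addr0.
by rewrite pq qE !addrA.
Qed.

(** The linear functional on vectors from [x 0] with value 1 on the plane of the triple; on a facet
    it is at most 1 at every vertex. *)
Let h (j d : nat) (v : V) := (det3 v (y j) (y j.+1) + det3 (y (j + d)) v (y j.+1)
  + det3 (y (j + d)) (y j) v) / side j d 0.

Lemma sideE j d m : side j d 0 != 0 -> side j d m = side j d 0 * (1 - h j d (y m)).
Proof.
move=> D0; rewrite /h mulrBr mulr1 mulrCA mulfV // mulr1.
by rewrite /plane_side /det4 /y !det3E !mxE; ring.
Qed.

Lemma side_zero j d m : (j < n)%N -> (2 <= d < n - 1)%N -> (0 < m < n)%N -> side j d m = 0 ->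
  [\/ m = j, m = j.+1, m = j + d | m + n = j + d]%N.
Proof.
move=> jn d2 mn s0; have [lt|ge] := ltnP j m.
  have [e|ne] := eqVneq m j.+1; first by constructor 2.
  have [e|ne'] := eqVneq m (j + d)%N; first by constructor 3.
  have := side_neq0 n5 x_gen (j := j) (d := d) (m := m); rewrite s0 eqxx => H.
  by exfalso; suff: false by []; apply: H; lia.
have [e|ne] := eqVneq m j; first by constructor 1.
have [e|ne'] := eqVneq (m + n)%N (j + d)%N; first by constructor 4.
have := side_neq0 n5 x_gen (j := j) (d := d) (m := (m + n)%N); rewrite (side_per x_per) s0 eqxx => H.
by exfalso; suff: false by []; apply: H; lia.
Qed.

Lemma facet_sign j d m : (j < n)%N -> (2 <= d < n - 1)%N -> facet j d -> side j d 0 != 0 ->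
  side j d m != 0 -> 0 < side j d 0 * side j d m.
Proof.
move=> jn d2 fjd s0 sm.
have win m' : side j d m' != 0 -> exists2 m'', (j.+1 < m'' < j + n)%N /\ m'' != (j + d)%N & side j d m' = side j d m''.
  move=> s'; have sM : side j d m' = side j d (m' %% n) by rewrite /plane_side xM.
  have lt := ltn_pmod m' n_gt0; rewrite sM in s' *.
  have n1 : (m' %% n != j)%N by apply: contraNneq s' => ->; rewrite /plane_side det4_eq13.
  have n2 : (m' %% n != j.+1)%N by apply: contraNneq s' => ->; rewrite /plane_side det4_eq14.
  have n3 : (m' %% n != j + d)%N by apply: contraNneq s' => ->; rewrite /plane_side det4_eq12.
  have n4 : (m' %% n + n != j + d)%N.
    by apply: contraNneq s' => e; rewrite -(side_per x_per) e /plane_side det4_eq12.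
  have n6 : (m' %% n + n != j.+1)%N.
    by apply: contraNneq s' => e; rewrite -(side_per x_per) e /plane_side det4_eq14.
  have [lt1|ge1] := ltnP j (m' %% n)%N; first by exists (m' %% n)%N => //; split => //; lia.
  by exists (m' %% n + n)%N; [split => //; lia|rewrite (side_per x_per)].
have [m1 [w1 w1'] ->] := win _ s0; have [m2 [w2 w2'] ->] := win _ sm.
exact: (facet_mul fjd).
Qed.

Lemma h_le1 j d m : (j < n)%N -> (2 <= d < n - 1)%N -> facet j d -> side j d 0 != 0 ->
  h j d (y m) <= 1 /\ (h j d (y m) = 1 -> side j d m = 0).
Proof.
move=> jn d2 fjd s0; have sE := sideE m s0.
split; last by move=> h1; rewrite sE h1 subrr mulr0.
have [e|ne] := eqVneq (side j d m) 0.
  have : side j d 0 * (1 - h j d (y m)) == 0 by rewrite -sE e.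
  by rewrite mulf_eq0 (negbTE s0) /= subr_eq0 => /eqP <-.
have := facet_sign jn d2 fjd s0 ne; rewrite sE mulrA -expr2.
by rewrite pmulr_rgt0 ?exprn_even_gt0 //= subr_gt0 => /ltW.
Qed.

Lemma h_comb j d (a b c : R) u v w :
  h j d (a *: u + b *: v + c *: w) = a * h j d u + b * h j d v + c * h j d w.
Proof. by rewrite /h !det3E !mxE; ring. Qed.

Lemma h_vertices j d : side j d 0 != 0 ->
  [/\ h j d (y (j + d)) = 1, h j d (y j) = 1 & h j d (y j.+1) = 1].
Proof.
move=> s0; have key m : side j d m = 0 -> h j d (y m) = 1.
  by rewrite sideE // => /eqP; rewrite mulf_eq0 (negbTE s0) /= subr_eq0 => /eqP <-.
by split; apply: key; rewrite /plane_side ?det4_eq12 ?det4_eq13 ?det4_eq14.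
Qed.

Lemma fan_coef j d p : ~ exceptional p -> side j d 0 != 0 -> fan j d p ->
  exists a b c, [/\ 0 < a, 0 < b, 0 < c & p - x 0 = a *: y (j + d) + b *: y j + c *: y j.+1].
Proof.
move=> Np s0 [a [b [c [a0 b0 c0 _ pE]]]].
have qE : p - x 0 = a *: y (j + d) + b *: y j + c *: y j.+1.
  by rewrite pE addrC !addrA addNr add0r.
have D0 : det3 (y (j + d)) (y j) (y j.+1) != 0 by [].
have n1 : det3 (y j) (y j.+1) (p - x 0) != 0.
  by apply: (generic_det (v := y (j + d)) Np); move: D0; rewrite !det3E; apply: contraNneq => <-; apply/eqP; ring.
have n2 : det3 (y (j + d)) (y j.+1) (p - x 0) != 0.
  by apply: (generic_det (v := y j) Np); rewrite det3_swap23 oppr_eq0.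
have n3 : det3 (y (j + d)) (y j) (p - x 0) != 0 by apply: (generic_det (v := y j.+1) Np).
exists a, b, c; split => //; rewrite lt_neqAle eq_sym ?a0 ?b0 ?c0 andbT.
- by apply: contraNneq n1 => e; rewrite qE e !det3E !mxE; apply/eqP; ring.
- by apply: contraNneq n2 => e; rewrite qE e !det3E !mxE; apply/eqP; ring.
- by apply: contraNneq n3 => e; rewrite qE e !det3E !mxE; apply/eqP; ring.
Qed.

(** Evaluating each functional [h] on the representation by the other triple bounds either weight by
    the other, so they are equal. Equality with positive coefficients forces [h j d = 1] at all
    three vertices of the second triple, which therefore lie in the plane of the first; by general
    position the triples agree, and the range of [d] gives each triple only one name. *)
Lemma fan_unique p j d j' d' : ~ exceptional p ->
  (j < n)%N -> (2 <= d < n - 1)%N -> facet j d -> side j d 0 != 0 -> fan j d p ->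
  (j' < n)%N -> (2 <= d' < n - 1)%N -> facet j' d' -> side j' d' 0 != 0 -> fan j' d' p ->
  j = j' /\ d = d'.
Proof.
move=> Np jn d2 fjd s0 Fp jn' d2' fjd' s0' Fp'.
have [a [b [c [a0 b0 c0 qE]]]] := fan_coef Np s0 Fp.
have [a' [b' [c' [a0' b0' c0' qE']]]] := fan_coef Np s0' Fp'.
have [h1 h2 h3] := h_vertices s0; have [h1' h2' h3'] := h_vertices s0'.
have hq : h j d (p - x 0) = a + b + c by rewrite qE h_comb h1 h2 h3 !mulr1.
have hq' : h j' d' (p - x 0) = a' + b' + c' by rewrite qE' h_comb h1' h2' h3' !mulr1.
have le1 m := (h_le1 m jn d2 fjd s0).1; have eq1 m := (h_le1 m jn d2 fjd s0).2.
have le1' m := (h_le1 m jn' d2' fjd' s0').1.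
have mle (s t : R) : 0 < s -> t <= 1 -> s * t <= s by move=> s_0 t1; rewrite ler_piMr // ltW.
have Sle : a' + b' + c' <= a + b + c.
  by rewrite -hq' qE h_comb !lerD // mle.
have Seq : a' * h j d (y (j' + d')) + b' * h j d (y j') + c' * h j d (y j'.+1) = a + b + c.
  by rewrite -hq qE' h_comb.
have l1 := mle _ _ a0' (le1 (j' + d')%N).
have l2 := mle _ _ b0' (le1 j').
have l3 := mle _ _ c0' (le1 j'.+1).
have eqh (s t : R) : 0 < s -> s * t = s -> t = 1.
  by move=> s_0 /eqP; rewrite -[X in _ == X]mulr1 => /eqP /mulfI; apply; rewrite gt_eqF.
have z1 : side j d (j' + d') = 0 by apply: eq1; apply: (eqh _ _ a0'); lra.
have z2 : side j d j' = 0 by apply: eq1; apply: (eqh _ _ b0'); lra.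
have z3 : side j d j'.+1 = 0 by apply: eq1; apply: (eqh _ _ c0'); lra.
(* As [x 0] is off both planes, none of the three indices is congruent to 0. *)
have [j1 j2 j3] : [/\ (0 < j')%N, (j'.+1 < n)%N & (j' + d' != n)%N].
  split; [rewrite lt0n|rewrite ltn_neqAle jn' andbT|]; apply: contraNneq s0' => e.
  - by rewrite /plane_side -e det4_eq13.
  - by rewrite /plane_side e -[n]add0n x_per det4_eq14.
  - by rewrite /plane_side e -[n]add0n x_per det4_eq12.
have [k1 k2 k3] : [/\ (0 < j)%N, (j.+1 < n)%N & (j + d != n)%N].
  split; [rewrite lt0n|rewrite ltn_neqAle jn andbT|]; apply: contraNneq s0 => e.
  - by rewrite /plane_side -e det4_eq13.
  - by rewrite /plane_side e -[n]add0n x_per det4_eq14.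
  - by rewrite /plane_side e -[n]add0n x_per det4_eq12.
have w2 : (0 < j' < n)%N by rewrite j1.
have w3 : (0 < j'.+1 < n)%N by rewrite j2.
have H2 := side_zero jn d2 w2 z2; have H3 := side_zero jn d2 w3 z3.
have [lt|ge] := ltnP (j' + d') n.
  have w1 : (0 < j' + d' < n)%N by rewrite lt addn_gt0 j1.
  have H1 := side_zero jn d2 w1 z1.
  clear -H1 H2 H3 d2 d2' lt j1 j2 k1 k2 k3.
  by case: H1 => H1; case: H2 => H2; case: H3 => H3; lia.
have w1 : (0 < j' + d' - n < n)%N by clear -ge j1 j2 j3 jn' d2'; lia.
have z1' : side j d (j' + d' - n) = 0.
  by rewrite -z1 -(side_per x_per) subnK.
have H1 := side_zero jn d2 w1 z1'.
clear -H1 H2 H3 d2 d2' ge j1 j2 j3 k1 k2 k3.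
by case: H1 => H1; case: H2 => H2; case: H3 => H3; lia.
Qed.

Lemma vol_finite_hull : vol hull =
  (24^-1 * \sum_(0 <= i < n) \sum_(0 <= j < n) `|det4 (x i) (x i.+1) (x j) (x j.+1)|)%:E.
Proof.
have n4 : (4 <= n)%N by lia.
(* Facets containing [x 0] have a degenerate cone; they are left out here and have [facet_area] zero
   in the sum. *)
pose Q (t : 'I_n * 'I_n) := [&& (2 <= t.2)%N, (t.2 < n - 1)%N, `[< facet t.1 t.2 >] & side t.1 t.2 0 != 0].
have QP t : Q t -> [/\ (2 <= t.2 < n - 1)%N, facet t.1 t.2 & side t.1 t.2 0 != 0].
  by move=> /and4P[-> -> /asboolP ? ?].
have [mE vE] := exceptional_null.
have mH : vmeasurable hull by exact: (vmeasurable_finite_hull (o := o) n4 vtx_gen).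
have mF t : Q t -> vmeasurable (fan t.1 t.2) by move=> /QP[_ _ s0]; exact: vmeasurable_cone.
have -> : vol hull = (\sum_(t | Q t) vol (fan t.1 t.2))%E.
  apply: (@measure_ae_partition _ _ _ (lam3 R) (of_coords (R := R) @^-1` hull)
    (of_coords (R := R) @^-1` exceptional) _ Q (fun t => of_coords (R := R) @^-1` fan t.1 t.2)) => //.
  - move=> t /QP[d2 _ _] p /= [s1 [s2 [s3 Hp]]].
    apply: (@cone_finite_hull _ _ (vtx (n := n) x) o (Ordinal (ltn_pmod (t.1 + t.2)%N n_gt0)) t.1 (Ordinal (ltn_pmod t.1.+1 n_gt0))).
    by exists s1, s2, s3; rewrite /vtx /= -!xM.
  - move=> p hp Np; have [j [d [jn d2 fjd s0 Fp]]] := exists_fan hp Np.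
    have dn : (d < n)%N by lia.
    exists (Ordinal jn, Ordinal dn) => //=; apply/and4P; split => //=; try lia.
    exact/asboolP.
  - move=> p Np [j d] [j' d'] /QP[/= d2 f s0] /QP[/= d2' f' s0'] Fp Fp'.
    by have [/val_inj -> /val_inj ->] := fan_unique Np (ltn_ord j) d2 f s0 Fp (ltn_ord j') d2' f' s0' Fp'.
have -> : (\sum_(t | Q t) vol (fan t.1 t.2) = \sum_(t | Q t) (`|side t.1 t.2 0| / 6)%:E)%E.
  by apply: eq_bigr => t /QP[_ _ s0]; rewrite /fan vol_cone.
rewrite sumEFin; congr _%:E.
rewrite (sum_tetrahedra n5 x_per x_gen x_alt).
transitivity (6^-1 * \sum_(2 <= d < n - 1) \sum_(0 <= j < n) facet_area n x j d); last by field.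
have -> : \sum_(2 <= d < n - 1) \sum_(0 <= j < n) facet_area n x j d =
    \sum_(d < n) \sum_(j < n) (if (2 <= d)%N && (d < n - 1)%N then facet_area n x j d else 0).
  rewrite (big_nat_widen _ _ n) ?leq_subr // (big_nat_widenl _ 0) // big_mkord big_mkcond /=.
  apply: eq_bigr => d _; rewrite andbC; case: ifP => _; first by rewrite big_mkord.
  by rewrite big1.
rewrite exchange_big /= pair_bigA /= mulr_sumr big_mkcond /=; apply: eq_bigr => t _.
have [q|nq] := boolP (Q t).
  by have [/andP[a b] f s0] := QP t q; rewrite a b /facet_area (asboolT f) mulr1n [RHS]mulrC.
case: ifP => [/andP[a b]|_]; last by rewrite mulr0.
move: nq; rewrite /Q a b /facet_area; case: asboolP => [f|nf]; last by rewrite mulr0n mulr0.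
by rewrite negbK => /eqP ->; rewrite normr0 mul0rn mulr0.
Qed.

End polygon_volume.

(** * Planes and the curve *)

Section within_calculus.
Variables (R : realType).
Local Notation V := 'rV[R]_3.

Lemma coord_le_norm (A : V) k : `|A ord0 k| <= `|A|.
Proof.
rewrite [leRHS]/Num.norm /= mx_normrE.
exact: (le_bigmax _ (fun ij : 'I_1 * 'I_3 => `|A ij.1 ij.2|) (ord0, k)).
Qed.

Lemma within_quotient_near (D : set R) (f : R -> V) t e :
  cvg (within_quotient D f t) -> 0 < e ->
  exists2 d, 0 < d & forall h, h != 0 -> `|h| < d -> D (h + t) ->
    `|h^-1 *: (f (h + t) - f t) - derive1_in D f t| < e.
Proof.
move=> cv e0.
have {}cv : (fun h => h^-1 *: (f (h + t) - f t)) @ within (fun h => D (h + t)) 0^'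
    --> derive1_in D f t by [].
have /cvgrPdist_lt /(_ e e0) := cv.
rewrite !near_withinE => /nbhs_ballP[d /= d0 H].
exists d => // h h0 hd Dh; rewrite distrC.
by apply: H => //=; rewrite /ball /= sub0r normrN.
Qed.

Lemma within_quotient_coord (D : set R) (f : R -> V) t e k :
  cvg (within_quotient D f t) -> 0 < e ->
  exists2 d, 0 < d & forall h, h != 0 -> `|h| < d -> D (h + t) ->
    `|h^-1 * (f (h + t) ord0 k - f t ord0 k) - derive1_in D f t ord0 k| < e.
Proof.
move=> cv e0; have [d d0 H] := within_quotient_near cv e0.
exists d => // h h0 hd Dh; apply: le_lt_trans (H h h0 hd Dh).
have := coord_le_norm (h^-1 *: (f (h + t) - f t) - derive1_in D f t) k.
by rewrite !mxE.
Qed.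

Lemma derivable_in_norm_continuous (D : set R) (f : R -> V) t e :
  cvg (within_quotient D f t) -> 0 < e ->
  exists2 d, 0 < d & forall s, `|s - t| < d -> D s -> `|f s - f t| < e.
Proof.
move=> cv e0; have [d d0 H] := within_quotient_near cv ltr01.
set l := derive1_in D f t in H.
have l1 : 0 < `|l| + 1 by rewrite ltr_wpDl.
exists (Num.min d (e / (`|l| + 1))); first by rewrite lt_min d0 divr_gt0.
move=> s; rewrite lt_min => /andP[sd se] Ds.
have [->|st] := eqVneq s t; first by rewrite subrr normr0.
have h0 : s - t != 0 by rewrite subr_eq0.
have := H (s - t) h0 sd; rewrite subrK => /(_ Ds) lt1.
have q : `|(s - t)^-1 *: (f s - f t)| < `|l| + 1.
  rewrite -[X in `|X|](subrK l); apply: le_lt_trans (ler_normD _ _) _.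
  by rewrite addrC ltrD2l.
have -> : f s - f t = (s - t) *: ((s - t)^-1 *: (f s - f t)).
  by rewrite scalerA mulfV // scale1r.
rewrite normrZ; apply: (@le_lt_trans _ _ (`|s - t| * (`|l| + 1))).
  by rewrite ler_wpM2l // ltW.
by rewrite -ltr_pdivlMr.
Qed.

Lemma derivable_in_continuous (D : set R) (f : R -> V) t e k :
  cvg (within_quotient D f t) -> 0 < e ->
  exists2 d, 0 < d & forall s, `|s - t| < d -> D s -> `|f s ord0 k - f t ord0 k| < e.
Proof.
move=> cv e0; have [d d0 H] := derivable_in_norm_continuous cv e0.
exists d => // s sd Ds; apply: le_lt_trans (H s sd Ds).
by have := coord_le_norm (f s - f t) k; rewrite !mxE.
Qed.

(** Near an interior point the restriction of increments to the segment is void, so the one-sided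
    notion agrees with the derivative to which the mean value theorem applies. *)
Lemma is_derive_interior (a b : R) (f : R -> V) t k : a < t < b ->
  cvg (within_quotient `[a, b] f t) ->
  is_derive t 1 (fun s => f s ord0 k) (derive1_in `[a, b] f t ord0 k).
Proof.
move=> /andP[at_ tb] cv.
have lim : (fun h : R => h^-1 *: (((fun s => f s ord0 k) \o shift t) (h *: (1 : R^o)) - f t ord0 k)) @ 0^'
    --> derive1_in `[a, b] f t ord0 k.
  apply/cvgrPdist_lt => e e0.
  have [d d0 H] := within_quotient_coord k cv e0.
  rewrite near_withinE; apply/nbhs_ballP.
  exists (Num.min d (Num.min (t - a) (b - t))) => /=.
    by rewrite !lt_min d0 !subr_gt0 at_ tb.
  move=> h /=; rewrite /ball /= sub0r normrN !lt_min => /andP[hd /andP[ha hb]] h0.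
  have hh : h *: (1 : R^o) = h by exact: mulr1.
  rewrite distrC /shift /= hh.
  apply: H => //=; rewrite in_itv /=.
  by move: ha hb; rewrite !ltr_norml => /andP[? ?] /andP[? ?]; apply/andP; split; lra.
by split; [apply/cvg_ex; eexists; exact: lim|exact/cvg_lim].
Qed.

Lemma within_continuousP (a b : R) (f : R -> R) :
  (forall t e, t \in `[a, b] -> 0 < e -> exists2 d, 0 < d &
     forall s, `|s - t| < d -> s \in `[a, b] -> `|f s - f t| < e) ->
  {within `[a, b], continuous f}.
Proof.
move=> H; apply/subspace_continuousP => t tab; apply/cvgrPdist_lt => e e0.
have [d d0 Hd] := H t e tab e0.
rewrite near_withinE; apply/nbhs_ballP; exists d => //= s; rewrite /ball /= => st sab.
by rewrite distrC; apply: Hd => //; rewrite distrC.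
Qed.

End within_calculus.

Section curve_zeros.
Variables (R : realType) (L : R) (gamma : R -> 'rV[R]_3).
Local Notation V := 'rV[R]_3.
Hypothesis gamma_planes : forall (nu : V) (c : R), nu != 0 -> (plane_count L gamma nu c <= 4%:E)%E.

Lemma no_five_zeros nu c (s : seq R) : nu != 0 -> uniq s -> size s = 5%N ->
  (forall t, t \in s -> plane_params L gamma nu c t) -> False.
Proof.
move=> nu0 us s5 sP; have := gamma_planes c nu0; rewrite leNgt => /negP; apply.
apply: (@lt_le_trans _ _ 5%:E%E); first by rewrite lte_fin ltr_nat.
apply: esum_ge; exists [set` s]; first by split; [exact: finite_seq|].
rewrite -fsbig_seq //.
apply: (@le_trans _ _ (\sum_(a <- s) 1%:E)%E).
  by rewrite sumEFin lee_fin big_const_seq count_predT s5 iter_addr_0.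
apply: lee_sum => t _; rewrite lee_fin /multiplicity.
by do 3![case: ifP => _; first by rewrite ler1n]; rewrite ler1n.
Qed.

Lemma finite_plane_params nu c : nu != 0 -> finite_set (plane_params L gamma nu c).
Proof.
move=> nu0; apply: contrapT => /(infinite_set_fset 5)[X XP X5].
pose s := take 5 (finmap.finmap.enum_fset X).
apply: (@no_five_zeros nu c s) => //.
- by apply: take_uniq; exact: finmap.finmap.fset_uniq.
- by rewrite size_takel.
- by move=> t /mem_take tX; apply: XP.
Qed.

End curve_zeros.

Section curve_alternation.
Variables (R : realType) (L : R) (gamma : R -> 'rV[R]_3).
Local Notation V := 'rV[R]_3.
Hypothesis gamma_der : derivable_in `[0, L] gamma.
Hypothesis gamma_planes : forall (nu : V) (c : R), nu != 0 -> (plane_count L gamma nu c <= 4%:E)%E.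

Lemma coord_within_continuous a b k : 0 <= a -> b <= L ->
  {within `[a, b], continuous (fun t => gamma t ord0 k)}.
Proof.
move=> a0 bL; apply: within_continuousP => t e; rewrite in_itv /= => /andP[at_ tb] e0.
have tD : `[0, L]%classic t by rewrite /= in_itv /= (le_trans a0 at_) (le_trans tb bL).
have [d d0 H] := derivable_in_continuous k (gamma_der tD) e0.
exists d => // s sd; rewrite in_itv /= => /andP[as_ sb]; apply: H => //=.
by rewrite in_itv /= (le_trans a0 as_) (le_trans sb bL).
Qed.

Lemma plane_fun_within_continuous nu c a b : 0 <= a -> b <= L ->
  {within `[a, b], continuous (plane_fun gamma nu c)}.
Proof.
move=> a0 bL; have ck k := @coord_within_continuous a b k a0 bL.
have -> : plane_fun gamma nu c = fun t => gamma t ord0 i0 * nu ord0 i0 + gamma t ord0 i1 * nu ord0 i1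
   + gamma t ord0 i2 * nu ord0 i2 - c.
  by apply/funext => t; rewrite /plane_fun /dot big_ord3.
move=> t; apply: cvgB; last exact: cvg_cst.
by apply: cvgD; [apply: cvgD|]; apply: cvgM; try exact: cvg_cst; exact: ck.
Qed.

Lemma zero_between nu c u v : 0 <= u -> u < v -> v <= L ->
  plane_fun gamma nu c u * plane_fun gamma nu c v < 0 ->
  exists2 w, u < w < v & plane_fun gamma nu c w = 0.
Proof.
move=> u0 uv vL; set f := plane_fun gamma nu c => fuv.
have [w wuv fw] : exists2 w, w \in `[u, v] & f w = 0.
  apply: IVT; [exact: ltW|exact: plane_fun_within_continuous|].
  rewrite ge_min le_max; case: (ltgtP (f u) 0) fuv => [fu|fu|->]; last by rewrite mul0r ltxx.
    by rewrite nmulr_rlt0 // => fv; rewrite (ltW fv) orbT.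
  by rewrite pmulr_rlt0 // => fv; rewrite (ltW fv) orbT.
exists w => //; move: wuv; rewrite in_itv /= => /andP[uw wv].
rewrite !lt_neqAle uw wv !andbT; apply/andP; split; apply: contraTneq fuv => e.
  by rewrite e fw mul0r ltxx.
by rewrite -e fw mulr0 ltxx.
Qed.

(** The five sign changes give five zeros, and each counts at least once. The normal is nonzero
    because a constant function has no sign change. *)
Lemma no_six_alternations nu c s1 s2 s3 s4 s5 s6 (f := plane_fun gamma nu c) :
  0 <= s1 -> s1 < s2 < s3 -> s3 < s4 < s5 -> s5 < s6 < L ->
  f s1 * f s2 < 0 -> f s2 * f s3 < 0 -> f s3 * f s4 < 0 -> f s4 * f s5 < 0 -> f s5 * f s6 < 0 -> False.
Proof.
move=> s10 /andP[s12 s23] /andP[s34 s45] /andP[s56 s6L] h1 h2 h3 h4 h5.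
have nu0 : nu != 0.
  apply: contraTneq h1 => nu0; rewrite -leNgt /f /plane_fun nu0 /dot !big_ord3 !mxE.
  by rewrite !mulr0 !addr0 -expr2 sqr_ge0.
have p2 := ltW (le_lt_trans s10 s12); have p3 := ltW (le_lt_trans p2 s23).
have p4 := ltW (le_lt_trans p3 s34); have p5 := ltW (le_lt_trans p4 s45).
have q5 := ltW (lt_trans s56 s6L); have q4 := le_trans (ltW s45) q5.
have q3 := le_trans (ltW s34) q4; have q2 := le_trans (ltW s23) q3.
have [w1 /andP[a1 b1] f1] := zero_between s10 s12 q2 h1.
have [w2 /andP[a2 b2] f2] := zero_between p2 s23 q3 h2.
have [w3 /andP[a3 b3] f3] := zero_between p3 s34 q4 h3.
have [w4 /andP[a4 b4] f4] := zero_between p4 s45 q5 h4.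
have [w5 /andP[a5 b5] f5] := zero_between p5 s56 (ltW s6L) h5.
have w12 := lt_trans b1 a2; have w23 := lt_trans b2 a3; have w34 := lt_trans b3 a4.
have w45 := lt_trans b4 a5.
have w1p := le_lt_trans s10 a1; have w5L := lt_trans b5 s6L.
apply: (no_five_zeros gamma_planes nu0 (c := c) (s := [:: w1; w2; w3; w4; w5])) => //=.
- clear -w12 w23 w34 w45; rewrite !inE !negb_or !andbT.
  by do ![apply/andP; split]; rewrite lt_eqF //; lra.
- move=> t; rewrite !inE => H; suff [t0L ft] : (0 <= t < L) /\ f t = 0 by split => //=; rewrite in_itv.
  move: H => /orP[|/orP[|/orP[|/orP[|]]]] /eqP ->; split => //;
    clear -w12 w23 w34 w45 w1p w5L; by apply/andP; split; lra.
Qed.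

(** The cyclic pattern is cut open at the parameter 0. Alternation survives because six is even: the
    sign change between the sixth and the first vertex replaces the one lost at the cut. *)
Lemma polygon_alternation (n : nat) (T : nat -> R) : (0 < n)%N ->
  (forall i, (i < n)%N -> 0 <= T i < L) ->
  (forall i j, (i < j)%N -> (j < n)%N -> T i < T j) ->
  forall f : V -> R, affine_form f -> forall i1 i2 i3 i4 i5 i6 : nat,
  (i1 < i2 < i3)%N -> (i3 < i4 < i5)%N -> (i5 < i6 < i1 + n)%N ->
  let x i := gamma (T (i %% n)%N) in
  [/\ f (x i1) < 0, 0 < f (x i2) & f (x i3) < 0] ->
  ~ [/\ 0 < f (x i4), f (x i5) < 0 & 0 < f (x i6)].
Proof.
move=> n0 TL Tmono f [nu [c fE]] i1 i2 i3 i4 i5 i6 /andP[i12 i23] /andP[i34 i45] /andP[i56 i61] x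
  [f1 f2 f3] [f4 f5 f6].
have lin (j1 j2 j3 j4 j5 j6 : nat) : (j1 < j2)%N -> (j2 < j3)%N -> (j3 < j4)%N -> (j4 < j5)%N ->
    (j5 < j6)%N -> (j6 < n)%N ->
    f (gamma (T j1)) * f (gamma (T j2)) < 0 -> f (gamma (T j2)) * f (gamma (T j3)) < 0 ->
    f (gamma (T j3)) * f (gamma (T j4)) < 0 -> f (gamma (T j4)) * f (gamma (T j5)) < 0 ->
    f (gamma (T j5)) * f (gamma (T j6)) < 0 -> False.
  move=> h1 h2 h3 h4 h5 h6.
  have m5 := ltn_trans h5 h6; have m4 := ltn_trans h4 m5; have m3 := ltn_trans h3 m4.
  have m2 := ltn_trans h2 m3; have m1 := ltn_trans h1 m2.
  have [/andP[a1 _] /andP[_ b6]] := (TL _ m1, TL _ h6).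
  rewrite !fE; apply: no_six_alternations => //; apply/andP; split => //; exact: Tmono.
have mod_ i : (i < n)%N -> (i %% n = i)%N by exact: modn_small.
have modn_ i : (n <= i)%N -> (i < n + n)%N -> (i %% n = i - n)%N.
  by move=> ni i2n; rewrite -{1}(subnK ni) modnDr modn_small // ltn_subLR.
pose b := (i1 %/ n * n)%N.
have bi1 : (b <= i1)%N by exact: leq_trunc_div.
have i1b : (i1 - b < n)%N.
  by rewrite {1}(divn_eq i1 n) addnC addnK ltn_pmod.
have xb i : (b <= i)%N -> x i = gamma (T ((i - b) %% n)%N).
  by move=> bi; rewrite /x -{1}(subnK bi) /b addnC modnMDl.
(* With the first index below [n], the cases say how many of the indices have passed [n]; those are
   moved to the front. *)
have cyc (j1 j2 j3 j4 j5 j6 : nat) : (j1 < n)%N -> (j1 < j2)%N -> (j2 < j3)%N -> (j3 < j4)%N ->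
    (j4 < j5)%N -> (j5 < j6)%N -> (j6 < j1 + n)%N ->
    let F k := f (gamma (T (k %% n)%N)) in
    F j1 < 0 -> 0 < F j2 -> F j3 < 0 -> 0 < F j4 -> F j5 < 0 -> 0 < F j6 -> False.
  move=> h0 h1 h2 h3 h4 h5 h6 F F1 F2 F3 F4 F5 F6.
  have Flt k : (k < n)%N -> f (gamma (T k)) = F k by move=> kn; rewrite /F mod_.
  have Fge k : (n <= k)%N -> (k < n + n)%N -> f (gamma (T (k - n)%N)) = F k.
    by move=> k1 k2; rewrite /F modn_.
  have up6 : (j6 < n + n)%N by apply: leq_trans h6 _; rewrite leq_add2r ltnW.
  have up5 := ltn_trans h5 up6; have up4 := ltn_trans h4 up5; have up3 := ltn_trans h3 up4.
  have up2 := ltn_trans h2 up3.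
  have P12 : F j1 * F j2 < 0 by rewrite nmulr_rlt0.
  have P23 : F j2 * F j3 < 0 by rewrite pmulr_rlt0.
  have P34 : F j3 * F j4 < 0 by rewrite nmulr_rlt0.
  have P45 : F j4 * F j5 < 0 by rewrite pmulr_rlt0.
  have P56 : F j5 * F j6 < 0 by rewrite nmulr_rlt0.
  have P61 : F j6 * F j1 < 0 by rewrite pmulr_rlt0.
  clear F1 F2 F3 F4 F5 F6.
  have [k6|k6] := ltnP j6 n.
    have k5 := ltn_trans h5 k6; have k4 := ltn_trans h4 k5; have k3 := ltn_trans h3 k4.
    have k2 := ltn_trans h2 k3.
    by apply: (lin j1 j2 j3 j4 j5 j6) => //; rewrite !Flt.
  have [k5|k5] := ltnP j5 n.
    have k4 := ltn_trans h4 k5; have k3 := ltn_trans h3 k4; have k2 := ltn_trans h2 k3.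
    apply: (lin (j6 - n)%N j1 j2 j3 j4 j5) => //; rewrite ?Fge ?Flt //.
    by clear -h6 k6; lia.
  have [k4|k4] := ltnP j4 n.
    have k3 := ltn_trans h3 k4; have k2 := ltn_trans h2 k3.
    apply: (lin (j5 - n)%N (j6 - n)%N j1 j2 j3 j4) => //; rewrite ?Fge ?Flt //; clear -h5 h6 k5 k6; lia.
  have [k3|k3] := ltnP j3 n.
    have k2 := ltn_trans h2 k3.
    apply: (lin (j4 - n)%N (j5 - n)%N (j6 - n)%N j1 j2 j3) => //; rewrite ?Fge ?Flt //; clear -h4 h5 h6 k4 k5 k6; lia.
  have [k2|k2] := ltnP j2 n.
    apply: (lin (j3 - n)%N (j4 - n)%N (j5 - n)%N (j6 - n)%N j1 j2) => //; rewrite ?Fge ?Flt //; clear -h3 h4 h5 h6 k3 k4 k5 k6; lia.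
  apply: (lin (j2 - n)%N (j3 - n)%N (j4 - n)%N (j5 - n)%N (j6 - n)%N j1) => //; rewrite ?Fge ?Flt //; clear -h2 h3 h4 h5 h6 k2 k3 k4 k5 k6; lia.
have b2 : (b <= i2)%N by apply: leq_trans bi1 (ltnW i12).
have b3 := leq_trans b2 (ltnW i23); have b4 := leq_trans b3 (ltnW i34).
have b5 := leq_trans b4 (ltnW i45); have b6 := leq_trans b5 (ltnW i56).
rewrite xb // in f1; rewrite xb // in f2; rewrite xb // in f3.
rewrite xb // in f4; rewrite xb // in f5; rewrite xb // in f6.
apply: (cyc (i1 - b)%N (i2 - b)%N (i3 - b)%N (i4 - b)%N (i5 - b)%N (i6 - b)%N) => //;
  clear -bi1 i12 i23 i34 i45 i56 i61; lia.
Qed.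

End curve_alternation.

(** * Vertices in general position on the curve *)

Section generic_parameters.
Variables (R : realType) (L : R) (gamma : R -> 'rV[R]_3).
Local Notation V := 'rV[R]_3.
Hypothesis L_gt0 : 0 < L.
Hypothesis gamma_simple : simple_curve L gamma.
Hypothesis gamma_planes : forall (nu : V) (c : R), nu != 0 -> (plane_count L gamma nu c <= 4%:E)%E.

Definition cross (u v : V) : V :=
  row3 (u ord0 i1 * v ord0 i2 - u ord0 i2 * v ord0 i1)
       (u ord0 i2 * v ord0 i0 - u ord0 i0 * v ord0 i2)
       (u ord0 i0 * v ord0 i1 - u ord0 i1 * v ord0 i0).

(** The first formula vanishes when [u] lies on the third axis, hence the second case. *)
Definition orthogonal_to (u : V) : V :=
  if (u ord0 i0 != 0) || (u ord0 i1 != 0) then row3 (- u ord0 i1) (u ord0 i0) 0 else row3 1 0 0.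

Lemma orthogonal_to_neq0 u : orthogonal_to u != 0.
Proof.
rewrite /orthogonal_to; case: ifP => [|_].
  apply: contraTneq => e; rewrite negb_or !negbK; apply/andP; split; apply/eqP.
    by have := congr1 (fun w : V => w ord0 i1) e; rewrite !mxE.
  by have := congr1 (fun w : V => w ord0 i0) e; rewrite !mxE /= => /eqP; rewrite oppr_eq0 => /eqP.
apply/eqP => e; have := congr1 (fun w : V => w ord0 i0) e; rewrite !mxE /=.
by move/eqP; rewrite oner_eq0.
Qed.

(** A vector parallel to [u] is orthogonal to [orthogonal_to u]. So a new point stays off the line
    through two others as soon as it avoids one plane containing that line. *)
Lemma cross_neq0 u w : u != 0 -> dot w (orthogonal_to u) != 0 -> cross u w != 0.
Proof.
move=> u0; apply: contraNneq => e.
have e0 := congr1 (fun w : V => w ord0 i0) e; have e1 := congr1 (fun w : V => w ord0 i1) e.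
have e2 := congr1 (fun w : V => w ord0 i2) e; rewrite !mxE /= in e0 e1 e2.
rewrite /dot big_ord3 /orthogonal_to; case: ifP => [_|/norP[/negPn/eqP a0 /negPn/eqP b0]]; rewrite !mxE /=.
  by apply/eqP; lra.
rewrite a0 b0 in e0 e1; have c0 : u ord0 i2 != 0.
  by apply: contraNneq u0 => c0; apply/eqP/eq_rV3; rewrite !mxE.
have : u ord0 i2 * w ord0 i0 == 0 by apply/eqP; lra.
by rewrite mulf_eq0 (negbTE c0) /= => /eqP ->; apply/eqP; ring.
Qed.

Lemma det4_plane_fun a b c t :
  det4 a b c (gamma t) = plane_fun gamma (cross (b - a) (c - a)) (dot a (cross (b - a) (c - a))) t.
Proof. by rewrite /plane_fun /dot !big_ord3 /cross !mxE /= /det4 det3E !mxE; ring. Qed.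

Lemma infinite_interval (a b : R) : a < b -> infinite_set (`]a, b[%classic : set R).
Proof.
move=> ab /finite_set_countable /countable_lebesgue_measure0.
rewrite lebesgue_measure_itv /= lte_fin ab -EFinB => /eqP; rewrite eqe subr_eq0 => /eqP e.
by rewrite e ltxx in ab.
Qed.

(* Each new parameter has to avoid the finitely many planes through three earlier
   vertices, and each of them meets the curve finitely often. *)
Lemma generic_parameters (n : nat) : (0 < n)%N -> exists T : nat -> R,
  [/\ T 0%N = 0,
      forall i, (0 < i < n)%N -> i%:R * L / n%:R < T i < i.+1%:R * L / n%:R
    & forall i j k l, (i < j)%N -> (j < k)%N -> (k < l)%N -> (l < n)%N ->
        det4 (gamma (T i)) (gamma (T j)) (gamma (T k)) (gamma (T l)) != 0].
Proof.
move=> n0.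
have nR : 0 < n%:R :> R by rewrite ltr0n.
(* The induction also keeps triples non-collinear: the plane through three earlier vertices needs a
   nonzero normal before the bound on intersections applies to it. *)
suff H m : (0 < m)%N -> (m <= n)%N -> exists T : nat -> R,
  [/\ T 0%N = 0,
      forall i, (0 < i < m)%N -> i%:R * L / n%:R < T i < i.+1%:R * L / n%:R,
      forall i j k, (i < j)%N -> (j < k)%N -> (k < m)%N ->
        cross (gamma (T j) - gamma (T i)) (gamma (T k) - gamma (T i)) != 0
    & forall i j k l, (i < j)%N -> (j < k)%N -> (k < l)%N -> (l < m)%N ->
        det4 (gamma (T i)) (gamma (T j)) (gamma (T k)) (gamma (T l)) != 0].
  by have [T [T0 Ti _ Tg]] := H n n0 (leqnn n); exists T; split.
elim: m => // -[_ _ _|m IH _ mn].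
  by exists (fun=> 0); split => // *; lia.
have [T [T0 Ti Tc Tg]] := IH isT (ltnW mn).
pose x i := gamma (T i).
pose M := m.+1; rewrite -/M in IH mn Ti Tc Tg *.
have TL i : (i < M)%N -> 0 <= T i < M%:R * L / n%:R.
  move=> iM; have [->|i0] := eqVneq i 0%N.
    by rewrite T0 lexx /= divr_gt0 // mulr_gt0 // ltr0n.
  have /andP[h1 h2] : i%:R * L / n%:R < T i < i.+1%:R * L / n%:R by apply: Ti; rewrite lt0n i0.
  rewrite (le_trans _ (ltW h1)) /=; last by rewrite divr_ge0 ?mulr_ge0 ?ler0n // ltW.
  apply: lt_le_trans h2 _; rewrite ler_pM2r ?invr_gt0 // ler_pM2r // ler_nat //.
(* [B2] collects the curve parameters in a plane through two earlier vertices, [B3] those in the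
   plane through three. *)
pose B2 (t : nat * nat) := plane_params L gamma (orthogonal_to (x t.2 - x t.1))
   (dot (x t.1) (orthogonal_to (x t.2 - x t.1))).
pose n3 (t : nat * nat * nat) := cross (x t.1.2 - x t.1.1) (x t.2 - x t.1.1).
pose B3 (t : nat * nat * nat) := if n3 t != 0 then
  plane_params L gamma (n3 t) (dot (x t.1.1) (n3 t)) else set0.
pose B := (\bigcup_(t in `I_M `*` `I_M) B2 t) `|` (\bigcup_(t in `I_M `*` `I_M `*` `I_M) B3 t).
have finB : finite_set B.
  rewrite finite_setU; split; apply: bigcup_finite.
  - exact: finite_setX.
  - by move=> t _; apply: (finite_plane_params gamma_planes); exact: orthogonal_to_neq0.
  - by apply: finite_setX => //; exact: finite_setX.
  - by move=> t _; rewrite /B3; case: ifP => // n30; exact: (finite_plane_params gamma_planes).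
have itv : M%:R * L / n%:R < M.+1%:R * L / n%:R.
  by rewrite ltr_pM2r ?invr_gt0 // ltr_pM2r // ltr_nat.
have [s [sI sB]] := infinite_setN0 (infinite_setD (infinite_interval itv) finB).
rewrite /= in_itv /= in sI; have [s1 s2] := andP sI.
have sL : s < L.
  apply: lt_le_trans s2 _; rewrite ler_pdivrMr // [leRHS]mulrC ler_pM2r // ler_nat.
  exact: mn.
have s0 : 0 <= s by apply: le_trans (ltW s1); rewrite divr_ge0 ?mulr_ge0 ?ler0n // ltW.
pose T' i := if i == M then s else T i.
have TM : T' M = s by rewrite /T' eqxx.
have TE i : (i < M)%N -> T' i = T i by move=> iM; rewrite /T' ltn_eqF.
have sP : `[0, L[%classic s by rewrite /= in_itv /= s0.
exists T'; split.
- by rewrite TE.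
- move=> i /andP[i0]; rewrite ltnS leq_eqVlt => /predU1P[->|iM]; first by rewrite TM s1.
  by rewrite TE // Ti // i0.
- move=> i j k ij jk; rewrite ltnS leq_eqVlt => /predU1P[e|kM]; last first.
    by rewrite !TE ?Tc //; lia.
  have jM : (j < M)%N by rewrite -e.
  have iM := ltn_trans ij jM.
  rewrite e TM !TE //; apply: cross_neq0.
    rewrite subr_eq0; apply/eqP => /gamma_simple e'.
    have : T j = T i.
      apply: e'; rewrite in_itv /=.
        have /andP[-> h] := TL j jM; exact: lt_trans h (lt_trans s1 sL).
      have /andP[-> h] := TL i iM; exact: lt_trans h (lt_trans s1 sL).
    have /andP[h1 h2] : j%:R * L / n%:R < T j < j.+1%:R * L / n%:R by apply: Ti; lia.
    suff : T i < T j by move=> + e2; rewrite e2 ltxx.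
    apply: le_lt_trans h1; have [->|i0] := eqVneq i 0%N.
      by rewrite T0 divr_ge0 ?mulr_ge0 ?ler0n // ltW.
    have /andP[_ h3] : i%:R * L / n%:R < T i < i.+1%:R * L / n%:R by apply: Ti; lia.
    apply: le_trans (ltW h3) _; by rewrite ler_pM2r ?invr_gt0 // ler_pM2r // ler_nat.
  apply: contra_not_neq sB => e0; left; exists (i, j) => //; split => //=.
  rewrite /plane_fun -/(x i) -/(x j) -[RHS]e0 /dot !big_ord3 !mxE /x; ring.
- move=> i j k l ij jk kl; rewrite ltnS leq_eqVlt => /predU1P[e|lM]; last first.
    by rewrite !TE ?Tg //; lia.
  have kM : (k < M)%N by rewrite -e.
  have jM := ltn_trans jk kM; have iM := ltn_trans ij jM.
  rewrite e TM !TE // det4_plane_fun.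
  apply: contra_not_neq sB => e0; right; exists ((i, j), k) => //=.
  have c0 := Tc _ _ _ ij jk kM.
  by rewrite /B3 /n3 /= ifT //; split.
Qed.

End generic_parameters.

(** * Convex hulls and their approximation *)

Section hull_theory.
Variable R : realType.
Local Notation V := 'rV[R]_3.
Implicit Types (A B : set V) (s : seq (R * V)).

Definition weighted_points A s := forall q, q \in s -> 0 <= q.1 /\ A q.2.

Definition barycenter s : V := \sum_(q <- s) q.1 *: q.2.

Definition combinations A : set V :=
  [set p | exists s, [/\ weighted_points A s, \sum_(q <- s) q.1 = 1 & p = barycenter s]].

Definition segment_closed B := forall a b (r : R), 0 <= r <= 1 -> B a -> B b -> B (r *: a + (1 - r) *: b).

Lemma convex_set_segment B : @convex_set R V B <-> segment_closed B.
Proof.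
split=> [cB a b r /andP[r0 r1] Ba Bb|sB a b r].
  have := cB a b (Itv01 r0 r1); rewrite !inE => /(_ Ba Bb); exact.
rewrite !inE => Ba Bb; have := sB a b r%:num; apply => //.
by apply/andP; split.
Qed.

(** The first point is split off and the rest renormalised. If the rest has total weight zero, its
    coefficients all vanish and the first point alone remains. *)
Lemma segment_closed_barycenter B s : segment_closed B -> weighted_points B s ->
  \sum_(q <- s) q.1 = 1 -> B (barycenter s).
Proof.
move=> sB; have [n sn] := ubnP (size s); elim: n s sn => // n IH [|[r a] s] sn wp.
  by rewrite big_nil => /eqP; rewrite eq_sym oner_eq0.
rewrite /barycenter !big_cons /= => sum1.
have [r0 Ba] := wp (r, a) (mem_head _ _); rewrite /= in r0 Ba.
have wps : weighted_points B s by move=> q qs; apply: wp; rewrite inE qs orbT.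
have s0 : 0 <= \sum_(q <- s) q.1.
  by rewrite big_seq; apply: sumr_ge0 => q /wps[].
have [e|ne] := eqVneq (\sum_(q <- s) q.1) 0.
  have q0 : forall q, q \in s -> q.1 = 0.
    move=> q qs; apply/eqP; move: e => /eqP.
    by rewrite big_seq_cond psumr_eq0 => [/allP/(_ q qs)|i]; rewrite ?qs ?andbT // => /wps[].
  rewrite big_seq big1 ?addr0 => [|q /q0 ->]; last by rewrite scale0r.
  by rewrite e addr0 in sum1; rewrite sum1 scale1r.
set t := \sum_(q <- s) q.1 in s0 ne sum1.
pose s' := [seq (q.1 / t, q.2) | q <- s].
have rE : 1 - r = t by lra.
have -> : \sum_(q <- s) q.1 *: q.2 = (1 - r) *: barycenter s'.
  rewrite rE /barycenter big_map /= scaler_sumr; apply: eq_bigr => q _.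
  by rewrite scalerA mulrCA mulfV // mulr1.
apply: sB => //; first by rewrite r0; lra.
apply: IH; first by rewrite size_map.
  move=> q /mapP[q' /wps[q0 Bq] ->] /=; split => //; exact: divr_ge0.
by rewrite big_map /= -mulr_suml mulfV.
Qed.

Lemma combinations_segment_closed A : segment_closed (combinations A).
Proof.
move=> _ _ r /andP[r0 r1] [s [ws s1 ->]] [t [wt t1 ->]].
have r1' : 0 <= 1 - r by rewrite subr_ge0.
exists ([seq (r * q.1, q.2) | q <- s] ++ [seq ((1 - r) * q.1, q.2) | q <- t]); split.
- move=> q; rewrite mem_cat => /orP[] /mapP[q' qs ->] /=.
    by have [? ?] := ws _ qs; split => //; exact: mulr_ge0.
  by have [? ?] := wt _ qs; split => //; exact: mulr_ge0.
- by rewrite big_cat !big_map /= -!mulr_sumr s1 t1; ring.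
- rewrite /barycenter big_cat !big_map /= !scaler_sumr; congr (_ + _);
  by apply: eq_bigr => q _; rewrite scalerA.
Qed.

Lemma convex_hullE A : convex_hull A = combinations A.
Proof.
apply/seteqP; split.
  apply: smallest_sub; first exact/convex_set_segment/combinations_segment_closed.
  move=> a Aa; exists [:: (1, a)]; split.
  - by move=> q; rewrite inE => /eqP -> /=.
  - by rewrite big_seq1.
  - by rewrite /barycenter big_seq1 scale1r.
move=> _ [s [ws s1 ->]] B [/convex_set_segment cB AB].
by apply: segment_closed_barycenter => // q /ws[? /AB].
Qed.

(** The cone version is applied to the differences from one point [q0] of the combination; since it
    does not increase the total weight, the remainder [1 - \sum_i m i] can be given to [q0]. *)
Lemma caratheodory A p : combinations A p ->
  exists s, [/\ weighted_points A s, \sum_(q <- s) q.1 = 1, p = barycenter s & (size s <= 4)%N].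
Proof.
move=> [s [ws s1 pE]].
have [q0 q0s] : exists q0, q0 \in s.
  case: s s1 {ws pE} => [|q s]; last by exists q; exact: mem_head.
  by rewrite big_nil => /eqP; rewrite eq_sym oner_eq0.
pose z (i : 'I_(size s)) := (nth q0 s i).2; pose l (i : 'I_(size s)) := (nth q0 s i).1.
have zA i : 0 <= l i /\ A (z i) by apply: ws; exact: mem_nth.
have l1 : \sum_i l i = 1 by rewrite -s1 (big_nth q0) big_mkord.
have pz : p = \sum_i l i *: z i by rewrite pE /barycenter (big_nth q0) big_mkord.
have [m [m0 mE ml m3 _]] := caratheodory_cone (fun i => z i - q0.2) (fun i => (zA i).1).
exists ((1 - \sum_i m i, q0.2) :: [seq (m i, z i) | i <- enum (supp m)]).
have sumE (W : nmodType) (F : 'I_(size s) -> W) : (forall i, m i = 0 -> F i = 0) ->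
    \sum_(i <- enum (supp m)) F i = \sum_i F i.
  move=> F0; rewrite big_enum /= [RHS](bigID [in supp m]) /= [X in _ + X]big1 ?addr0 //.
  by move=> i; rewrite inE negbK => /eqP /F0.
split.
- move=> q; rewrite inE => /predU1P[->|/mapP[i _ ->]] /=.
    by split; [rewrite subr_ge0 (le_trans ml) // l1|have [] := ws _ q0s].
  by split; [exact: m0|have [] := zA i].
- by rewrite big_cons big_map /= sumE // subrK.
- rewrite /barycenter big_cons big_map /= sumE => [|i ->]; last by rewrite scale0r.
  have {}mE : \sum_i m i *: (z i - q0.2) = \sum_i l i *: (z i - q0.2) := mE.
  have dist (f : 'I_(size s) -> R) : \sum_i f i *: (z i - q0.2) = \sum_i f i *: z i - (\sum_i f i) *: q0.2.
    by rewrite scaler_suml -sumrB; apply: eq_bigr => i _; rewrite scalerBr.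
  rewrite !dist l1 scale1r -pz in mE.
  by rewrite scalerBl scale1r -addrA [X in _ + X]addrC mE addrCA subrr addr0.
- by rewrite /= size_map -cardE.
Qed.

(** A continuous image of [[0, 1] * A * B], so it preserves compactness. By Carathéodory, three
    nested joins of [A] exhaust its convex hull. *)
Definition join A B : set V :=
  (fun q : R * V * V => q.1.1 *: q.1.2 + (1 - q.1.1) *: q.2) @` ((`[0, 1] `*` A) `*` B).

Lemma compact_join A B : compact A -> compact B -> compact (join A B).
Proof.
move=> cA cB; apply: continuous_compact; last first.
  apply: compact_setX => //; apply: compact_setX => //; exact: segment_compact.
apply: continuous_subspaceT => -[[r a] b].
have c1 : (fun q : R * V * V => q.1.1) @ (r, a, b) --> r.
  by apply: (cvg_comp (fun q : R * V * V => q.1) fst); [exact: cvg_fst|exact: cvg_fst].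
have c2 : (fun q : R * V * V => q.1.2) @ (r, a, b) --> a.
  by apply: (cvg_comp (fun q : R * V * V => q.1) snd); [exact: cvg_fst|exact: cvg_snd].
have c3 : (fun q : R * V * V => q.2) @ (r, a, b) --> b by exact: cvg_snd.
apply: cvgD; first exact: cvgZ.
by apply: cvgZ => //; apply: cvgB => //; exact: cvg_cst.
Qed.

Lemma combinations_join A a0 : A a0 -> combinations A = join A (join A (join A A)).
Proof.
move=> Aa0.
have AC : A `<=` combinations A.
  move=> a Aa; exists [:: (1, a)]; split; [|by rewrite big_seq1|by rewrite /barycenter big_seq1 scale1r].
  by move=> q; rewrite inE => /eqP -> /=.
have JC B : B `<=` combinations A -> join A B `<=` combinations A.
  move=> BC _ [[[r a] b] [[/= r01 Aa] Bb] <-] /=.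
  apply: combinations_segment_closed; [by rewrite in_itv in r01|exact: AC|exact: BC].
apply/seteqP; split; last by exact: JC (JC _ (JC _ AC)).
have sJ B a : B a -> join A B a.
  by move=> Ba; exists (0, a0, a) => /=; [split => //; split => //=; rewrite in_itv /= lexx ler01|rewrite scale0r add0r subr0 scale1r].
(* Splits off the first point. The element [b] is a dummy endpoint for the case that the remaining
   points have total weight zero. *)
have step B s : (forall t, (size t < size s)%N -> weighted_points A t -> \sum_(q <- t) q.1 = 1 -> B (barycenter t)) ->
    (exists b, B b) -> weighted_points A s -> \sum_(q <- s) q.1 = 1 -> join A B (barycenter s).
  case: s => [|[r a] s] HB [b Bb] wp; first by rewrite big_nil => /eqP; rewrite eq_sym oner_eq0.
  rewrite /barycenter !big_cons /= => sum1.
  have [r0 Aa] := wp (r, a) (mem_head _ _); rewrite /= in r0 Aa.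
  have wps : weighted_points A s by move=> q qs; apply: wp; rewrite inE qs orbT.
  have s0 : 0 <= \sum_(q <- s) q.1 by rewrite big_seq; apply: sumr_ge0 => q /wps[].
  have [e|ne] := eqVneq (\sum_(q <- s) q.1) 0.
    have q0 : forall q, q \in s -> q.1 = 0.
      move=> q qs; apply/eqP; move: e => /eqP.
      by rewrite big_seq_cond psumr_eq0 => [/allP/(_ q qs)|i]; rewrite ?qs ?andbT // => /wps[].
    rewrite e addr0 in sum1.
    exists (1, a, b) => /=; first by split => //; split => //=; rewrite in_itv /= lexx ler01.
    by rewrite subrr scale0r sum1 big_seq big1 // => q /q0 ->; rewrite scale0r.
  set t := \sum_(q <- s) q.1 in s0 ne sum1.
  pose s' := [seq (q.1 / t, q.2) | q <- s].
  have rE : 1 - r = t by lra.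
  exists (r, a, barycenter s') => /=; last first.
    congr (_ + _); rewrite rE /barycenter big_map /= scaler_sumr; apply: eq_bigr => q _.
    by rewrite scalerA mulrCA mulfV // mulr1.
  split; first by split => //=; rewrite in_itv /= r0; lra.
  apply: HB; first by rewrite size_map.
    move=> q /mapP[q' /wps[q0 Bq] ->] /=; split => //; exact: divr_ge0.
  by rewrite big_map /= -mulr_suml mulfV.
have J1 s : (size s <= 1)%N -> weighted_points A s -> \sum_(q <- s) q.1 = 1 -> A (barycenter s).
  case: s => [|[r a] [|//]] _ wp; first by rewrite big_nil => /eqP; rewrite eq_sym oner_eq0.
  by rewrite /barycenter !big_seq1 /= => ->; rewrite scale1r; have [] := wp (r, a) (mem_head _ _).
move=> p /caratheodory[s [ws s1 -> s4]].
have A0 : exists b, A b by exists a0.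
have [b1 Jb1] : exists b, join A A b by exists a0; exact: sJ Aa0.
have [b2 Jb2] : exists b, join A (join A A) b by exists b1; exact: sJ Jb1.
apply: (step) => //; last by exists b2.
move=> t lt wt t1; have t3 : (size t <= 3)%N by rewrite -ltnS (leq_trans lt).
apply: (step) => //; last by exists b1.
move=> u lu wu u1; have u2 : (size u <= 2)%N by rewrite -ltnS (leq_trans lu).
apply: (step) => // w lw ww w1; apply: J1 => //; by rewrite -ltnS (leq_trans lw).
Qed.

Lemma compact_combinations A : compact A -> compact (combinations A).
Proof.
move=> cA; have [[a Aa]|A0] := pselect (exists a, A a).
  rewrite (combinations_join Aa).
  exact: compact_join cA (compact_join cA (compact_join cA cA)).
rewrite (_ : combinations A = set0); first exact: compact0.
apply/seteqP; split => // p [[|q s] [wp s1 _]].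
  by move: s1; rewrite big_nil => /eqP; rewrite eq_sym oner_eq0.
by apply: A0; exists q.2; have [] := wp q (mem_head _ _).
Qed.

End hull_theory.

(** * Homothetic copies inside approximating hulls *)

Section hull_approximation.
Variable R : realType.
Local Notation V := 'rV[R]_3.

Lemma cvg_det3 (T : Type) (F : set_system T) (FF : Filter F) (f g h : T -> V) (a b c : V) :
  f @ F --> a -> g @ F --> b -> h @ F --> c ->
  (fun t => det3 (f t) (g t) (h t)) @ F --> det3 a b c.
Proof.
move=> fa gb hc.
have co (k : T -> V) (l : V) i : k @ F --> l -> (fun t => k t ord0 i) @ F --> l ord0 i.
  by move=> kl; apply: (cvg_comp k (fun M : V => M ord0 i) kl); exact: coord_continuous.
rewrite det3E (_ : (fun t => _) = fun t =>
  f t ord0 i0 * (g t ord0 i1 * h t ord0 i2 - h t ord0 i1 * g t ord0 i2)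
  - g t ord0 i0 * (f t ord0 i1 * h t ord0 i2 - h t ord0 i1 * f t ord0 i2)
  + h t ord0 i0 * (f t ord0 i1 * g t ord0 i2 - g t ord0 i1 * f t ord0 i2)); last first.
  by apply/funext => t; rewrite det3E.
have cf i := co _ _ i fa; have cg i := co _ _ i gb; have ch i := co _ _ i hc.
apply: cvgD; [apply: cvgB|]; (apply: cvgM; [by []|apply: cvgB; by apply: cvgM]).
Qed.

(** At the centroid all four barycentric coordinates equal 1/4, and strict positivity survives a
    small displacement of all five points. *)
Lemma centroid_stability (v0 v1 v2 v3 : V) (o := 4^-1 *: (v0 + v1 + v2 + v3)) :
  det4 v0 v1 v2 v3 != 0 ->
  exists2 e, 0 < e & forall w0 w1 w2 w3 u : V,
    `|w0 - v0| < e -> `|w1 - v1| < e -> `|w2 - v2| < e -> `|w3 - v3| < e -> `|u - o| < e ->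
    cone w0 (w1 - w0) (w2 - w0) (w3 - w0) u.
Proof.
move=> D0.
pose T := (V * V * V * V * V)%type.
pose D (t : T) := det3 (t.1.1.1.2 - t.1.1.1.1) (t.1.1.2 - t.1.1.1.1) (t.1.2 - t.1.1.1.1).
pose N1 (t : T) := det3 (t.2 - t.1.1.1.1) (t.1.1.2 - t.1.1.1.1) (t.1.2 - t.1.1.1.1).
pose N2 (t : T) := det3 (t.1.1.1.2 - t.1.1.1.1) (t.2 - t.1.1.1.1) (t.1.2 - t.1.1.1.1).
pose N3 (t : T) := det3 (t.1.1.1.2 - t.1.1.1.1) (t.1.1.2 - t.1.1.1.1) (t.2 - t.1.1.1.1).
pose t0 : T := (v0, v1, v2, v3, o).
have FF : Filter (nbhs t0) := nbhs_filter t0.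
have c5 : (fun t : T => t.2) @ t0 --> o by exact: cvg_snd.
have f1 : (fun t : T => t.1) @ t0 --> t0.1 by exact: cvg_fst.
have f2 : (fun t : T => t.1.1) @ t0 --> t0.1.1 by apply: (cvg_comp _ fst f1); exact: cvg_fst.
have f3 : (fun t : T => t.1.1.1) @ t0 --> t0.1.1.1 by apply: (cvg_comp _ fst f2); exact: cvg_fst.
have c4 : (fun t : T => t.1.2) @ t0 --> v3 by apply: (cvg_comp _ snd f1); exact: cvg_snd.
have c3 : (fun t : T => t.1.1.2) @ t0 --> v2 by apply: (cvg_comp _ snd f2); exact: cvg_snd.
have c2 : (fun t : T => t.1.1.1.2) @ t0 --> v1 by apply: (cvg_comp _ snd f3); exact: cvg_snd.
have c1 : (fun t : T => t.1.1.1.1) @ t0 --> v0 by apply: (cvg_comp _ fst f3); exact: cvg_fst.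
have cD : D @ t0 --> D t0 by exact: (cvg_det3 FF (cvgB c2 c1) (cvgB c3 c1) (cvgB c4 c1)).
have cN1 : N1 @ t0 --> N1 t0 by exact: (cvg_det3 FF (cvgB c5 c1) (cvgB c3 c1) (cvgB c4 c1)).
have cN2 : N2 @ t0 --> N2 t0 by exact: (cvg_det3 FF (cvgB c2 c1) (cvgB c5 c1) (cvgB c4 c1)).
have cN3 : N3 @ t0 --> N3 t0 by exact: (cvg_det3 FF (cvgB c2 c1) (cvgB c3 c1) (cvgB c5 c1)).
have Dt0 : D t0 = det4 v0 v1 v2 v3 by [].
have Dn : D t0 != 0 by rewrite Dt0.
have E1 : N1 t0 = 4^-1 * D t0 by rewrite /N1 /D /t0 /= /o !det3E !mxE; field.
have E2 : N2 t0 = 4^-1 * D t0 by rewrite /N2 /D /t0 /= /o !det3E !mxE; field.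
have E3 : N3 t0 = 4^-1 * D t0 by rewrite /N3 /D /t0 /= /o !det3E !mxE; field.
have D2 : 0 < D t0 * D t0 by rewrite -expr2 exprn_even_gt0.
have pos (g : T -> R) (l : R) : g @ t0 --> l -> 0 < l -> \forall t \near t0, 0 < g t.
  move=> cg g0; apply: (cg [set x | 0 < x]); apply: open_nbhs_nbhs; split; [exact: open_gt|exact: g0].
(* Multiplication by [D t] makes the four sign conditions polynomial and independent of the
   orientation. *)
have P1 : \forall t \near t0, 0 < D t * N1 t.
  have C : (fun t => D t * N1 t) @ t0 --> D t0 * N1 t0 by exact: cvgM cD cN1.
  by apply: (pos _ _ C); rewrite E1 mulrCA mulr_gt0.
have P2 : \forall t \near t0, 0 < D t * N2 t.
  have C : (fun t => D t * N2 t) @ t0 --> D t0 * N2 t0 by exact: cvgM cD cN2.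
  by apply: (pos _ _ C); rewrite E2 mulrCA mulr_gt0.
have P3 : \forall t \near t0, 0 < D t * N3 t.
  have C : (fun t => D t * N3 t) @ t0 --> D t0 * N3 t0 by exact: cvgM cD cN3.
  by apply: (pos _ _ C); rewrite E3 mulrCA mulr_gt0.
have P4 : \forall t \near t0, 0 < D t * (D t - N1 t - N2 t - N3 t).
  have C : (fun t => D t * (D t - N1 t - N2 t - N3 t)) @ t0 -->
      D t0 * (D t0 - N1 t0 - N2 t0 - N3 t0) by exact: cvgM cD (cvgB (cvgB (cvgB cD cN1) cN2) cN3).
  apply: (pos _ _ C).
  rewrite E1 E2 E3 (_ : _ - _ = 4^-1 * D t0); last by field.
  by rewrite mulrCA mulr_gt0.
have : \forall t \near t0, [/\ 0 < D t * N1 t, 0 < D t * N2 t, 0 < D t * N3 t &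
    0 < D t * (D t - N1 t - N2 t - N3 t)].
  by near=> t; split; near: t.
move=> /nbhs_ballP[e /= e0 H]; exists e => // w0 w1 w2 w3 u h0 h1 h2 h3 hu.
have /H[] : ball t0 e ((w0, w1, w2, w3, u) : T).
  have b (a w : V) : `|w - a| < e -> ball a e w by rewrite -ball_normE /= distrC.
  split; last exact: b; split; last exact: b; split; last exact: b.
  by split; exact: b.
set t : T := (w0, w1, w2, w3, u) => p1 p2 p3 p4.
have Dt : D t != 0 by apply: contraTneq p1 => ->; rewrite mul0r ltxx.
have dv x : 0 < D t * x -> 0 <= x / D t.
  move=> px; have -> : x / D t = D t * x / (D t * D t) by field.
  by rewrite divr_ge0 // ?(ltW px) // -expr2 sqr_ge0.
exists (N1 t / D t), (N2 t / D t), (N3 t / D t); split; try exact: dv.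
  have := dv _ p4; rewrite !mulrBl divff // => ?; lra.
have := det3_cramer (u - w0) Dt; rewrite -/(N1 t) -/(N2 t) -/(N3 t) -/(D t) => E.
have uE : u = w0 + (u - w0) by rewrite addrCA subrr addr0.
by rewrite {1}uE {1}E !addrA.
Unshelve. all: by end_near. Qed.

Lemma cone_segment_closed (P : set V) w0 w1 w2 w3 u : segment_closed P ->
  P w0 -> P w1 -> P w2 -> P w3 -> cone w0 (w1 - w0) (w2 - w0) (w3 - w0) u -> P u.
Proof.
move=> sP p0 p1 p2 p3 [a [b [c [a0 b0 c0 abc ->]]]].
have -> : w0 + a *: (w1 - w0) + b *: (w2 - w0) + c *: (w3 - w0) =
  barycenter [:: (1 - a - b - c, w0); (a, w1); (b, w2); (c, w3)].
  rewrite /barycenter !big_cons big_nil /=; apply: eq_rV3; rewrite !mxE; ring.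
apply: segment_closed_barycenter => //.
  move=> q; rewrite !inE => /orP[|/orP[|/orP[|]]] /eqP -> /=; split => //; lra.
by rewrite !big_cons big_nil /=; ring.
Qed.

(* A neighbourhood of o stays inside P, and it absorbs the error made when x is
   replaced by a nearby point of P. *)
Lemma contraction_in_approximation (A : set V) v0 v1 v2 v3 (o := 4^-1 *: (v0 + v1 + v2 + v3)) (d : R) :
  A v0 -> A v1 -> A v2 -> A v3 -> det4 v0 v1 v2 v3 != 0 -> 0 < d -> d < 1 ->
  exists2 e, 0 < e & forall P : set V, segment_closed P ->
    (forall a, A a -> exists2 w, P w & `|w - a| < e) ->
    forall x, combinations A x -> P (o + (1 - d) *: (x - o)).
Proof.
move=> A0 A1 A2 A3 D0 d0 d1; have [e e0 H] := centroid_stability D0; rewrite -/o in H; clearbody o.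
have r0 : 0 <= (1 - d) / d by rewrite divr_ge0 ?ltW // subr_gt0.
have r1 : 0 < 1 + (1 - d) / d by rewrite ltr_pwDl.
(* Small enough to move the four vertices by less than [e], and still so after magnification by
   [(1 - d) / d]. *)
exists (e / (1 + (1 - d) / d)); first exact: divr_gt0.
move=> P sP net x [s [ws s1 xE]].
have eS : e / (1 + (1 - d) / d) <= e.
  by rewrite ler_pdivrMr // mulrDr mulr1 lerDl mulr_ge0 // ltW.
have near1 a : A a -> exists2 w, P w & `|w - a| < e.
  by move=> /net[w Pw wa]; exists w => //; exact: lt_le_trans wa eS.
have [w0 P0 h0] := near1 _ A0; have [w1 P1 h1] := near1 _ A1.
have [w2 P2 h2] := near1 _ A2; have [w3 P3 h3] := near1 _ A3.
have /choice[f fP] : forall a, exists w, A a -> P w /\ `|w - a| < e / (1 + (1 - d) / d).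
  move=> a; have [Aa|nA] := pselect (A a); last by exists 0.
  by have [w Pw wa] := net a Aa; exists w.
pose x' := barycenter [seq (q.1, f q.2) | q <- s].
have Px' : P x'.
  apply: segment_closed_barycenter => //; last by rewrite big_map.
  by move=> q /mapP[q' /ws[q0 Aq] ->] /=; split => //; have [] := fP _ Aq.
have xx' : `|x - x'| <= e / (1 + (1 - d) / d).
  rewrite xE /x' /barycenter big_map /= -sumrB.
  apply: le_trans (ler_norm_sum _ _ _) _.
  set C := e / _ in fP *.
  rewrite -[leRHS]mul1r -{1}s1 mulr_suml big_seq [leRHS]big_seq; apply: ler_sum => q qs.
  have [q0 Aq] := ws q qs; have [_ fq] := fP _ Aq.
  rewrite -scalerBr normrZ (ger0_norm q0); apply: ler_wpM2l => //.
  by rewrite distrC (ltW fq).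
(* [u] is chosen so that [d *: u + (1 - d) *: x'] is the contracted point
   [o + (1 - d) *: (x - o)]. *)
pose u := o + ((1 - d) / d) *: (x - x').
have Pu : P u.
  apply: (cone_segment_closed sP P0 P1 P2 P3); apply: H => //.
  rewrite /u addrC addKr normrZ ger0_norm //.
  apply: le_lt_trans (ler_wpM2l r0 xx') _.
  by rewrite mulrCA -[ltRHS]mulr1 ltr_pM2l // ltr_pdivrMr // mul1r ltrDr.
have := sP u x' d; rewrite (ltW d0) (ltW d1) => /(_ isT Pu Px').
have dE : d * ((1 - d) / d) = 1 - d by field; rewrite gt_eqF.
have uE : d *: u = d *: o + (1 - d) *: (x - x') by rewrite /u [LHS]scalerDr scalerA dE.
congr P; rewrite uE.
by apply: eq_rV3; rewrite !mxE; ring.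
Qed.

Lemma finite_hull_segment_closed (n : nat) (z : 'I_n -> V) : segment_closed (finite_hull z).
Proof.
move=> _ _ r /andP[r0 r1] [l [l0 l1 ->]] [m [m0 m1 ->]].
have r1' : 0 <= 1 - r by rewrite subr_ge0.
exists (fun i => r * l i + (1 - r) * m i); split.
- by move=> i; rewrite addr_ge0 // mulr_ge0.
- by rewrite big_split /= -!mulr_sumr l1 m1; ring.
- rewrite !scaler_sumr -big_split /=; apply: eq_bigr => i _.
  by apply: eq_rV3; rewrite !mxE; ring.
Qed.

Lemma finite_hull_sub (n : nat) (z : 'I_n -> V) (A : set V) : (forall i, A (z i)) ->
  finite_hull z `<=` combinations A.
Proof.
move=> zA p [l [l0 l1 ->]]; exists [seq (l i, z i) | i <- index_enum 'I_n]; split.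
- by move=> q /mapP[i _ ->] /=; split; [exact: l0|exact: zA].
- by rewrite big_map.
- by rewrite /barycenter big_map.
Qed.

Lemma vol_le (A B : set V) : vmeasurable A -> vmeasurable B -> A `<=` B -> (vol A <= vol B)%E.
Proof.
move=> mA mB AB; apply: (@le_measure _ _ _ (lam3 R)); rewrite ?inE //.
by move=> p; exact: AB.
Qed.

(** [K] is a countable intersection of homothetic enlargements of the sets [P]: a point of all of
    them is a limit of points of [K], which is closed. The sequence [1 / (m + 2)] stays below 1. *)
Lemma vmeasurable_limit (K : set V) (o : V) : closed K ->
  (forall d, 0 < d -> d < 1 -> exists P, [/\ vmeasurable P, P `<=` K &
     forall x, K x -> P (o + (1 - d) *: (x - o))]) -> vmeasurable K.
Proof.
move=> cK H; pose d (m : nat) : R := m.+2%:R^-1.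
have d0 m : 0 < d m by rewrite invr_gt0 ltr0n.
have d1 m : d m < 1 by rewrite invf_lt1 ?ltr0n // ltr1n.
have /choice[P PP] : forall m, exists P, [/\ vmeasurable P, P `<=` K &
     forall x, K x -> P (o + (1 - d m) *: (x - o))] by move=> m; exact: H.
have KE : K = \bigcap_m [set p | P m (o + (1 - d m) *: (p - o))].
  apply/seteqP; split=> [x Kx m _|x Px]; first by have [_ _] := PP m; apply.
  have : (fun m => o + (1 - d m) *: (x - o)) @ \oo --> x.
    rewrite [X in _ --> X](_ : x = o + (1 - 0) *: (x - o)); last by rewrite subr0 scale1r addrCA subrr addr0.
    apply: cvgD; first exact: cvg_cst.
    apply: cvgZ; last exact: cvg_cst.
    apply: cvgB; first exact: cvg_cst.
    have := @cvg_harmonic R; rewrite -cvg_shiftS; exact.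
  apply: (closed_cvg _ cK); apply: nearW => m.
  have [_ PK _] := PP m; exact/PK/Px.
rewrite KE /vmeasurable preimage_bigcap; apply: bigcapT_measurable => m.
have [mP _ _] := PP m.
have r0 : 0 < (1 - d m)^-1 by rewrite invr_gt0 subr_gt0.
by have [] := vol_homothety o r0 mP; rewrite invrK.
Qed.

End hull_approximation.

(** * Riemann sums *)

Section grid_integrals.
Variables (R : realType) (L : R) (n : nat) (T : nat -> R).
Local Notation mu := (@lebesgue_measure R).
Hypothesis T0 : T 0%N = 0.
Hypothesis Tn : T n = L.
Hypothesis T_mono : forall i, (i < n)%N -> T i < T i.+1.

Let h i := T i.+1 - T i.

Lemma grid_ge0 i : (i <= n)%N -> 0 <= T i.
Proof.
elim: i => [|i IH] lt; first by rewrite T0.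
by apply: le_trans (IH (ltnW lt)) (ltW (T_mono lt)).
Qed.

Lemma grid_in i : (i <= n)%N -> 0 <= T i <= L.
Proof.
move=> lei; rewrite grid_ge0 //= -Tn.
have : forall m, (i + m <= n)%N -> T i <= T (i + m)%N.
  elim=> [|m IH] le; first by rewrite addn0.
  by rewrite addnS in le *; apply: le_trans (IH (ltnW le)) (ltW (T_mono le)).
by move=> /(_ (n - i)%N); rewrite subnKC // => ->.
Qed.

Lemma integral_grid (f : R -> \bar R) : measurable_fun setT f -> (forall t, (0 <= f t)%E) ->
  (\int[mu]_(t in `[0%R, L]) f t = \sum_(0 <= i < n) \int[mu]_(t in `]T i, T i.+1]) f t)%E.
Proof.
move=> mf f0.
rewrite -(integral_itv_obnd_cbnd (r := 0) (b := BRight L)); last exact: measurable_funTS.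
rewrite -Tn; have key m : (m <= n)%N ->
    (\int[mu]_(t in `]0%R, T m]) f t = \sum_(0 <= i < m) \int[mu]_(t in `]T i, T i.+1]) f t)%E; last exact: key.
elim: m => [_|m IH mn].
  by rewrite big_geq // T0 set_itv_ge ?integral_set0 // -leNgt bnd_simp.
rewrite big_nat_recr //= -(IH (ltnW mn)) -ge0_integral_setU //=.
- congr (integral _ _ _); apply/seteqP; split=> t /=; rewrite !in_itv /=.
    by move=> /andP[t0 tm]; have [le|gt] := leP t (T m); [left|right]; rewrite ?t0 ?le ?gt ?tm.
  case => /andP[a b].
    by rewrite a (le_trans b) // ltW // T_mono.
  by rewrite b andbT; apply: le_lt_trans a; exact: grid_ge0 (ltnW mn).
- exact: measurable_funTS.
- apply/disj_setPS => t /= []; rewrite !in_itv /= => /andP[_ a] /andP[b _].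
  by have := le_lt_trans a b; rewrite ltxx.
Qed.

Lemma integral_cell_cst i (c : R) : (i < n)%N ->
  (\int[mu]_(t in `]T i, T i.+1]) c%:E = (c * h i)%:E)%E.
Proof.
move=> lt; have -> : (\int[mu]_(t in `]T i, T i.+1]) c%:E = c%:E * mu `]T i, T i.+1])%E.
  exact: integral_cst.
by rewrite lebesgue_measure_itv /= lte_fin T_mono // -EFinB -EFinM.
Qed.

Lemma integral_cell_le (f : R -> \bar R) i (c : R) : (i < n)%N -> measurable_fun setT f ->
  (forall t, (0 <= f t)%E) -> (forall t, T i < t <= T i.+1 -> (f t <= c%:E)%E) ->
  (\int[mu]_(t in `]T i, T i.+1]) f t <= (c * h i)%:E)%E.
Proof.
move=> lt mf f0 fc.
apply: (@le_trans _ _ (\int[mu]_(t in `]T i, T i.+1]) c%:E)%E).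
  by apply: ge0_le_integral => //; exact: measurable_funTS.
by rewrite integral_cell_cst.
Qed.

Lemma integral_cell_ge (f : R -> \bar R) i (c : R) : (i < n)%N -> measurable_fun setT f ->
  0 <= c -> (forall t, T i < t <= T i.+1 -> (c%:E <= f t)%E) ->
  ((c * h i)%:E <= \int[mu]_(t in `]T i, T i.+1]) f t)%E.
Proof.
move=> lt mf c0 fc.
apply: (@le_trans _ _ (\int[mu]_(t in `]T i, T i.+1]) c%:E)%E).
  by rewrite integral_cell_cst.
by apply: ge0_le_integral => //; exact: measurable_funTS.
Qed.

Definition double_integral (F : R * R -> R) : \bar R :=
  (\int[mu]_(s in `[0%R, L]) \int[mu]_(t in `[0%R, L]) (F (s, t))%:E)%E.

Lemma measurable_inner (F : R * R -> R) :
  measurable_fun [set: measurableTypeR R * measurableTypeR R] F -> (forall p, 0 <= F p) ->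
  measurable_fun [set: measurableTypeR R] (fun s => \int[mu]_(t in `[0%R, L]) (F (s, t))%:E)%E.
Proof.
move=> mF F0.
pose G (p : measurableTypeR R * measurableTypeR R) := ((F p)%:E * (\1_(`[0, L]%classic : set (measurableTypeR R)) p.2)%:E)%E.
have mI : measurable_fun [set: measurableTypeR R * measurableTypeR R]
    (fun p => (\1_(`[0, L]%classic : set (measurableTypeR R)) p.2 : R)).
  have mB : measurable (snd @^-1` (`[0, L]%classic : set (measurableTypeR R)) : set (measurableTypeR R * measurableTypeR R)).
    exact: (measurable_preimage (@measurable_snd _ _ (measurableTypeR R) (measurableTypeR R)) (measurable_itv _)).
  exact: (measurable_indic mB).
have mG : measurable_fun setT G.
  by apply: emeasurable_funM; apply/measurable_EFinP.
have G0 p : (0 <= G p)%E by rewrite mule_ge0 // lee_fin.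
have := @measurable_fun_fubini_tonelli_F _ _ (measurableTypeR R) (measurableTypeR R) R (@lebesgue_measure R) G mG G0.
congr measurable_fun; apply/funext => s; rewrite /fubini_F [RHS]integral_mkcond.
apply: eq_integral => t _; rewrite /G patchE /= indicE.
by case: ifPn => _; rewrite ?mule1 ?mule0.
Qed.

Variable F : R * R -> R.
Hypothesis mF : measurable_fun [set: measurableTypeR R * measurableTypeR R] F.
Hypothesis F0 : forall p, 0 <= F p.

Let mFs s : measurable_fun [set: measurableTypeR R] (fun t => (F (s, t))%:E).
Proof.
apply/measurable_EFinP; apply: (measurableT_comp mF).
by apply/measurable_fun_pair => //; exact: measurable_cst.
Qed.

Let Fs0 s t : (0 <= (F (s, t))%:E)%E.
Proof. by rewrite lee_fin. Qed.

Let in_cell i j s t := (T i < s <= T i.+1) && (T j < t <= T j.+1).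

Lemma double_integral_le (c : nat -> nat -> R) :
  (forall i j s t, (i < n)%N -> (j < n)%N -> in_cell i j s t -> F (s, t) <= c i j) ->
  (double_integral F <= (\sum_(0 <= i < n) \sum_(0 <= j < n) c i j * (h i * h j))%:E)%E.
Proof.
move=> Fc; rewrite /double_integral integral_grid; last 2 first.
- exact: measurable_inner.
- by move=> s; apply: integral_ge0 => t _; rewrite lee_fin.
rewrite -sumEFin; rewrite !big_nat; apply: lee_sum => i /= iN.
rewrite (_ : \sum_(0 <= j < n) _ = (\sum_(0 <= j < n) c i j * h j) * h i); last first.
  by rewrite mulr_suml; apply: eq_bigr => j _; ring.
apply: integral_cell_le => //.
- exact: measurable_inner.
- by move=> s; apply: integral_ge0 => t _; rewrite lee_fin.
move=> s si; rewrite (integral_grid (mFs s) (Fs0 s)).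
rewrite -sumEFin !big_nat; apply: lee_sum => j /= jN.
apply: (integral_cell_le _ (mFs s) (Fs0 s)) => // t tj; rewrite lee_fin; apply: Fc => //; by rewrite /in_cell si tj.
Qed.

Lemma double_integral_ge (c : nat -> nat -> R) : (forall i j, 0 <= c i j) ->
  (forall i j s t, (i < n)%N -> (j < n)%N -> in_cell i j s t -> c i j <= F (s, t)) ->
  ((\sum_(0 <= i < n) \sum_(0 <= j < n) c i j * (h i * h j))%:E <= double_integral F)%E.
Proof.
move=> c0 Fc; rewrite /double_integral integral_grid; last 2 first.
- exact: measurable_inner.
- by move=> s; apply: integral_ge0 => t _; rewrite lee_fin.
rewrite -sumEFin; rewrite !big_nat; apply: lee_sum => i /= iN.
rewrite (_ : \sum_(0 <= j < n) _ = (\sum_(0 <= j < n) c i j * h j) * h i); last first.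
  by rewrite mulr_suml; apply: eq_bigr => j _; ring.
apply: integral_cell_ge => //.
- exact: measurable_inner.
- rewrite big_nat; apply: sumr_ge0 => j jN; rewrite mulr_ge0 // subr_ge0 ltW // T_mono //.
move=> s si; rewrite (integral_grid (mFs s) (Fs0 s)).
rewrite -sumEFin !big_nat; apply: lee_sum => j /= jN.
apply: (integral_cell_ge _ (mFs s)) => // t tj; rewrite lee_fin; apply: Fc => //; by rewrite /in_cell si tj.
Qed.

End grid_integrals.

Lemma double_integralD (R : realType) (L e : R) (F : R * R -> R) : 0 < L -> 0 <= e ->
  measurable_fun [set: measurableTypeR R * measurableTypeR R] F -> (forall p, 0 <= F p) ->
  (double_integral L (fun p => F p + e)%R = double_integral L F + (e * L ^+ 2)%:E)%E.
Proof.
move=> L0 e0 mF F0; rewrite /double_integral.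
have muL : lebesgue_measure (`[0, L]%classic : set R) = L%:E.
  by rewrite lebesgue_measure_itv /= lte_fin L0 sube0.
have cstL (c : R) : (\int[@lebesgue_measure R]_(t in `[0%R, L]) c%:E = (c * L)%:E)%E.
  by rewrite EFinM -muL; exact: integral_cst.
have mFs s : measurable_fun [set: measurableTypeR R] (fun t => (F (s, t))%:E).
  apply/measurable_EFinP; apply: (measurableT_comp mF).
  by apply/measurable_fun_pair => //; exact: measurable_cst.
transitivity (\int[@lebesgue_measure R]_(s in `[0%R, L])
    (\int[@lebesgue_measure R]_(t in `[0%R, L]) (F (s, t))%:E + (e * L)%:E))%E.
  apply: eq_integral => s _; under eq_integral do rewrite EFinD.
  rewrite ge0_integralD //=; last 2 first.
  - by move=> t _; rewrite lee_fin.
  - exact: measurable_funTS.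
  by rewrite [X in (_ + X)%E]cstL.
rewrite ge0_integralD //=.
- by rewrite [X in (_ + X)%E]cstL -mulrA.
- by move=> s _; apply: integral_ge0 => t _; rewrite lee_fin.
- by apply: measurable_funTS; exact: measurable_inner.
- by move=> s _; rewrite lee_fin mulr_ge0 // ltW.
Qed.

(** * Continuous functions on a segment *)

Section segment_functions.
Variables (R : realType) (V : normedModType R) (L : R).

(** Values outside the segment are arbitrary; composing with this retraction gives a function
    continuous on the whole line without changing it on [[0, L]]. *)
Definition clamp (t : R) : R := Num.max 0 (Num.min t L).

Hypothesis L_gt0 : 0 < L.

Lemma clamp_in t : `[0, L]%classic (clamp t).
Proof. by rewrite /= in_itv /= /clamp le_max lexx ge_max ge_min lexx orbT (ltW L_gt0). Qed.

Lemma clampE t : t \in `[0, L] -> clamp t = t.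
Proof. by rewrite in_itv /= => /andP[t0 tL]; rewrite /clamp min_l // max_r. Qed.

Lemma clamp_lipschitz s t : `|clamp s - clamp t| <= `|s - t|.
Proof.
wlog st : s t / s <= t => [H|].
  have [st|ts] := leP s t; first exact: H.
  by rewrite distrC (distrC s); apply: H; exact: ltW.
rewrite distrC (distrC s) !ger0_norm ?subr_ge0 //; last first.
  by rewrite /clamp ge_max !le_max lexx /= le_min !ge_min st lexx !orbT.
rewrite lerBlDr /clamp ge_max; apply/andP; split.
  by rewrite addr_ge0 ?subr_ge0 // le_max lexx.
rewrite -lerBlDl le_max; apply/orP.
right; have [sL|/ltW Ls] := leP s L; rewrite lerBlDr.
  by rewrite subrKC ge_min lexx.
by apply: le_trans (_ : L <= _); rewrite ?ge_min ?lexx ?orbT // lerDl subr_ge0.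
Qed.

Lemma clamp_continuous (f : R -> V) :
  (forall t e, `[0, L]%classic t -> 0 < e -> exists2 d, 0 < d &
     forall s, `|s - t| < d -> `[0, L]%classic s -> `|f s - f t| < e) ->
  continuous (f \o clamp).
Proof.
move=> fc t; apply/cvgrPdist_lt => e e0.
have [d d0 H] := fc _ _ (clamp_in t) e0.
apply/nbhs_ballP; exists d => //= s; rewrite /ball /= => st.
rewrite distrC; apply: H; last exact: clamp_in.
by rewrite distrC; apply: le_lt_trans (clamp_lipschitz _ _) st.
Qed.

Lemma segment_uniformly_continuous (f : R -> V) e : continuous f -> 0 < e ->
  exists2 d, 0 < d & forall s t, `[0, L]%classic s -> `|s - t| < d -> `|f s - f t| < e.
Proof.
move=> fc e0.
have /compact_near_coveringP cov := @segment_compact R 0 L.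
have near_x : forall x : R, `[0, L]%classic x ->
    \forall s \near x & d \near (0 : R)^'+, forall t, `|s - t| < d -> `|f s - f t| < e.
  move=> x _; have /cvgrPdist_lt /(_ (e / 2)) := fc x.
  rewrite divr_gt0 // => /(_ isT) /nbhs_ballP[r /= r0 H].
  have r2 : 0 < r / 2 by rewrite divr_gt0.
  exists (ball x (r / 2), [set d | d < r / 2]).
    split => /=; first exact: nbhsx_ballx.
    exact: nbhs_right_lt.
  move=> [s d] /= [xs dr] t st; rewrite /ball /= in xs.
  have fs : `|f x - f s| < e / 2 by apply: H; rewrite /ball /=; apply: lt_le_trans xs _; lra.
  have ft : `|f x - f t| < e / 2.
    apply: H; rewrite /ball /= -(subrK s x) -addrA; apply: le_lt_trans (ler_normD _ _) _.
    by have := lt_trans st dr; lra.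
  rewrite -(subrK (f x) (f s)) -addrA; apply: le_lt_trans (ler_normD _ _) _.
  by rewrite (distrC (f s)); lra.
have near0 := cov _ _ _ (at_right_proper_filter 0) near_x.
have [d /= [H d0]] := filter_ex (filterI near0 (nbhs_right_gt 0)).
by exists d => // s t sL; exact: H.
Qed.

Lemma segment_bounded (f : R -> V) : continuous f ->
  exists2 M, 0 < M & forall t, `[0, L]%classic t -> `|f t| <= M.
Proof.
move=> fc.
have cA : compact (f @` `[0, L]%classic).
  apply: continuous_compact; last exact: segment_compact.
  by apply: continuous_subspaceT.
have [M [Mr H]] := compact_bounded cA.
exists (`|M| + 1); first by rewrite ltr_wpDl.
move=> t tL; apply: (H (`|M| + 1)); last by exists t.
by apply: le_lt_trans (ler_norm M) _; rewrite ltrDl.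
Qed.

End segment_functions.

Section riemann_sums.
Variables (R : realType) (L : R) (P Q : R -> 'rV[R]_3).
Local Notation V := 'rV[R]_3.
Hypothesis L_gt0 : 0 < L.
Hypotheses (cP : continuous P) (cQ : continuous Q).
Hypothesis mean_value : forall a b k, 0 <= a -> a < b -> b <= L ->
  exists2 c, c \in `[a, b] & P b ord0 k - P a ord0 k = Q c ord0 k * (b - a).

Lemma norm_le_coord (A : V) c : 0 <= c -> (forall k, `|A ord0 k| <= c) -> `|A| <= c.
Proof.
move=> c0 H; rewrite [leLHS]/Num.norm /= mx_normrE; apply: bigmax_le => // -[i k] _ /=.
by rewrite (ord1 i).
Qed.

Lemma det3_bound (u v w : V) : `|det3 u v w| <= 6 * (`|u| * `|v| * `|w|).
Proof.
have p i j k : `|u ord0 i * v ord0 j * w ord0 k| <= `|u| * `|v| * `|w|.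
  by rewrite !normrM !ler_pM ?mulr_ge0 // coord_le_norm.
rewrite det3E.
have := p i0 i1 i2; have := p i0 i2 i1; have := p i1 i0 i2.
have := p i1 i2 i0; have := p i2 i0 i1; have := p i2 i1 i0.
by rewrite !ler_norml; move=> /andP[? ?] /andP[? ?] /andP[? ?] /andP[? ?] /andP[? ?] /andP[? ?]; apply/andP; split; lra.
Qed.

(** The arguments are replaced one at a time, and each replacement costs at most [12 * M ^+ 2 * e]:
    the determinant has six terms, and the third argument, a difference of two points, has twice the
    bounds. *)
Lemma det3_perturbation (u v w u' v' w' : V) M e : `|u'| <= M -> `|v| <= M -> `|v'| <= M -> `|w| <= 2 * M ->
  `|u - u'| <= e -> `|v - v'| <= e -> `|w - w'| <= 2 * e ->
  `|det3 u v w - det3 u' v' w'| <= 36 * M ^+ 2 * e.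
Proof.
move=> u'M vM v'M wM uu vv ww.
have -> : det3 u v w - det3 u' v' w' =
    det3 (u - u') v w + det3 u' (v - v') w + det3 u' v' (w - w').
  by rewrite !det3E !mxE; ring.
have M0 : 0 <= M by apply: le_trans vM.
have e0 : 0 <= e by apply: le_trans uu.
have b1 : `|det3 (u - u') v w| <= 6 * (e * M * (2 * M)).
  by apply: le_trans (det3_bound _ _ _) _; rewrite ler_wpM2l // !ler_pM ?mulr_ge0.
have b2 : `|det3 u' (v - v') w| <= 6 * (M * e * (2 * M)).
  by apply: le_trans (det3_bound _ _ _) _; rewrite ler_wpM2l // !ler_pM ?mulr_ge0.
have b3 : `|det3 u' v' (w - w')| <= 6 * (M * M * (2 * e)).
  by apply: le_trans (det3_bound _ _ _) _; rewrite ler_wpM2l // !ler_pM ?mulr_ge0.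
apply: le_trans (ler_normD _ _) _; apply: le_trans (lerD (ler_normD _ _) b3) _.
apply: le_trans (lerD (lerD b1 b2) (lexx _)) _.
by rewrite le_eqVlt; apply/orP; left; apply/eqP; ring.
Qed.

Definition density (p : R * R) : R := `|det3 (Q p.1) (Q p.2) (P p.1 - P p.2)|.

Lemma measurable_density : measurable_fun [set: measurableTypeR R * measurableTypeR R] density.
Proof.
have co (f : R -> V) k : continuous f -> measurable_fun [set: measurableTypeR R] (fun t => f t ord0 k).
  move=> cf; apply: continuous_measurable_fun => t.
  by apply: (cvg_comp f (fun M : V => M ord0 k) (cf t)); exact: coord_continuous.
have m1 (f : R -> V) k : continuous f ->
    measurable_fun [set: measurableTypeR R * measurableTypeR R] (fun p => f p.1 ord0 k).
  by move=> cf; exact: (measurableT_comp (co f k cf) measurable_fst).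
have m2 (f : R -> V) k : continuous f ->
    measurable_fun [set: measurableTypeR R * measurableTypeR R] (fun p => f p.2 ord0 k).
  by move=> cf; exact: (measurableT_comp (co f k cf) measurable_snd).
apply: (measurableT_comp (@normr_measurable _ _)).
rewrite (_ : (fun p => _) = fun p =>
  Q p.1 ord0 i0 * (Q p.2 ord0 i1 * (P p.1 ord0 i2 - P p.2 ord0 i2) - (P p.1 ord0 i1 - P p.2 ord0 i1) * Q p.2 ord0 i2)
  - Q p.2 ord0 i0 * (Q p.1 ord0 i1 * (P p.1 ord0 i2 - P p.2 ord0 i2) - (P p.1 ord0 i1 - P p.2 ord0 i1) * Q p.1 ord0 i2)
  + (P p.1 ord0 i0 - P p.2 ord0 i0) * (Q p.1 ord0 i1 * Q p.2 ord0 i2 - Q p.2 ord0 i1 * Q p.1 ord0 i2)); last first.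
  by apply/funext => p; rewrite det3E !mxE.
by repeat first [exact: m1 | exact: m2 | apply: measurable_funM | apply: measurable_funB | apply: measurable_funD].
Qed.

Lemma density_ge0 p : 0 <= density p.
Proof. exact: normr_ge0. Qed.

(** Each tetrahedron is [h i * h j] times a determinant in difference quotients, whose value is
    uniformly close to the density on the cell. Bounding the double integral cell by cell turns this
    into the two inequalities. *)
Lemma polygon_sum_riemann e : 0 < e -> exists2 d, 0 < d & forall n (T : nat -> R),
  T 0%N = 0 -> T n = L -> (forall i, (i < n)%N -> T i < T i.+1) ->
  (forall i, (i < n)%N -> T i.+1 - T i < d) ->
  let S := \sum_(0 <= i < n) \sum_(0 <= j < n) `|det4 (P (T i)) (P (T i.+1)) (P (T j)) (P (T j.+1))| in
  (double_integral L density <= (S + e)%:E /\ S%:E <= double_integral L density + e%:E)%E.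
Proof.
move=> e0.
have [M1 M10 HM1] := segment_bounded L cP; have [M2 M20 HM2] := segment_bounded L cQ.
pose M := M1 + M2.
have M0 : 0 < M by rewrite addr_gt0.
have PM t : `[0, L]%classic t -> `|P t| <= M by move=> /HM1 /le_trans; apply; rewrite lerDl ltW.
have QM t : `[0, L]%classic t -> `|Q t| <= M by move=> /HM2 /le_trans; apply; rewrite lerDr ltW.
(* The constant of [det3_perturbation] times the area of the parameter square, so that an
   oscillation [e / k] produces a total error [e]. *)
pose k := 36 * M ^+ 2 * L ^+ 2.
have k0 : 0 < k by rewrite !mulr_gt0 ?exprn_gt0.
pose w := e / k.
have w0 : 0 < w by rewrite divr_gt0.
have [d1 d10 ucP] := segment_uniformly_continuous L cP w0.
have [d2 d20 ucQ] := segment_uniformly_continuous L cQ w0.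
exists (Num.min d1 d2); first by rewrite lt_min d10.
move=> n T T0 Tn T_mono mesh S.
have Tle i : (i <= n)%N -> 0 <= T i <= L by exact: (grid_in T0 Tn T_mono).
pose h i := T i.+1 - T i.
have h0 i : (i < n)%N -> 0 < h i by move=> lt; rewrite subr_gt0 T_mono.
pose D i : V := (h i)^-1 *: (P (T i.+1) - P (T i)).
have in_seg i s : (i < n)%N -> T i <= s <= T i.+1 -> `[0, L]%classic s.
  move=> lt /andP[a b]; rewrite /= in_itv /=.
  have /andP[c _] := Tle i (ltnW lt); have /andP[_ g] := Tle i.+1 lt.
  by rewrite (le_trans c a) (le_trans b g).
(* The intermediate point depends on the coordinate [q]; uniform continuity of [Q] makes this
   harmless. *)
have Dk i q : (i < n)%N -> exists2 c, T i <= c <= T i.+1 & D i ord0 q = Q c ord0 q.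
  move=> lt; have /andP[a _] := Tle i (ltnW lt); have /andP[_ b] := Tle i.+1 lt.
  have [c cin E] := mean_value q a (T_mono i lt) b.
  exists c; first by move: cin; rewrite in_itv.
  by rewrite /D !mxE E mulrC mulfK // lt0r_neq0 // h0.
have DM i : (i < n)%N -> `|D i| <= M.
  move=> lt; apply: norm_le_coord; first exact: ltW.
  move=> q; have [c ci ->] := Dk i q lt.
  by apply: le_trans (coord_le_norm _ _) _; apply: QM; exact: in_seg lt ci.
have close i s t : (i < n)%N -> T i <= s <= T i.+1 -> T i <= t <= T i.+1 -> `|s - t| < Num.min d1 d2.
  move=> lt /andP[a b] /andP[c g]; apply: le_lt_trans (mesh i lt).
  by rewrite ler_norml; apply/andP; split; lra.
have DQ i s : (i < n)%N -> T i <= s <= T i.+1 -> `|D i - Q s| <= w.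
  move=> lt si; apply: norm_le_coord; first exact: ltW.
  move=> q; have [c ci E] := Dk i q lt.
  have -> : (D i - Q s) ord0 q = Q c ord0 q - Q s ord0 q by rewrite -E !mxE.
  have := coord_le_norm (Q c - Q s) q; rewrite !mxE => /le_trans; apply; apply: ltW.
  apply: ucQ; first exact: in_seg lt ci.
  by apply: lt_le_trans (close i c s lt ci si) _; rewrite ge_min lexx orbT.
have self i : (i < n)%N -> T i <= T i <= T i.+1 by move=> lt; rewrite lexx (ltW (T_mono _ lt)).
have PP i s : (i < n)%N -> T i <= s <= T i.+1 -> `|P (T i) - P s| <= w.
  move=> lt si; apply: ltW; apply: ucP.
    exact: in_seg lt (self i lt).
  by apply: lt_le_trans (close i _ s lt (self i lt) si) _; rewrite ge_min lexx.
pose c i j := `|det3 (D i) (D j) (P (T i) - P (T j))|.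
(* Subtracting edge vectors replaces the three differences from [P (T i)] by the two edges and
   [P (T i) - P (T j)]. *)
have cS i j : (i < n)%N -> (j < n)%N ->
    `|det4 (P (T i)) (P (T i.+1)) (P (T j)) (P (T j.+1))| = c i j * (h i * h j).
  move=> /h0 hi /h0 hj; rewrite -[h i * h j]gtr0_norm ?mulr_gt0 // -normrM; congr `|_|.
  rewrite /D /det4 !det3E !mxE; field.
  by rewrite !gt_eqF.
have SE : S = \sum_(0 <= i < n) \sum_(0 <= j < n) c i j * (h i * h j).
  by rewrite /S; apply: eq_big_nat => i /= iN; apply: eq_big_nat => j /= jN; exact: cS.
have hL : \sum_(0 <= i < n) h i = L by rewrite telescope_sumr // Tn T0 subr0.
pose r := 36 * M ^+ 2 * w.
have r0 : 0 <= r by apply: mulr_ge0 (ltW w0); rewrite mulr_ge0 ?sqr_ge0.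
have rL : r * L ^+ 2 = e.
  by rewrite /r /w /k; field; rewrite !gt_eqF.
have est i j s t : (i < n)%N -> (j < n)%N -> T i <= s <= T i.+1 -> T j <= t <= T j.+1 ->
    `|c i j - density (s, t)| <= r.
  move=> iN jN si tj; apply: le_trans (ler_dist_dist _ _) _.
  apply: det3_perturbation.
  - by apply: QM; exact: in_seg iN si.
  - exact: DM.
  - by apply: QM; exact: in_seg jN tj.
  - apply: le_trans (ler_normB _ _) _; rewrite mulr_natl mulr2n.
    by apply: lerD; apply: PM; [exact: in_seg iN (self i iN)|exact: in_seg jN (self j jN)].
  - exact: DQ.
  - exact: DQ.
  - have -> : P (T i) - P (T j) - (P s - P t) = (P (T i) - P s) - (P (T j) - P t).
      by apply/rowP => q; rewrite !mxE; ring.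
    apply: le_trans (ler_normB _ _) _; rewrite mulr_natl mulr2n.
    by apply: lerD; exact: PP.
split.
  have -> : S + e = \sum_(0 <= i < n) \sum_(0 <= j < n) (c i j + r) * (h i * h j).
    rewrite SE -rL -hL expr2 mulr_suml mulr_sumr -big_split; apply: eq_bigr => i _ /=.
    rewrite !mulr_sumr -big_split; apply: eq_bigr => j _ /=; ring.
  apply: (double_integral_le T0 Tn T_mono measurable_density density_ge0).
  move=> i j s t iN jN /andP[/andP[/ltW a b] /andP[/ltW a' b']].
  have := est i j s t iN jN; rewrite a b a' b' => /(_ isT isT).
  by rewrite ler_norml => /andP[? _]; lra.
rewrite SE -rL -double_integralD //; last 2 first.
- exact: measurable_density.
- exact: density_ge0.
apply: (double_integral_ge T0 Tn T_mono).
- by apply: measurable_funD; [exact: measurable_density|exact: measurable_cst].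
- by move=> p; rewrite addr_ge0 // density_ge0.
- by move=> i j; exact: normr_ge0.
move=> i j s t iN jN /andP[/andP[/ltW a b] /andP[/ltW a' b']].
have := est i j s t iN jN; rewrite a b a' b' => /(_ isT isT).
by rewrite ler_norml => /andP[_ ?]; lra.
Qed.

End riemann_sums.

(** * Inscribed polygons *)

(** Reducing modulo [n] rotates the four indices cyclically, which changes [det4] at most by a
    sign. *)
Lemma cyclic_general_position (R : realType) (n : nat) (y : nat -> 'rV[R]_3) :
  (forall i j k l, (i < j)%N -> (j < k)%N -> (k < l)%N -> (l < n)%N -> det4 (y i) (y j) (y k) (y l) != 0) ->
  forall i j k l, (i < j)%N -> (j < k)%N -> (k < l)%N -> (l < i + n)%N ->
    det4 (y (i %% n)%N) (y (j %% n)%N) (y (k %% n)%N) (y (l %% n)%N) != 0.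
Proof.
move=> gen.
have base i j k l : (i < n)%N -> (i < j)%N -> (j < k)%N -> (k < l)%N -> (l < i + n)%N ->
    det4 (y (i %% n)%N) (y (j %% n)%N) (y (k %% n)%N) (y (l %% n)%N) != 0.
  move=> iN ij jk kl lN; rewrite (modn_small iN).
  have wrap m : (n <= m)%N -> (m < i + n)%N -> (m %% n = m - n)%N.
    by move=> nm mi; rewrite -{1}(subnK nm) modnDr modn_small //; lia.
  have [ln|nl] := ltnP l n.
    by rewrite !modn_small; try lia; apply: gen.
  rewrite (wrap l) //.
  have [kn|nk] := ltnP k n.
    rewrite !modn_small; try lia.
    by rewrite det4_swap34 det4_swap23 det4_swap12 !oppr_eq0; apply: gen => //; lia.
  rewrite (wrap k) //; last lia.
  have [jn|nj] := ltnP j n.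
    rewrite modn_small //.
    by rewrite det4_swap13_24; apply: gen => //; lia.
  rewrite (wrap j) //; last lia.
  by rewrite det4_swap12 det4_swap23 det4_swap34 !oppr_eq0; apply: gen => //; lia.
move=> i j k l ij jk kl lN.
have n0 : (0 < n)%N by lia.
have E := divn_eq i n; set q := (i %/ n)%N in E; set r := (i %% n)%N in E *.
have rn : (r < n)%N by rewrite ltn_mod.
have shift m : (i <= m)%N -> (m %% n = (m - q * n) %% n)%N.
  by move=> im; rewrite -{1}(@subnKC (q * n) m) ?modnMDl //; lia.
have {1}-> : r = (r %% n)%N by rewrite modn_small.
by rewrite (shift j) ?(shift k) ?(shift l); try lia; apply: base; lia.
Qed.

Lemma grid_locate (R : realType) (T : nat -> R) (n : nat) (t : R) : (0 < n)%N ->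
  T 0%N <= t -> t <= T n -> exists2 i, (i < n)%N & T i <= t <= T i.+1.
Proof.
elim: n => // n IH _ t0 tn.
have [tl|lt] := leP (T n) t; first by exists n => //; rewrite tl tn.
case: n IH tn lt => [|n] IH tn lt; first by move: (le_lt_trans t0 lt); rewrite ltxx.
have [i iN Ti] := IH isT t0 (ltW lt).
by exists i => //; exact: leq_trans iN _.
Qed.

Section curve_volume.
Variables (R : realType) (L : R) (gamma : R -> 'rV[R]_3).
Local Notation V := 'rV[R]_3.
Hypothesis L_gt0 : 0 < L.
Hypothesis gamma_der : derivable_in `[0, L] gamma.
Hypothesis gamma_der2 : derivable_in `[0, L] (derive1_in `[0, L] gamma).
Hypothesis gamma_loop : gamma 0 = gamma L.
Hypothesis gamma_simple : simple_curve L gamma.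
Hypothesis gamma_planes : forall (nu : V) (c : R), nu != 0 -> (plane_count L gamma nu c <= 4%:E)%E.

Let P := gamma \o clamp L.
Let Q := derive1_in `[0, L] gamma \o clamp L.

Let cP : continuous P.
Proof.
apply: (clamp_continuous L_gt0) => t e tD e0.
exact: derivable_in_norm_continuous (gamma_der tD) e0.
Qed.

Let cQ : continuous Q.
Proof.
apply: (clamp_continuous L_gt0) => t e tD e0.
exact: derivable_in_norm_continuous (gamma_der2 tD) e0.
Qed.

Let PE t : t \in `[0, L] -> P t = gamma t.
Proof. by move=> tL; rewrite /P /= clampE. Qed.

Let mean_value (a b : R) k : 0 <= a -> a < b -> b <= L ->
  exists2 c, c \in `[a, b] & P b ord0 k - P a ord0 k = Q c ord0 k * (b - a).
Proof.
move=> a0 ab bL.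
have sub t : t \in `[a, b] -> t \in `[0, L].
  by rewrite !in_itv /= => /andP[at_ tb]; rewrite (le_trans a0 at_) (le_trans tb bL).
rewrite !PE; try by apply: sub; rewrite in_itv /= lexx ltW.
have [c cab E] : exists2 c, c \in `[a, b] &
    gamma b ord0 k - gamma a ord0 k = derive1_in `[0, L] gamma c ord0 k * (b - a).
  apply: (MVT_segment (ltW ab) (f := fun t => gamma t ord0 k)).
    move=> t; rewrite in_itv /= => /andP[at_ tb].
    have tL : 0 < t < L by rewrite (le_lt_trans a0 at_) (lt_le_trans tb bL).
    apply: (is_derive_interior _ tL); apply: gamma_der => /=.
    by rewrite in_itv /=; case/andP: tL => /ltW -> /ltW ->.
  exact: (@coord_within_continuous _ _ _ gamma_der a b k a0 bL).
by exists c => //; rewrite /Q /= clampE //; exact: sub.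
Qed.

Lemma inscribed_polygon n : (5 <= n)%N -> exists T : nat -> R,
  [/\ T 0%N = 0, T n = L, forall i, (i < n)%N -> T i < T i.+1,
      forall i, (i < n)%N -> T i.+1 - T i < 2 * L / n%:R &
      let H := finite_hull (vtx (n := n) (fun i => gamma (T (i %% n)%N))) in
      vmeasurable H /\ vol H = (24^-1 * \sum_(0 <= i < n) \sum_(0 <= j < n)
        `|det4 (P (T i)) (P (T i.+1)) (P (T j)) (P (T j.+1))|)%:E].
Proof.
move=> n5; have n0 : (0 < n)%N by lia.
have nR : 0 < n%:R :> R by rewrite ltr0n.
have [T' [T0 Tin gen]] := generic_parameters L_gt0 gamma_simple gamma_planes n0.
(* [T n = L] completes the subdivision and names the same point as [T 0 = 0], since the curve is a
   loop. As [T i] lies between [u i] and [u i.+1], the mesh is below [2 * L / n]. *)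
pose T i := if (i < n)%N then T' i else L.
pose u (i : nat) : R := i%:R * L / n%:R.
have uS i : u i.+1 = u i + L / n%:R by rewrite /u -natr1 mulrDl mul1r mulrDl.
have un : u n = L by rewrite /u mulrAC mulfV ?gt_eqF // mul1r.
have Ln : 0 < L / n%:R by rewrite divr_gt0.
have T_lo i : (i <= n)%N -> u i <= T i.
  rewrite leq_eqVlt => /orP[/eqP ->|lt]; first by rewrite /T ltnn un.
  rewrite /T lt; case: i lt => [|i] lt; first by rewrite T0 /u !mul0r.
  by have /andP[/ltW] := Tin i.+1 lt.
have T_hi i : (i < n)%N -> T i < u i.+1.
  move=> lt; rewrite /T lt; case: i lt => [|i] lt; last by have /andP[_] := Tin i.+1 lt.
  by rewrite T0 /u mul1r.
have T_mono i : (i < n)%N -> T i < T i.+1 by move=> lt; apply: lt_le_trans (T_hi i lt) (T_lo i.+1 lt).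
have T_inc i j : (i < j)%N -> (j < n)%N -> T i < T j.
  elim: j => // j IH; rewrite ltnS leq_eqVlt => /orP[/eqP -> /ltnW /T_mono //|ij jn].
  by apply: lt_trans (IH ij (ltnW jn)) (T_mono _ (ltnW jn)).
exists T; split => //.
- by rewrite /T n0.
- by rewrite /T ltnn.
- move=> i lt; have a := T_lo i (ltnW lt).
  have b : T i.+1 <= u i.+2.
    have [lt'|] := ltnP i.+1 n; first exact: ltW (T_hi _ lt').
    move=> ge; have -> : i.+1 = n by lia.
    by rewrite /T ltnn uS un lerDl ltW.
  have : T i.+1 - T i <= 2 * L / n%:R by rewrite -mulrA; move: b; rewrite !uS; lra.
  rewrite le_eqVlt => /orP[/eqP E|//]; exfalso.
  have bb : T i.+1 < u i.+2.
    have [lt'|] := ltnP i.+1 n; first exact: (T_hi _ lt').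
    move=> ge; have -> : i.+1 = n by lia.
    by rewrite /T ltnn uS un ltrDl.
  by move: E bb; rewrite -mulrA !uS; lra.
pose x i := gamma (T (i %% n)%N).
have Tn i : T (i %% n)%N = T' (i %% n)%N by rewrite /T ltn_mod n0.
have x_per i : x (i + n)%N = x i by rewrite /x modnDr.
have x_gen i j k l : (i < j)%N -> (j < k)%N -> (k < l)%N -> (l < i + n)%N ->
    det4 (x i) (x j) (x k) (x l) != 0.
  by rewrite /x !Tn; exact: (cyclic_general_position (y := gamma \o T') gen).
have T_in i : (i < n)%N -> 0 <= T i < L.
  move=> lt; apply/andP; split.
    by apply: le_trans (T_lo i (ltnW lt)); rewrite /u !mulr_ge0 ?invr_ge0 // ltW.
  apply: lt_le_trans (T_hi i lt) _; rewrite -un /u ler_pM2r ?invr_gt0 // ler_pM2r // ler_nat //.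
have x_alt := polygon_alternation gamma_der gamma_planes n0 T_in T_inc.
split.
  exact: (@vmeasurable_finite_hull _ n (vtx x) _ (ltnW n5) (@vtx_gen _ n x n5 x_gen)).
rewrite (vol_finite_hull n5 x_per x_gen x_alt).
have xP i : (i <= n)%N -> x i = P (T i).
  rewrite leq_eqVlt => /orP[/eqP ->|lt].
    by rewrite /x modnn /T n0 ltnn T0 PE ?gamma_loop // in_itv /= lexx ltW.
  rewrite /x modn_small // PE //; have /andP[a /ltW b] := T_in i lt.
  by rewrite in_itv /= a b.
congr ((_ * _)%:E); apply: eq_big_nat => i /= iN; apply: eq_big_nat => j /= jN.
by rewrite !xP //; exact: ltnW.
Qed.

Lemma curve_hullE : curve_hull L gamma = combinations (gamma @` `[0, L]%classic).
Proof. exact: convex_hullE. Qed.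

Lemma closed_curve_hull : closed (curve_hull L gamma).
Proof.
rewrite curve_hullE; apply: compact_closed; first exact: norm_hausdorff.
apply: compact_combinations.
have -> : gamma @` `[0, L]%classic = P @` `[0, L]%classic.
  by apply: eq_imagel => t tL; rewrite PE.
by apply: continuous_compact; [exact: continuous_subspaceT|exact: segment_compact].
Qed.

Lemma hull_sandwich : exists o : V, forall d e : R, 0 < d -> d < 1 -> 0 < e -> exists H S,
  [/\ vmeasurable H /\ H `<=` curve_hull L gamma, vol H = (24^-1 * S)%:E,
      forall x, curve_hull L gamma x -> H (o + (1 - d) *: (x - o)) &
      (double_integral L (density P Q) <= (S + e)%:E /\ S%:E <= double_integral L (density P Q) + e%:E)%E].
Proof.
have [T4 [T40 T4in gen4]] := generic_parameters L_gt0 gamma_simple gamma_planes (isT : (0 < 4)%N).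
set A := gamma @` `[0, L]%classic.
have A4 i : (i < 4)%N -> A (gamma (T4 i)).
  move=> lt; exists (T4 i) => //=; rewrite in_itv /=.
  case: i lt => [|i] lt; first by rewrite T40 lexx ltW.
  have /andP[a b] := T4in i.+1 lt; apply/andP; split.
    by apply: le_trans (ltW a); rewrite !mulr_ge0 ?invr_ge0 // ltW.
  apply: le_trans (ltW b) _; rewrite -mulrA mulrC -mulrA ger_pMr // ler_pdivrMl // mulr1 ler_nat //.
pose o := 4^-1 *: (gamma (T4 0%N) + gamma (T4 1%N) + gamma (T4 2%N) + gamma (T4 3%N)).
exists o => d e d0 d1 e0.
have D4 : det4 (gamma (T4 0%N)) (gamma (T4 1%N)) (gamma (T4 2%N)) (gamma (T4 3%N)) != 0.
  exact: gen4.
have [eta eta0 contr] := contraction_in_approximation (A4 0%N isT) (A4 1%N isT) (A4 2%N isT) (A4 3%N isT) D4 d0 d1.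
have [d2 d20 unif] := segment_uniformly_continuous L cP eta0.
have [d3 d30 riem] := polygon_sum_riemann L_gt0 cP cQ mean_value e0.
pose m := Num.min d2 d3.
have m0 : 0 < m by rewrite lt_min d20.
(* The bound makes the mesh smaller than both moduli of continuity require; the summand 5 meets the
   size condition on polygons. *)
pose n := (Num.Def.archi_bound (2 * L / m) + 5)%N.
have nm : 2 * L / n%:R < m.
  have nR : 0 < n%:R :> R by rewrite ltr0n /n addn_gt0 orbT.
  rewrite ltr_pdivrMr // -ltr_pdivrMl // mulrC.
  apply: (@lt_le_trans _ _ (Num.Def.archi_bound (2 * L / m))%:R).
    by rewrite archi_boundP // divr_ge0 ?mulr_ge0 // ltW.
  by rewrite ler_nat leq_addr.
have n5 : (5 <= n)%N by rewrite leq_addl.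
have [T [T0 Tn T_mono mesh [mH vH]]] := inscribed_polygon n5.
have meshm i : (i < n)%N -> T i.+1 - T i < m by move=> lt; apply: lt_trans (mesh i lt) nm.
set x := fun i => _ in mH vH; set H := finite_hull _ in mH vH.
have T_in i : (i < n)%N -> T i \in `[0, L].
  by move=> lt; rewrite in_itv /=; exact: (grid_in T0 Tn T_mono (ltnW lt)).
have zA (i : 'I_n) : A (vtx x i).
  by exists (T i); [exact: T_in|rewrite /vtx /x modn_small].
have Hsub : H `<=` curve_hull L gamma by rewrite curve_hullE; exact: finite_hull_sub.
exists H, (\sum_(0 <= i < n) \sum_(0 <= j < n) `|det4 (P (T i)) (P (T i.+1)) (P (T j)) (P (T j.+1))|).
split => //.
- move=> p; rewrite curve_hullE; apply: contr; first exact: finite_hull_segment_closed.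
  move=> _ [t tL <-].
  have tL' : 0 <= t <= L by move: tL; rewrite /= in_itv.
  have /andP[t0 t1] := tL'.
  have [i iN /andP[ti it]] : exists2 i, (i < n)%N & T i <= t <= T i.+1.
    by apply: grid_locate => //; rewrite ?T0 ?Tn.
  exists (vtx x (Ordinal iN)).
    exists (fun j => (j == Ordinal iN)%:R); split.
    + by move=> j; rewrite ler0n.
    + by rewrite (bigD1 (Ordinal iN)) //= eqxx big1 ?addr0 // => j /negbTE ->.
    + rewrite (bigD1 (Ordinal iN)) //= eqxx scale1r big1 ?addr0 // => j /negbTE ->.
      by rewrite scale0r.
  rewrite /vtx /x /= modn_small // -(PE (T_in i iN)) -(PE tL).
  apply: unif; first exact: T_in.
  have := meshm i iN; rewrite lt_min => /andP[lt _].
  by rewrite ltr_norml; apply/andP; split; lra.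
- apply: riem => // i iN; have := meshm i iN; rewrite lt_min => /andP[_]; exact.
Qed.

Lemma vmeasurable_curve_hull : vmeasurable (curve_hull L gamma).
Proof.
have [c sand] := hull_sandwich; apply: (vmeasurable_limit (o := c) closed_curve_hull) => d d0 d1.
by have [H [S [[mH HK] _ HC _]]] := sand d 1 d0 d1 ltr01; exists H.
Qed.

(** For every [d] and [e], [S / 24] lies between [(1 - d) ^+ 3] times the volume and the volume, and
    within [e / 24] of the claimed value. Finiteness of both sides is settled at [d = 1 / 2], so
    that the limits can be taken in the reals. *)
Lemma vol_curve_hull : vol (curve_hull L gamma) = ((24^-1)%:E * double_integral L (density P Q))%E.
Proof.
have [c sand] := hull_sandwich; have mK := vmeasurable_curve_hull.
set K := curve_hull L gamma in sand mK *; set I := double_integral _ _ in sand *.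
have K0 : (0 <= vol K)%E by exact: measure_ge0.
have I0 : (0 <= I)%E.
  by apply: integral_ge0 => s _; apply: integral_ge0 => t _; rewrite lee_fin density_ge0.
have bounds d e : 0 < d -> d < 1 -> 0 < e -> exists S : R,
    [/\ (((1 - d) ^+ 3)%:E * vol K <= (24^-1 * S)%:E)%E, ((24^-1 * S)%:E <= vol K)%E,
        (I <= (S + e)%:E)%E & (S%:E <= I + e%:E)%E].
  move=> d0 d1 e0; have [H [S [[mH HK] vH HC [IS SI]]]] := sand d e d0 d1 e0.
  exists S; split; [|by rewrite -vH; exact: vol_le|by []|by []].
  have r0 : 0 < 1 - d by rewrite subr_gt0.
  have [mK' E] := vol_homothety c r0 mK.
  rewrite -E -vH; apply: vol_le => // p /= /HC.
  by rewrite addrAC subrr add0r scalerA mulfV ?gt_eqF // scale1r addrC subrK.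
have Kfin : vol K \is a fin_num.
  have half : 0 < (1 / 2 : R) by lra.
  have half1 : (1 / 2 : R) < 1 by lra.
  have [S [b _ _ _]] := bounds (1 / 2) 1 half half1 ltr01.
  rewrite ge0_fin_numE // lt_neqAle leey andbT; apply: contraTneq b => ->.
  by rewrite gt0_muley ?lte_fin ?exprn_gt0 ?leye_eq //; lra.
have Ifin : I \is a fin_num.
  have half : 0 < (1 / 2 : R) by lra.
  have half1 : (1 / 2 : R) < 1 by lra.
  have [S [_ _ b _]] := bounds (1 / 2) 1 half half1 ltr01.
  by rewrite ge0_fin_numE //; apply: le_lt_trans b _; rewrite ltry.
rewrite -(fineK Kfin) -(fineK Ifin) -EFinM; congr (_%:E).
set v := fine (vol K); set w := fine I.
have v0 : 0 <= v by exact: fine_ge0.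
have bnd d e : 0 < d -> d < 1 -> 0 < e ->
    (1 - d) ^+ 3 * v <= 24^-1 * (w + e) /\ 24^-1 * w <= v + e.
  move=> d0 d1 e0; have [S []] := bounds d e d0 d1 e0.
  rewrite -(fineK Kfin) -(fineK Ifin) -/v -/w -EFinM -EFinD !lee_fin => b1 b2 b3 b4.
  by split; lra.
apply/eqP; rewrite eq_le; apply/andP; split; last first.
  by apply/ler_addgt0Pr => e e0; have [] := bnd (1 / 2) e _ _ e0; lra.
apply/ler_addgt0Pr => e e0.
(* Since [(1 - d) ^+ 3 >= 1 - 3 * d], the contraction loses at most [3 * d * v <= e / 2]; the
   summand 1 keeps the denominator positive. *)
pose d := Num.min (1 / 2) (e / (6 * (v + 1))).
have v1 : 0 < 6 * (v + 1) by rewrite mulr_gt0 // ltr_wpDl.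
have d0 : 0 < d by rewrite lt_min divr_gt0 // divr_gt0.
have d1 : d <= 1 / 2 by rewrite ge_min lexx.
have dv : d * (6 * (v + 1)) <= e by rewrite -ler_pdivlMr // ge_min lexx orbT.
have [] := bnd d e d0 _ e0; first by lra.
have p : (1 - 3 * d) * v <= (1 - d) ^+ 3 * v.
  rewrite ler_wpM2r // -subr_ge0 (_ : _ - _ = d ^+ 2 * (3 - d)); last by ring.
  by rewrite mulr_ge0 ?sqr_ge0 //; lra.
clear -p dv d0 e0 v0; move=> b _; nra.
Qed.

End curve_volume.

Theorem corollary1p6 (R : realType) (L : R) (gamma : R -> 'rV[R]_3)
    (L_gt0 : 0 < L)
    (gamma_C3 : is_Ck 3 `[0, L] gamma)
    (gamma_closed : closed_curve L gamma)
    (gamma_simple : simple_curve L gamma)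
    (gamma_convex : convex_curve L gamma)
    (gamma_unit : unit_speed L gamma)
    (gamma_curv : nonvanishing_curvature L gamma)
    (gamma_planes : forall (nu : 'rV[R]_3) (c : R),
        nu != 0 -> (plane_count L gamma nu c <= 4%:E)%E) :
  vol (curve_hull L gamma) =
  ((24^-1)%:E *
   \int[@lebesgue_measure R]_(t1 in `[0%R, L])
     \int[@lebesgue_measure R]_(t2 in `[0%R, L])
       `|det3 (derive1n_in `[0%R, L] 1 gamma t1)
              (derive1n_in `[0%R, L] 1 gamma t2)
              (gamma t1 - gamma t2)|%:E)%E.
Proof.
have [der _] := gamma_C3.
have der0 : derivable_in `[0, L] gamma by exact: (der 0%N isT).
have der1 : derivable_in `[0, L] (derive1_in `[0, L] gamma) by exact: (der 1%N isT).
have loop : gamma 0 = gamma L by exact: (gamma_closed 0%N isT).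
rewrite (vol_curve_hull L_gt0 der0 der1 loop gamma_simple gamma_planes).
apply: congr1; rewrite /double_integral.
apply: eq_integral => s; rewrite inE /= => sL.
apply: eq_integral => t; rewrite inE /= => tL.
by rewrite /density /= !clampE.
Qed.
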